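(* Let $n\ge2$, let $\overrightarrow{C_n}$ be the cycle on $n$ vertices directed cyclically, and let $\lambda=(\lambda_1,\lambda_2,\dots,\lambda_k)$ be a partition of $n$. If $k\ge2$, then $$\sum_{\sigma\in N_{C_n,\lambda}}t^{\mathrm{inv}_{\overrightarrow{C_n}}(\sigma)}=n\,t\,A_{k-1}(t)\prod_{i=1}^k[\lambda_i]_t.$$ In the case $\lambda=(n)$, $$\sum_{\sigma\in N_{C_n,(n)}}t^{\mathrm{inv}_{\overrightarrow{C_n}}(\sigma)}=n\,t\,[n-1]_t.$$ Hence the coefficient of $\frac1n p_n$ in $\omega X_{\overrightarrow{C_n}}(\mathbf{x},t)$ is $nt[n-1]_t$, and for all other $\lambda=(\lambda_1,\dots,\lambda_k)\vdash n$ the coefficient of $z_\lambda^{-1}p_\lambda$ in $\omega X_{\overrightarrow{C_n}}(\mathbf{x},t)$ is $nt\,A_{k-1}(t)\prod_{i=1}^k[\lambda_i]_t$.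
   Context: $\overrightarrow{C_n}$ is the digraph on $[n]$ with directed edges $1\to2\to\cdots\to n\to1$, and $C_n$ is its underlying undirected graph (for $n=2$: the two directed edges $1\to2$, $2\to1$, with underlying graph a single edge). $[m]_t=1+t+\cdots+t^{m-1}$. $A_m(t)=\sum_{\pi\in\mathfrak{S}_m}t^{\mathrm{des}(\pi)}$ is the Eulerian polynomial, where $\mathrm{des}(\pi)=|\{i:\pi_i>\pi_{i+1}\}|$ (so $A_1=1$, $A_2=1+t$). For a digraph $\overrightarrow{G}=(V,E)$, a proper coloring is a map $\kappa:V\to\mathbb{P}=\{1,2,3,\dots\}$ with $\kappa(u)\ne\kappa(v)$ whenever $u,v$ are adjacent, $\mathrm{asc}(\kappa)=|\{(u,v)\in E:\kappa(u)<\kappa(v)\}|$ (where $(u,v)$ is directed from $u$ to $v$), and $$X_{\overrightarrow{G}}(\mathbf{x},t)=\sum_{\kappa}t^{\mathrm{asc}(\kappa)}\prod_{v\in V}x_{\kappa(v)},$$ summed over all proper colorings. For $\overrightarrow{G}=\overrightarrow{C_n}$ this is a polynomial in $t$ with symmetric function coefficients. $\omega$ is the usual involution on symmetric functions (exchanging $e_n$ and $h_n$), applied coefficientwise in $t$; $p_\lambda$ are the power sum symmetric functions; $z_\lambda=\prod_i i^{m_i}m_i!$ where $m_i$ is the number of parts of $\lambda$ equal to $i$. Let $\overrightarrow{G}=([n],E)$ with underlying undirected graph $G$, and let $\sigma=\sigma_1\cdots\sigma_n\in\mathfrak{S}_n$. $\mathrm{inv}_{\overrightarrow{G}}(\sigma)=|\{(i,j)\in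 E:\sigma^{-1}(j)<\sigma^{-1}(i)\}|$. For $x\in[n]$, $\mathrm{rank}_{(G,\sigma)}(x)$ is the length $k$ of the longest subword $\sigma_{i_1}\cdots\sigma_{i_k}$ with $i_1<\cdots<i_k$, $\sigma_{i_k}=x$, and $\{\sigma_{i_j},\sigma_{i_{j+1}}\}$ an edge of $G$ for each $1\le j<k$. $\sigma$ has a $G$-descent at $i$ ($1\le i\le n-1$) if either $\mathrm{rank}_{(G,\sigma)}(\sigma_i)>\mathrm{rank}_{(G,\sigma)}(\sigma_{i+1})$, or these ranks are equal and $\sigma_i>\sigma_{i+1}$. For a word $w=w_1\cdots w_k$ with distinct letters in $[n]$, a letter $w_j$ with $j>1$ is $G$-isolated if for all $i<j$ there is no edge of $G$ between $w_i$ and $w_j$. For a partition $\lambda=(\lambda_1\ge\cdots\ge\lambda_k)$ of $n$, $N_{G,\lambda}$ is the set of $\sigma\in\mathfrak{S}_n$ such that, when $\sigma$ is cut into contiguous segments $\alpha_1,\dots,\alpha_k$ of sizes $\lambda_1,\dots,\lambda_k$ in this order, each word $\alpha_i$ has no $G$-isolated letters and contains no $G$-descent of $\sigma$ (that is, $\sigma$ has no $G$-descent at any $j$ for which $\sigma_j$ and $\sigma_{j+1}$ both lie in the same segment). *)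

(* Defs.v *)
From mathcomp Require Import all_boot all_order all_algebra all_fingroup finmap.
From mathcomp Require Import boolp classical_sets functions fsbigop.
From mathcomp.multinomials Require Import monalg.

Set Implicit Arguments.
Unset Strict Implicit.
Unset Printing Implicit Defensive.

Import GRing.Theory.
Local Open Scope ring_scope.

(* Vertices and letters in [n] are elements of 'I_n (i stands for i+1), and
   a digraph is its relation of directed edges. *)

Definition adj (V : finType) (E : rel V) : rel V :=
  fun u v => E u v || E v u.

Definition cycle_digraph (n : nat) : rel 'I_n := fun i j => j == ordS i.

Definition is_partn (n : nat) (la : seq nat) : bool :=
  [&& sorted geq la, 0%N \notin la & sumn la == n].

Definition zpart (la : seq nat) : nat :=
  (\prod_(i <- undup la) (i ^ count_mem i la * (count_mem i la)`!))%N.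

Definition qint (m : nat) : {poly rat} := \sum_(i < m) 'X^i.

Definition des (m : nat) (s : 'S_m) : nat :=
  #|[set ij : 'I_m * 'I_m
      | (ij.2 == ij.1.+1 :> nat) && (s ij.2 < s ij.1)%N]|.

Definition eulerian (m : nat) : {poly rat} := \sum_(s : 'S_m) 'X^(des s).

Section Words.
Variables (n : nat) (E : rel 'I_n).

(* The one-line notation sigma_1 ... sigma_n: sigma_i is the image of i. *)
Definition word (s : 'S_n) : seq 'I_n := [seq s i | i <- enum 'I_n].

Definition inv_digraph (s : 'S_n) : nat :=
  #|[set ij : 'I_n * 'I_n
      | E ij.1 ij.2 && ((s^-1)%g ij.2 < (s^-1)%g ij.1)%N]|.

Definition walk_to (x : 'I_n) (w : seq 'I_n) : bool :=
  if w is y :: w' then path (adj E) y w' && (last y w' == x) else false.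

Definition rank_in (s : 'S_n) (x : 'I_n) : nat :=
  (\max_(w : n.-bseq 'I_n | subseq w (word s) && walk_to x w) size w)%N.

(* Whether the pair of consecutive letters (x, y) of sigma is a G-descent. *)
Definition gdescent (s : 'S_n) (x y : 'I_n) : bool :=
  (rank_in s y < rank_in s x)%N || (rank_in s x == rank_in s y) && (y < x)%N.

Definition isolated (w : seq 'I_n) (j : 'I_(size w)) : bool :=
  (0 < j)%N && ~~ has (adj E ^~ (tnth (in_tuple w) j)) (take j w).

(* Consecutive letters of a segment are consecutive letters of sigma, so
   [sorted] ranges over the positions j with sigma_j, sigma_{j+1} in it. *)
Definition good_segment (s : 'S_n) (a : seq 'I_n) : bool :=
  [forall j : 'I_(size a), ~~ isolated j]
  && sorted (fun x y => ~~ gdescent s x y) a.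

Definition Nset (la : seq nat) : {set 'S_n} :=
  [set s : 'S_n | all (good_segment s) (reshape la (word s))].

End Words.

(* Formal power series in x_0, x_1, ... (standing for x_1, x_2, ...), given by
   their coefficients at the monomials. As [fps R] is a function type, ring
   multiplication would be pointwise: the product of series is [psmul]. *)
Definition fps (R : Type) : Type := {cmonom nat} -> R.

Section PowerSeries.
Variable R : comNzRingType.
Implicit Types (f g : fps R) (m : {cmonom nat}).

Definition psconst (c : R) : fps R := fun m => if m == onecm nat then c else 0.

Definition psadd f g : fps R := fun m => f m + g m.

Definition psmul f g : fps R := fun m =>
  \sum_(ab \in [set ab : {cmonom nat} * {cmonom nat}
                 | mulcm ab.1 ab.2 = m]%classic) f ab.1 * g ab.2.

Definition elem (k : nat) : fps R := fun m =>
  ((mdeg m == k) && all (fun i => m i <= 1)%N (finsupp m))%:R.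

Definition complete (k : nat) : fps R := fun m => (mdeg m == k)%:R.

(* Only meaningful for k > 0. *)
Definition psum (k : nat) : fps R := fun m =>
  `[< exists i, m = expcmn (ucm i) k >]%:R.

Definition psum_part (la : seq nat) : fps R :=
  \big[psmul/psconst 1]_(k <- la) psum k.

(* The graph of the homomorphism of R-algebras mapping each e_k to h_k (and
   hence, being an involution, each h_k to e_k). Its domain, the R-algebra
   generated by the e_k, is that of symmetric functions over R; it is
   single-valued since the e_k (k > 0) are algebraically independent. *)
Inductive omega_graph : fps R -> fps R -> Prop :=
  | OmegaElem k : omega_graph (elem k) (complete k)
  | OmegaConst c : omega_graph (psconst c) (psconst c)
  | OmegaAdd f f' g g' : omega_graph f f' -> omega_graph g g' ->
      omega_graph (psadd f g) (psadd f' g')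
  | OmegaMul f f' g g' : omega_graph f f' -> omega_graph g g' ->
      omega_graph (psmul f g) (psmul f' g').

(* Zero outside the ring of symmetric functions. For R = {poly rat}, R-linearity
   makes this the coefficientwise application of omega over rat. *)
Definition omega f : fps R := xget (psconst 0) [set g | omega_graph f g]%classic.

End PowerSeries.

Section Chromatic.
Variables (V : finType) (E : rel V).
Implicit Type k : {ffun V -> nat}.

Definition proper_coloring k : Prop := forall u v, adj E u v -> k u <> k v.

Definition asc k : nat :=
  #|[set uv : V * V | E uv.1 uv.2 && (k uv.1 < k uv.2)%N]|.

Definition coloring_mon k : {cmonom nat} :=
  \big[@mulcm nat/onecm nat]_(v : V) ucm (k v).

(* The coefficient at m sums over the finitely many proper colorings with
   monomial m. *)
Definition chromatic : fps {poly rat} := fun m =>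
  \sum_(k \in [set k | proper_coloring k /\ coloring_mon k = m]%classic)
    ('X^(asc k) : {poly rat}).

End Chromatic.

(* The sum of c_la z_la^-1 p_la over the partitions la of n. *)
Definition psum_expansion (n : nat) (c : seq nat -> {poly rat}) :
    fps {poly rat} := fun m =>
  \sum_(la \in [set la | is_partn n la]%classic)
    ((zpart la)%:R^-1 : rat) *: (c la * psum_part {poly rat} la m).

(* Main.v *)
(* Cutting a permutation of N_{C_n,la} into segments colors the cycle, and its
   order relation orients it. The permutation is recovered from the coloring and
   the orientation (sort by segment, then rank, then letter); the condition on
   isolated letters says that each color class has a single source, and this
   forces the color classes to be arcs when k >= 2. The orientation between two arcs
   is forced by their colors, so cyclic arrangements of the arcs contribute
   t A_(k-1)(t), and an arc with l vertices contributes [l]_t by the position of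
   its source; the factor n is the rotation. For k = 1 one chooses the source and the
   sink of the orientation.

   The chromatic series is the trace of the n-th power of a matrix M with
   det(1 - M z) = (E(tz) - t E(z)) / (1 - t), E being the generating function of
   the e_k. Hence the traces are the coefficients of -z d/dz of the logarithm of
   this determinant. As E(tz) / E(z) = exp((t - 1) y) with y a series in the p_l,
   the exponential generating function of the Eulerian polynomials expands this in
   power sums. *)
Require Import Defs.
From mathcomp Require Import all_boot all_order all_algebra all_fingroup.
From mathcomp Require Import zify ring finmap.
From mathcomp Require Import boolp classical_sets functions fsbigop.
From mathcomp.multinomials Require Import monalg.

Set Implicit Arguments.
Unset Strict Implicit.
Unset Printing Implicit Defensive.

Import GRing.Theory.

(** * Words and ranks *)

(** The permutation sums and the chromatic series are computed independently and only turn out to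
    have the same coefficients.

    Ranks depend on the orientation alone, being lengths of longest directed paths. They exist as
    soon as both directions occur around the cycle, which the conditions on the data enforce. For k
    >= 2 the cycle is cut open where the arc of the largest colour begins. The step that leaves this
    arc always goes to a smaller colour, which gives the factor t, and the other k - 1 colours
    follow in any order, whence A_(k-1).

    On the algebraic side 1 - t is regular but not invertible, so quotients are replaced by products
    to be cancelled. With P = z E'/E, the traces have generating function t (z y') A(y) - P(tz),
    where A is the Eulerian exponential generating function. Integrating (z y') A(y) raises the
    powers of y by one, so that k parts meet A_(k-1). In degree n the term P(tz) is a multiple of
    p_n alone and turns n t [n]_t into n t [n-1]_t.

    As omega is defined by a relation, its value is known only once this relation is single-valued.
    That rests on the uniqueness of power sum expansions, proved in finitely many variables. *)

Section Words.
Variables (n : nat) (E : rel 'I_n) (s : 'S_n).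

Definition pos (x : 'I_n) : 'I_n := (s^-1)%g x.

Lemma pos_inj : injective pos. Proof. exact: perm_inj. Qed.

Lemma pos_perm i : pos (s i) = i. Proof. exact: permK. Qed.

Lemma perm_pos x : s (pos x) = x. Proof. exact: permKV. Qed.

Lemma word_uniq : uniq (word s).
Proof. by rewrite map_inj_uniq ?enum_uniq //; exact: perm_inj. Qed.

Lemma size_word : size (word s) = n.
Proof. by rewrite size_map size_enum_ord. Qed.

Lemma mem_word x : x \in word s.
Proof. by apply/mapP; exists (pos x); rewrite ?mem_enum ?perm_pos. Qed.

Definition poslt : rel 'I_n := fun x y => (pos x < pos y)%N.

Lemma poslt_trans : transitive poslt.
Proof. by move=> y x z; apply: ltn_trans. Qed.

Lemma poslt_irr : irreflexive poslt.
Proof. by move=> x; apply: ltnn. Qed.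

Lemma enum_ord_sorted : sorted (fun i j : 'I_n => (i < j)%N) (enum 'I_n).
Proof.
have : sorted ltn (map val (enum 'I_n)) by rewrite val_enum_ord iota_ltn_sorted.
by rewrite sorted_map.
Qed.

Lemma word_sorted : sorted poslt (word s).
Proof.
rewrite /word sorted_map; apply: sub_sorted enum_ord_sorted => i j.
by rewrite /= /poslt !pos_perm.
Qed.

Lemma subseq_word w : subseq w (word s) = sorted poslt w.
Proof.
apply/idP/idP => [h|sw].
  by apply: (subseq_sorted poslt_trans h); apply: word_sorted.
have -> : w = filter (mem w) (word s); last exact: filter_subseq.
apply: (irr_sorted_eq poslt_trans poslt_irr) => //.
  by apply: sorted_filter word_sorted; apply: poslt_trans.
by move=> x; rewrite mem_filter mem_word andbT.
Qed.

(** Precedence is a strict order, so a word sorted by it has distinct letters and fits the length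
    bound [n] of the maximum. *)
Lemma rank_in_ge x w : sorted poslt w -> walk_to E x w -> (size w <= rank_in E s x)%N.
Proof.
move=> sw wx; have sz : (size w <= n)%N.
  have /card_uniqP <- := sorted_uniq poslt_trans poslt_irr sw.
  by apply: leq_trans (max_card _) _; rewrite card_ord.
rewrite /rank_in (bigD1 (Bseq sz)) /= ?leq_maxl //.
by rewrite subseq_word sw wx.
Qed.

Lemma rank_in_attained x :
  exists w, [/\ sorted poslt w, walk_to E x w & size w = rank_in E s x].
Proof.
have n0 : (0 < n)%N by apply: leq_ltn_trans (ltn_ord x).
have [|w] := @eq_bigmax_cond _ [pred w : n.-bseq 'I_n | subseq w (word s) && walk_to E x w]
   (fun w : n.-bseq 'I_n => size w).
  by apply/card_gt0P; exists (Bseq (n0 : size [:: x] <= n)%N); rewrite inE subseq_word /= eqxx.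
by rewrite inE subseq_word => /andP[sw wx] e; exists w.
Qed.

Lemma rank_in_gt0 x : (0 < rank_in E s x)%N.
Proof. by apply: (@rank_in_ge x [:: x]) => //=. Qed.

Lemma walk_to_rcons x w z : walk_to E x (rcons w z) =
  (z == x) && (if w is y :: w' then path (adj E) y w' && adj E (last y w') z else true).
Proof. by case: w => [|y w] /=; rewrite ?andbT // rcons_path last_rcons andbC. Qed.

Lemma rank_in_lt x y : adj E y x -> poslt y x -> (rank_in E s y < rank_in E s x)%N.
Proof.
move=> yx pyx; have [w [sw wy <-]] := rank_in_attained y.
case: w sw wy => [|z w] // sw /andP[pw /eqP ly].
rewrite -(size_rcons _ x); apply: rank_in_ge; last first.
  by rewrite walk_to_rcons eqxx pw ly.
by rewrite /= rcons_path ly pyx andbT; exact: sw.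
Qed.

(** The witness is the last letter but one of a longest walk to [x]. *)
Lemma rank_in_parent x : rank_in E s x = 1%N \/
  exists y, [/\ adj E y x, poslt y x & rank_in E s x = (rank_in E s y).+1].
Proof.
have [w [sw wx e]] := rank_in_attained x.
case: (lastP w) sw wx e => [|w' z] // sw; rewrite walk_to_rcons => /andP[/eqP zx].
case: w' sw => [|y w'] sw; first by left.
case/andP=> pw lx e; right; exists (last y w'); rewrite -zx.
move: sw; rewrite /= rcons_path => /andP[sw plx]; split=> //.
apply/eqP; rewrite eqn_leq rank_in_lt // andbT zx -e size_rcons ltnS.
by apply: rank_in_ge; rewrite //= pw eqxx.
Qed.

End Words.

(** The recursion of longest paths: 1 plus the maximum over the predecessors. Only the relation [e]
    enters, so ranks can be compared between permutations with the same orientation. *)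
Definition is_rank (n : nat) (e : rel 'I_n) (f : 'I_n -> nat) : Prop :=
  [/\ forall x, (0 < f x)%N,
      forall x y, e y x -> (f y < f x)%N
    & forall x, f x = 1%N \/ exists2 y, e y x & f x = (f y).+1].

(** Induction on the value of one function: its predecessor [y] at [x] has a smaller value, and the
    other function must also grow from [y] to [x]. *)
Lemma is_rank_uniq n (e : rel 'I_n) f g : is_rank e f -> is_rank e g -> f =1 g.
Proof.
have H f1 g1 : is_rank e f1 -> is_rank e g1 -> forall x, (f1 x <= g1 x)%N.
  case=> f0 f2 f3 [g0 g2 g3] x; move: {2}(f1 x) (leqnn (f1 x)) => m.
  elim: m x => [|m IH] x fm; first by rewrite leqNgt in fm; rewrite f0 in fm.
  case: (f3 x) => [->|[y yx fx]]; first exact: g0.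
  by rewrite fx (leq_ltn_trans (IH y _) (g2 _ _ yx)) // -ltnS -fx.
by move=> hf hg x; apply/eqP; rewrite eqn_leq !H.
Qed.

Lemma rank_in_is_rank n (E : rel 'I_n) s :
  is_rank (fun y x => adj E y x && poslt s y x) (rank_in E s).
Proof.
split=> [x|x y /andP[yx pyx]|x]; first exact: rank_in_gt0.
  exact: rank_in_lt.
by case: (rank_in_parent E s x) => [|[y [yx pyx e]]]; [left|right; exists y; rewrite ?yx].
Qed.

(** * Segments of a word as fibres of a colouring *)

Fixpoint blocks (k : nat) (la : seq nat) : seq nat :=
  if la is l :: la' then nseq l k ++ blocks k.+1 la' else [::].

Lemma size_blocks k la : size (blocks k la) = sumn la.
Proof. by elim: la k => //= l la IH k; rewrite size_cat size_nseq IH. Qed.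

Lemma mem_blocks k la j : j \in blocks k la -> (k <= j < k + size la)%N.
Proof.
elim: la k => //= l la IH k; rewrite mem_cat mem_nseq => /orP[/andP[_ /eqP ->]|/IH]; lia.
Qed.

Lemma count_blocks k la j : count_mem (k + j) (blocks k la) = nth 0 la j.
Proof.
elim: la k j => [|l la IH] k [|j] //=; rewrite count_cat count_nseq /=.
  rewrite addn0 eqxx mul1n (_ : count _ _ = 0) ?addn0 //.
  by apply/count_memPn/negP => /mem_blocks; rewrite ltnn.
by rewrite addnS -addSn IH (_ : (k == _) = false) ?mul0n //; lia.
Qed.

Lemma blocks_sorted k la : sorted leq (blocks k la).
Proof.
elim: la k => //= l la IH k; elim: l => //= l IHl.
rewrite path_sortedE ?IHl ?andbT; last exact: leq_trans.
rewrite all_cat all_nseq leqnn orbT /=; apply/allP => j /mem_blocks; lia.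
Qed.

(** Trades the cutting of a word by positions for the fibres of a colouring, the form in which
    segments can be followed around the cycle. *)
Lemma reshape_blocks (T : eqType) (c : T -> nat) (w : seq T) k la :
  map c w = blocks k la ->
  reshape la w = [seq [seq x <- w | c x == j] | j <- iota k (size la)].
Proof.
elim: la k w => [|l la IH] k w //= e.
have lw : (l <= size w)%N by rewrite -(size_map c) e size_cat size_nseq leq_addr.
have e1 : map c (take l w) = nseq l k.
  by rewrite map_take e take_size_cat // size_nseq.
have e2 : map c (drop l w) = blocks k.+1 la.
  by rewrite map_drop e drop_size_cat // size_nseq.
have c1 x : x \in take l w -> c x = k.
  by move=> /(map_f c); rewrite e1 mem_nseq => /andP[_ /eqP].
have c2 x : x \in drop l w -> (k < c x)%N.
  by move=> /(map_f c); rewrite e2 => /mem_blocks /andP[].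
rewrite (IH _ _ e2); congr (_ :: _).
  rewrite -{2}(cat_take_drop l w) filter_cat (_ : filter _ (drop _ _) = [::]) ?cats0.
    by apply/esym/all_filterP/allP => x /c1 ->.
  by apply/eqP; rewrite -[_ == _]negbK -has_filter; apply/hasPn => x /c2 h; rewrite gtn_eqF.
apply/eq_in_map => j; rewrite mem_iota => /andP[kj _].
rewrite -[in RHS](cat_take_drop l w) filter_cat (_ : filter _ (take _ _) = [::]) //.
by apply/eqP; rewrite -[_ == _]negbK -has_filter; apply/hasPn => x /c1 ->; rewrite ltn_eqF.
Qed.

Section Segments.
Variables (n : nat) (E : rel 'I_n) (s : 'S_n) (la : seq nat).
Hypothesis sla : sumn la = n.

Definition block_of (x : 'I_n) : nat := nth 0 (blocks 0 la) (pos s x).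

Lemma map_block_of : map block_of (word s) = blocks 0 la.
Proof.
apply: (@eq_from_nth _ 0) => [|i].
  by rewrite size_map size_word size_blocks sla.
rewrite size_map size_word => i_n.
rewrite -[i]/(val (Ordinal i_n)) -map_comp (nth_map (Ordinal i_n)) ?size_enum_ord //=.
by rewrite (nth_ord_enum _ (Ordinal i_n)) /block_of pos_perm.
Qed.

Lemma block_of_lt x : (block_of x < size la)%N.
Proof. by have /mem_blocks : block_of x \in blocks 0 la by rewrite -map_block_of map_f ?mem_word. Qed.

Lemma block_of_le x y : poslt s x y -> (block_of x <= block_of y)%N.
Proof.
move=> xy; apply: (sorted_leq_nth leq_trans leqnn 0 (blocks_sorted 0 la)).
- by rewrite inE size_blocks sla ltn_ord.
- by rewrite inE size_blocks sla ltn_ord.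
- exact: ltnW.
Qed.

Definition fiber j := [seq x <- word s | block_of x == j].

Lemma mem_fiber j x : (x \in fiber j) = (block_of x == j).
Proof. by rewrite mem_filter mem_word andbT. Qed.

Lemma fiber_sorted j : sorted (poslt s) (fiber j).
Proof. by apply: sorted_filter; [exact: poslt_trans | exact: word_sorted]. Qed.

Lemma index_fiber j x y : x \in fiber j -> y \in fiber j ->
  (index x (fiber j) < index y (fiber j))%N = poslt s x y.
Proof.
move=> xj yj; apply/idP/idP.
  exact: (sorted_ltn_index (@poslt_trans n s) (fiber_sorted j)).
case: (ltngtP (index x _)) => // [h xy|h].
  have := sorted_ltn_index (@poslt_trans n s) (fiber_sorted j) y x yj xj h.
  by rewrite /poslt ltnNge ltnW.
by rewrite (index_inj x xj yj h) poslt_irr.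
Qed.

(** Not being a descent is the weak lexicographic order on pairs (rank, letter). *)
Lemma gdescent_trans : transitive (fun x y => ~~ gdescent E s x y).
Proof. move=> y x z; rewrite /gdescent; lia. Qed.

(** Removes all indices: by transitivity the condition on consecutive letters holds for all pairs,
    and a letter is not the first of its segment exactly when some letter of the segment precedes
    it. *)
Lemma good_fiberP j : reflect
  ((forall x y, block_of x = j -> block_of y = j -> poslt s x y -> ~~ gdescent E s x y) /\
   (forall x y, block_of x = j -> block_of y = j -> poslt s y x ->
     exists z, [/\ block_of z = j, adj E z x & poslt s z x]))
  (good_segment E s (fiber j)).
Proof.
have inF x : block_of x = j -> x \in fiber j by rewrite mem_fiber => ->.
have Fin x : x \in fiber j -> block_of x = j by rewrite mem_fiber => /eqP.
apply: (iffP andP) => -[h1 h2]; split.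
- move=> x y /inF xj /inF yj xy.
  by have := sorted_ltn_index gdescent_trans h2 x y xj yj; rewrite index_fiber //; apply.
- move=> x y /inF xj /inF yj yx.
  have xs : (index x (fiber j) < size (fiber j))%N by rewrite index_mem.
  have := forallP h1 (Ordinal xs); rewrite /isolated /= (leq_ltn_trans _ (_ : index y (fiber j) < _)%N) ?index_fiber //=.
  rewrite negbK => /hasP[z zt]; rewrite (tnth_nth x) /= nth_index // => zx.
  have zj : z \in fiber j by apply: mem_take zt.
  exists z; split=> //; first exact: Fin.
  by rewrite -(index_fiber zj xj); rewrite in_take in zt.
- apply/forallP => i; rewrite /isolated; case: (posnP i) => //= i0.
  pose x0 : 'I_n := tnth (in_tuple (fiber j)) i.
  rewrite negbK (tnth_nth x0) /=; set x := nth x0 _ _; set y := nth x0 (fiber j) 0.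
  have xj : x \in fiber j by rewrite mem_nth.
  have yj : y \in fiber j by rewrite mem_nth // (leq_ltn_trans _ (ltn_ord i)).
  have uF : uniq (fiber j) by rewrite filter_uniq // word_uniq.
  have yx : poslt s y x.
    by rewrite -(index_fiber yj xj) !index_uniq // (leq_ltn_trans _ (ltn_ord i)).
  have [z [/inF zj zx pz]] := h2 _ _ (Fin _ xj) (Fin _ yj) yx.
  apply/hasP; exists z => //; rewrite in_take //.
  by move: pz; rewrite -(index_fiber zj xj) index_uniq.
- rewrite sorted_pairwise; last exact: gdescent_trans.
  have := fiber_sorted j; rewrite sorted_pairwise; last exact: poslt_trans.
  have : all (fun x => block_of x == j) (fiber j) by apply/allP => x; rewrite mem_fiber.
  elim: (fiber j) => //= x a IH /andP[/eqP xj aj] /andP[xa sa]; rewrite IH // andbT.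
  by apply/allP => y ya; apply: h1 => //; [apply/eqP; exact: (allP aj) | exact: (allP xa)].
Qed.

Lemma NsetP : reflect
  ((forall x y, poslt s x y -> block_of x = block_of y -> ~~ gdescent E s x y) /\
   (forall x y, poslt s y x -> block_of y = block_of x ->
     exists z, [/\ block_of z = block_of x, adj E z x & poslt s z x]))
  (s \in Nset E la).
Proof.
rewrite inE (reshape_blocks map_block_of) all_map.
apply: (iffP allP) => [h|[h1 h2] j _].
  have h' x : good_segment E s (fiber (block_of x)).
    by apply: h; rewrite mem_iota block_of_lt.
  split=> x y xy e; have [h1 h2] := good_fiberP _ (h' x); first exact: h1.
  exact: h2 xy.
apply/good_fiberP; split=> x y xj yj xy; first by apply: h1; rewrite ?xj ?yj.
by rewrite -xj; apply: h2 xy _; rewrite xj.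
Qed.

End Segments.

(** * Orientations of the cycle *)

Section CyclicOrder.
Variable n : nat.

Lemma val_iter_ordS k (x : 'I_n) : iter k (@ordS n) x = (x + k) %% n :> nat.
Proof.
elim: k => [|k IH] /=; first by rewrite addn0 modn_small.
by rewrite IH -addn1 modnDml -addnA addn1.
Qed.

Lemma ordS_reach (x y : 'I_n) : exists k, iter k (@ordS n) x = y.
Proof.
exists (n - x + y); apply: val_inj; rewrite /= val_iter_ordS addnA subnKC; last exact: ltnW.
by rewrite modnDl modn_small.
Qed.

Lemma ord_pred_reach (x y : 'I_n) : exists k, iter k (@ord_pred n) x = y.
Proof.
have [k <-] := ordS_reach y x; exists k.
by elim: k => //= k IH; rewrite -iterS iterSr ordSK IH.
Qed.

Lemma ordS_neq (x : 'I_n) : 1 < n -> ordS x != x.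
Proof.
move=> n1; apply/eqP => /(congr1 val) /=; have := ltn_ord x.
case: (ltnP x.+1 n) => h; first by rewrite modn_small //; lia.
have -> : x.+1 = n by have := ltn_ord x; lia.
by rewrite modnn; lia.
Qed.

(* An orientation d of the cycle: d i tells that i+1 precedes i, and [ed d y x]
   that y and x are neighbours with y preceding x. *)
Definition ed (d : 'I_n -> bool) : rel 'I_n :=
  fun y x => (x == ordS y) && ~~ d y || (y == ordS x) && d x.

(** When both directions occur, a directed path stays on a stretch of equally directed edges. A
    longest path to [x] therefore arrives from one side or the other, with [a x] edges through the
    cyclic predecessors or [b x] edges through the successors, and the rank is 1 plus the
    maximum. *)
Lemma ed_rank (d : 'I_n -> bool) : (exists i, d i) -> (exists i, ~~ d i) ->
  exists f, is_rank (ed d) f.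
Proof.
move=> [i1 d1] [i0 d0].
have exA x : exists k, d (ord_pred (iter k (@ord_pred n) x)).
  by have [k e] := ord_pred_reach (ord_pred x) i1; exists k; rewrite -iterS iterSr e.
have exB x : exists k, ~~ d (iter k (@ordS n) x).
  by have [k e] := ordS_reach x i0; exists k; rewrite e.
pose a x := ex_minn (exA x); pose b x := ex_minn (exB x).
have a0 x : d (ord_pred x) -> a x = 0.
  by rewrite /a; case: ex_minnP => m _ /(_ 0) h /h; rewrite leqn0 => /eqP.
have b0 x : ~~ d x -> b x = 0.
  by rewrite /b; case: ex_minnP => m _ /(_ 0) h /h; rewrite leqn0 => /eqP.
have aS x : ~~ d (ord_pred x) -> a x = (a (ord_pred x)).+1.
  rewrite /a; case: ex_minnP => -[|m]; first by move=> /= ->.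
  rewrite iterSr => dm mm _; case: ex_minnP => k dk kk; congr _.+1.
  by apply/eqP; rewrite eqn_leq kk // andbT -ltnS mm // iterSr.
have bS x : d x -> b x = (b (ordS x)).+1.
  rewrite /b; case: ex_minnP => -[|m]; first by move=> /= /negPf ->.
  rewrite iterSr => dm mm _; case: ex_minnP => k dk kk; congr _.+1.
  by apply/eqP; rewrite eqn_leq kk // andbT -ltnS mm // iterSr.
exists (fun x => (maxn (a x) (b x)).+1); split=> // [x y|x].
  case/orP => /andP[/eqP -> dy].
    by rewrite (b0 y) // (aS (ordS y)) ordSK //; lia.
  by rewrite (a0 (ordS x)) ?ordSK // (bS x) //; lia.
case: (boolP (d (ord_pred x))) => dp; case: (boolP (d x)) => dx.
- right; exists (ordS x); first by rewrite /ed eqxx dx orbT.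
  by rewrite (a0 x) // (bS x) // (a0 (ordS x)) ?ordSK //; lia.
- by left; rewrite a0 // b0.
- have [ab|ba] := leqP (b x) (a x).
    right; exists (ord_pred x); first by rewrite /ed ord_predK eqxx dp.
    by move: ab; rewrite (aS x) // (b0 (ord_pred x)) //; lia.
  right; exists (ordS x); first by rewrite /ed eqxx dx orbT.
  by move: ba; rewrite (bS x) // (a0 (ordS x)) ?ordSK //; lia.
- right; exists (ord_pred x); first by rewrite /ed ord_predK eqxx dp.
  by rewrite (aS x) // (b0 x) // (b0 (ord_pred x)) //; lia.
Qed.

Definition keylt (c f : 'I_n -> nat) : rel 'I_n := fun x y =>
  (c x < c y) || (c x == c y) && ((f x < f y) || (f x == f y) && (x < y)).

Lemma keylt_trans c f : transitive (keylt c f).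
Proof. by move=> y x z; rewrite /keylt; lia. Qed.

Lemma keylt_irr c f : irreflexive (keylt c f).
Proof. by move=> x; rewrite /keylt; lia. Qed.

Lemma keylt_total c f x y : x != y -> keylt c f x y = ~~ keylt c f y x.
Proof. by rewrite -val_eqE /keylt /=; lia. Qed.

Lemma keylt_perm c f : exists s : 'S_n, forall x y, poslt s x y = keylt c f x y.
Proof.
pose le x y := (x == y) || keylt c f x y; pose w := sort le (enum 'I_n).
have le_trans : transitive le.
  move=> y x z /orP[/eqP->//|xy] /orP[/eqP <-|yz]; rewrite /le ?xy ?orbT //.
  by rewrite (keylt_trans xy yz) orbT.
have le_total : total le.
  by move=> x y; rewrite /le eq_sym; case: eqP => //= /eqP yx; rewrite keylt_total 1?eq_sym // orNb.
have uw : uniq w by rewrite sort_uniq enum_uniq.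
have sw : size w = n by rewrite size_sort size_enum_ord.
have mw x : x \in w by rewrite mem_sort mem_enum.
have lew : sorted le w by apply: sort_sorted.
have ix x : index x w < n by rewrite -[X in _ < X]sw index_mem.
have fI : injective (fun x => Ordinal (ix x)).
  by move=> x y [] /(index_inj x (mw x) (mw y)).
(* [perm fI] sends a letter to its index in the sorted list; it is the position map, that is, the
   inverse of the permutation sought. *)
exists (perm fI)^-1%g => x y; rewrite /poslt /pos invgK !permE /=.
have H u v : index u w < index v w -> keylt c f u v.
  move=> h; have /orP[/eqP e|//] := sorted_ltn_index le_trans lew u v (mw u) (mw v) h.
  by move: h; rewrite e ltnn.
case: (ltngtP (index x w) (index y w)) => [/H ->//|/H h|/(index_inj x (mw x) (mw y)) ->].
  by apply/esym/negbTE/negP => h2; have := keylt_trans h h2; rewrite keylt_irr.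
by rewrite keylt_irr.
Qed.

End CyclicOrder.

(** * Permutations as pairs of a colouring and an orientation *)

Section SegmentData.
Variables (n K : nat) (la : seq nat).
Hypotheses (n1 : 1 < n) (sla : sumn la = n) (la0 : 0 \notin la) (laK : size la = K.+1).
Let E := @cycle_digraph n.
Implicit Types (s : 'S_n) (c : {ffun 'I_n -> 'I_K.+1}) (d : {ffun 'I_n -> bool}).

Definition seg_block s : {ffun 'I_n -> 'I_K.+1} := [ffun x => inord (block_of s la x)].
Definition seg_dir s : {ffun 'I_n -> bool} := [ffun i => poslt s (ordS i) i].

Definition block_root c d x := [forall y, ~~ (ed d y x && (c y == c x))].

(* The data (c, d) of a permutation: c x is the segment containing x and d the
   orientation of the cycle by precedence. A segment has no isolated letter iff
   its first letter is its only root. *)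
Definition valid_data (p : {ffun 'I_n -> 'I_K.+1} * {ffun 'I_n -> bool}) :=
  [&& [forall j : 'I_K.+1, #|[set x | p.1 x == j]| == nth 0 la j],
      [forall i, (p.1 i < p.1 (ordS i)) ==> ~~ p.2 i],
      [forall i, (p.1 (ordS i) < p.1 i) ==> p.2 i]
    & [forall j, #|[set x | (p.1 x == j) && block_root p.1 p.2 x]| == 1]].

Lemma val_seg_block s x : seg_block s x = block_of s la x :> nat.
Proof. by rewrite ffunE inordK // -laK block_of_lt. Qed.

Lemma poslt_total s x y : x != y -> poslt s x y = ~~ poslt s y x.
Proof.
move=> xy; rewrite /poslt -leqNgt [RHS]leq_eqVlt (inj_eq (@ord_inj n)).
by rewrite (inj_eq (@pos_inj _ s)) (negPf xy).
Qed.

Lemma ed_poslt s y x : adj E y x && poslt s y x = ed (seg_dir s) y x.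
Proof.
rewrite /adj /E /cycle_digraph /ed !ffunE.
case: (eqVneq x (ordS y)) => [->|_] /=.
  rewrite -poslt_total; last by rewrite eq_sym ordS_neq.
  (* The two vertices are neighbours in both cyclic directions only for n = 2; both disjuncts of
     [ed] then say the same. *)
  by case: (eqVneq y (ordS (ordS y))) => [<-|_]; rewrite ?orbb ?orbF.
by case: eqP => [->|].
Qed.

Lemma rank_seg_dir s : is_rank (ed (seg_dir s)) (rank_in E s).
Proof.
have [h1 h2 h3] := rank_in_is_rank E s; split=> // [x y|x].
  by rewrite -ed_poslt; exact: h2.
by case: (h3 x) => [|[y yx e]]; [left | right; exists y; rewrite -?ed_poslt].
Qed.

Lemma Nset_keylt s : s \in Nset E la ->
  forall x y, poslt s x y -> keylt (fun x => seg_block s x) (rank_in E s) x y.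
Proof.
case/(NsetP _ _ sla) => h _ x y xy.
have bxy := block_of_le sla xy.
have xney : x != y by apply: contraTneq xy => ->; rewrite poslt_irr.
move: (h x y xy); rewrite /keylt !val_seg_block /gdescent.
by rewrite -val_eqE /= in xney; lia.
Qed.

(** Equal orientations give equal ranks by [is_rank_uniq], so both words list all letters in
    increasing order for the same strict order [keylt]. *)
Lemma seg_data_inj : {in Nset E la &, injective (fun s => (seg_block s, seg_dir s))}.
Proof.
move=> s s' sN s'N [eb ed'].
have er : rank_in E s =1 rank_in E s'.
  by apply: (is_rank_uniq (rank_seg_dir s)); rewrite ed'; apply: rank_seg_dir.
have w1 : sorted (keylt (fun x => seg_block s x) (rank_in E s)) (word s).
  by apply: sub_sorted (word_sorted s) => x y; exact: Nset_keylt.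
have w2 : sorted (keylt (fun x => seg_block s x) (rank_in E s)) (word s').
  apply: sub_sorted (word_sorted s') => x y /(Nset_keylt s'N).
  by rewrite /keylt eb !er.
have ew : word s = word s'.
  apply: (irr_sorted_eq (@keylt_trans n _ _) (@keylt_irr n _ _) w1 w2) => x.
  by rewrite !mem_word.
apply/permP => x; have /eq_in_map -> // : map s (enum 'I_n) = map s' (enum 'I_n) by exact: ew.
by rewrite mem_enum.
Qed.

Lemma card_word s (P : pred 'I_n) : #|[set x | P x]| = count P (word s).
Proof.
rewrite cardsE cardE size_filter -enumT; apply/seq.permP.
apply: uniq_perm; rewrite ?enum_uniq ?word_uniq // => x.
by rewrite mem_word mem_enum.
Qed.

Lemma first_in_block s (j : nat) : (exists x, block_of s la x = j) ->
  exists2 m, block_of s la m = j & forall x, block_of s la x = j -> x != m -> poslt s m x.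
Proof.
case=> x0 /eqP x0j; case: (@arg_minnP _ x0 (fun x => block_of s la x == j) (pos s) x0j) => m /eqP mj mm.
exists m => // x /eqP xj xm; rewrite /poslt ltn_neqAle mm // andbT.
by rewrite (inj_eq (@ord_inj n)) (inj_eq (@pos_inj _ s)) eq_sym.
Qed.

Lemma first_root s m : (forall x, block_of s la x = block_of s la m -> x != m -> poslt s m x) ->
  block_root (seg_block s) (seg_dir s) m.
Proof.
move=> mm; apply/forallP => y; apply/negP => /andP[]; rewrite -ed_poslt => /andP[_ ym].
rewrite -val_eqE /= !val_seg_block => /eqP e.
have [yem|/mm] := eqVneq y m; first by move: ym; rewrite yem poslt_irr.
by rewrite e => /(_ erefl); rewrite poslt_total ?ym //; apply: contraTneq ym => ->; rewrite poslt_irr.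
Qed.

Lemma seg_data_valid s : s \in Nset E la -> valid_data (seg_block s, seg_dir s).
Proof.
case/(NsetP _ _ sla) => h1 h2; apply/and4P; split; apply/forallP => /= j.
- rewrite (card_word s).
  rewrite (eq_count (a2 := preim (block_of s la) (pred1 (val j)))); last first.
    by move=> x; rewrite /= -val_eqE /= val_seg_block.
  by rewrite -count_map map_block_of // -[val j]add0n count_blocks.
- rewrite !val_seg_block ffunE; apply/implyP; rewrite ltnNge.
  by apply: contra; apply: block_of_le.
- rewrite !val_seg_block ffunE; apply/implyP; rewrite ltnNge.
  apply: contraNT; rewrite -poslt_total 1?eq_sym ?ordS_neq //.
  exact: block_of_le.
have [|m mj mm] := @first_in_block s j.
  have : val j \in blocks 0 la.
    rewrite -has_pred1 has_count -[val j]add0n count_blocks.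
    have jK : j < size la by rewrite laK.
    by rewrite lt0n; apply: contraNneq la0 => <-; rewrite mem_nth.
  by rewrite -(map_block_of s sla) => /mapP[x _ ->]; exists x.
apply/cards1P; exists m; apply/setP => x; rewrite !inE -val_eqE /= val_seg_block.
apply/andP/eqP => [[/eqP xj xr]|->]; last first.
  by rewrite mj eqxx; split=> //; apply: first_root => x' e; apply: mm; rewrite e.
apply/eqP; apply: contraTT xr => xm.
have [|z [zx za pz]] := h2 x m (mm _ xj xm); first by rewrite xj mj.
rewrite negb_forall; apply/existsP; exists z; rewrite negbK -ed_poslt za pz /=.
by rewrite -val_eqE /= !val_seg_block zx.
Qed.

(** The conditions on roots and colours exclude a directed cycle, so ranks exist; sorting by colour,
    rank and letter gives the permutation, whose ranks are again the given ones by uniqueness. *)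
Lemma valid_exists c d : valid_data (c, d) ->
  exists2 s, s \in Nset E la & (seg_block s, seg_dir s) = (c, d).
Proof.
case/and4P => /= /forallP v1 /forallP v2 /forallP v3 /forallP v4.
have mono (r : rel nat) : reflexive r -> transitive r ->
    (forall i, r (c i) (c (ordS i))) -> forall x y, r (c x) (c y).
  move=> rr rt h x y; have [k <-] := ordS_reach x y.
  by elim: k => //= k IH; apply: rt IH (h _).
have root_ex : exists x, block_root c d x.
  have /cards1P[x /setP/(_ x)] := v4 ord0; rewrite !inE eqxx => /andP[_ h].
  by exists x.
(* With no edge reversed the colours would increase weakly all around the cycle, hence be constant;
   a root would then have its cyclic predecessor before it in its own class. [dF] below is the
   mirror image. *)
have dT : exists i, d i.
  apply/existsP; apply: contraT; rewrite negb_exists => /forallP nd.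
  have cc : forall x y, c x <= c y.
    apply: mono => [i|i j k|i]; [exact: leqnn | exact: leq_trans |].
    by rewrite leqNgt; apply/negP => h; have := v3 i; rewrite h (negPf (nd i)).
  case: root_ex => x /forallP/(_ (ord_pred x)).
  by rewrite /ed ord_predK eqxx nd /= -val_eqE eqn_leq !cc.
have dF : exists i, ~~ d i.
  apply/existsP; apply: contraT; rewrite negb_exists => /forallP nd.
  have cc : forall x y, c x >= c y.
    apply: (mono geq) => [i|i j k|i]; [exact: leqnn | exact: (rev_trans leq_trans) |].
    by rewrite /geq /= leqNgt; apply/negP => h; have := v2 i; rewrite h (negPf (nd i)).
  case: root_ex => x /forallP/(_ (ordS x)); have := nd x; rewrite negbK => dx.
  by rewrite /ed eqxx dx orbT /= -val_eqE eqn_leq !cc.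
have [f fr] := ed_rank dT dF.
have [s Hs] := keylt_perm (fun x => val (c x)) f.
have bc x : block_of s la x = c x.
  have : map (block_of s la) (word s) = map (fun x => val (c x)) (word s).
    rewrite map_block_of //; apply: (sorted_eq leq_trans anti_leq (blocks_sorted 0 la)).
      rewrite sorted_map; apply: sub_sorted (word_sorted s) => u v.
      by rewrite Hs /keylt /=; lia.
    apply/allP => j _ /=; rewrite -[j]add0n count_blocks count_map add0n.
    have [jK|Kj] := ltnP j K.+1.
      have := v1 (Ordinal jK); rewrite (card_word s) => /eqP <-; apply/eqP.
      by apply: eq_count => y; rewrite /= -val_eqE.
    rewrite nth_default ?laK // eq_sym -leqn0 leqNgt -has_count; apply/hasPn => y _ /=.
    by rewrite neq_ltn (leq_trans (ltn_ord (c y))).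
  by move/eq_in_map => /(_ x (mem_word s x)).
have sb : seg_block s = c by apply/ffunP => x; apply: val_inj; rewrite [LHS]val_seg_block bc.
have sd : seg_dir s = d.
  apply/ffunP => i; rewrite ffunE Hs /keylt.
  have [_ f2 _] := fr.
  have := v2 i; have := v3 i; case: (ltngtP (c i) (c (ordS i))) => //= _.
    by move=> _ /negPf.
  move=> _ _; case di: (d i).
    by have -> : f (ordS i) < f i by apply: f2; rewrite /ed eqxx di orbT.
  have : f i < f (ordS i) by apply: f2; rewrite /ed eqxx di.
  lia.
have rk : rank_in E s =1 f.
  by apply: is_rank_uniq (rank_seg_dir s) _; rewrite sd.
exists s; last by rewrite sb sd.
apply/(NsetP _ _ sla); split=> [x y xy|x y yx].
  by rewrite !bc /gdescent !rk => e; move: xy; rewrite Hs /keylt /=; lia.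
move=> exy.
have [|m mj mm] := @first_in_block s (block_of s la x); first by exists x.
have mr : block_root c d m.
  by rewrite -sb -sd; apply: first_root => z; rewrite mj => zj; exact: mm.
have xm : x != m.
  apply: contraTneq yx => xm; have [->|yx] := eqVneq y x; first by rewrite poslt_irr.
  by rewrite poslt_total // negbK xm; apply: mm; rewrite // -xm.
(* The first letter [m] of the segment is a root and the only one of its colour, so [x] is none;
   what disqualifies it is the required neighbour. *)
have /existsP[z] : ~~ block_root c d x.
  apply: contra xm => xr; have /cards1P[r /setP hr] := v4 (c x).
  have := hr x; have := hr m; rewrite !inE eqxx xr mr -val_eqE /= -!bc mj eqxx.
  by move=> /esym /eqP -> /esym.
rewrite negbK -{1}sd -ed_poslt => /andP[/andP[za zp] /eqP zc].
by exists z; rewrite !bc zc.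
Qed.

End SegmentData.

Local Open Scope ring_scope.

(** * Truncated power series *)

Section TruncatedSeries.
Variable K : comNzRingType.
Implicit Types (f g h : {poly K}) (D : nat).

(** Congruence modulo ['X^D.+1]: power series are represented by polynomials up to this
    congruence. *)
Definition eqmod D f g := forall i, (i <= D)%N -> f`_i = g`_i.

Lemma eqmod_refl D f : eqmod D f f.
Proof. by []. Qed.

Lemma eqmod_eq D f g : f = g -> eqmod D f g.
Proof. by move=> ->. Qed.

Lemma eqmod_sym D f g : eqmod D f g -> eqmod D g f.
Proof. by move=> e i /e. Qed.

Lemma eqmod_trans D g f h : eqmod D f g -> eqmod D g h -> eqmod D f h.
Proof. by move=> e1 e2 i iD; rewrite e1 ?e2. Qed.

Lemma eqmodD D f f' g g' : eqmod D f f' -> eqmod D g g' -> eqmod D (f + g) (f' + g').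
Proof. by move=> e1 e2 i iD; rewrite !coefD e1 ?e2. Qed.

Lemma eqmodN D f f' : eqmod D f f' -> eqmod D (- f) (- f').
Proof. by move=> e i iD; rewrite !coefN e. Qed.

Lemma eqmodB D f f' g g' : eqmod D f f' -> eqmod D g g' -> eqmod D (f - g) (f' - g').
Proof. by move=> e1 e2; apply/eqmodD/eqmodN. Qed.

Lemma eqmodM D f f' g g' : eqmod D f f' -> eqmod D g g' -> eqmod D (f * g) (f' * g').
Proof.
move=> e1 e2 i iD; rewrite !coefM; apply: eq_bigr => j _.
by rewrite e1 ?e2 // (leq_trans _ iD) ?leq_subr // -ltnS.
Qed.

Definition vanish (a : nat) f := forall i, (i < a)%N -> f`_i = 0.

Lemma vanishM a b f g : vanish a f -> vanish b g -> vanish (a + b) (f * g).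
Proof.
move=> va vb i iab; rewrite coefM big1 // => j _.
have [ja|aj] := ltnP j a; first by rewrite va ?mul0r.
rewrite [g`__]vb ?mulr0 // ltn_subLR ?(leq_trans iab) ?leq_add2r //.
by rewrite -ltnS.
Qed.

Lemma vanishX a k f : vanish a f -> vanish (k * a) (f ^+ k).
Proof.
by move=> va; elim: k => [|k IH] //; rewrite exprS mulSn; apply: vanishM.
Qed.

Lemma vanish0 f : f`_0 = 0 -> vanish 1 f.
Proof. by move=> f0 [|i]. Qed.

(** The Euler operator z d/dz. Unlike the derivative it does not shift degrees, hence it respects
    [eqmod D] without loss. *)
Definition theta f := 'X * f^`().

Lemma coef_theta f i : (theta f)`_i = f`_i *+ i.
Proof. by case: i => [|i]; rewrite coefXM ?mulr0n //= coef_deriv. Qed.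

Lemma thetaB f g : theta (f - g) = theta f - theta g.
Proof. by rewrite /theta derivB mulrBr. Qed.

Lemma thetaM f g : theta (f * g) = theta f * g + f * theta g.
Proof. by rewrite /theta derivM; ring. Qed.

Lemma thetaCM c f : theta (c%:P * f) = c%:P * theta f.
Proof. by rewrite /theta derivM derivC mul0r add0r mulrCA. Qed.

Lemma theta_sum (I : Type) (r : seq I) (P : pred I) (F : I -> {poly K}) :
  theta (\sum_(i <- r | P i) F i) = \sum_(i <- r | P i) theta (F i).
Proof. by rewrite /theta raddf_sum mulr_sumr. Qed.

Lemma theta_exp f k : theta (f ^+ k.+1) = theta f * f ^+ k *+ k.+1.
Proof. by rewrite /theta deriv_exp /= mulrnAr mulrA. Qed.

Lemma eqmod_cancel D f g : f`_0 = 1 -> eqmod D (f * g) 0 -> eqmod D g 0.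
Proof.
move=> f0 e; elim/ltn_ind => i IH iD.
have := e i iD; rewrite coefM big_ord_recl /= f0 mul1r subn0 big1 ?addr0 // => j _.
have ji : (i - bump 0 j < i)%N by rewrite ltn_subrL (leq_ltn_trans _ (ltn_ord j)).
by rewrite IH ?coef0 ?mulr0 // (leq_trans _ iD) // ltnW.
Qed.

(** [q] supplies the inverses of positive integers in [K]. *)
Variable q : {rmorphism rat -> K}.

Lemma qK k : (0 < k)%N -> q (k%:R^-1) * k%:R = 1.
Proof.
move=> k0; rewrite -(rmorph_nat q) -rmorphM mulVf ?rmorph1 //.
by rewrite Num.Theory.pnatr_eq0 -lt0n.
Qed.

Lemma mulrnI_rat k (a b : K) : (0 < k)%N -> a *+ k = b *+ k -> a = b.
Proof.
move=> k0 e; rewrite -[a]mul1r -[b]mul1r -(qK k0) -!mulrA.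
by rewrite !mulr_natl e.
Qed.

(** In degree i the equation expresses i f_i through earlier coefficients because g has no constant
    term, and i can be cancelled. *)
Lemma ode_unique D g f h : g`_0 = 0 -> eqmod D (theta f) (g * f) ->
  eqmod D (theta h) (g * h) -> f`_0 = h`_0 -> eqmod D f h.
Proof.
move=> g0 ef eh e0; elim/ltn_ind => -[|i] // IH iD.
apply: (@mulrnI_rat i.+1) => //.
rewrite -!coef_theta ef // eh // !coefM [LHS]big_ord_recl [RHS]big_ord_recl g0 !mul0r !add0r.
apply: eq_bigr => j _; have ji : (i.+1 - bump 0 j < i.+1)%N by rewrite subSS ltnS leq_subr.
by rewrite IH // (leq_trans _ iD) // ltnW.
Qed.

(** The exponential generating function of [a] evaluated at [y]. Cutting it after [y ^+ D] loses
    nothing modulo [eqmod D] if [y] has no constant term. *)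
Definition expser D (a : nat -> K) (y : {poly K}) : {poly K} :=
  \sum_(k < D.+1) (q (k`!%:R^-1) * a k)%:P * y ^+ k.

Lemma qfact k : q (k.+1`!%:R^-1) * k.+1%:R = q (k`!%:R^-1).
Proof.
rewrite -(rmorph_nat q) -rmorphM factS natrM invfM mulrAC mulVf ?mul1r //.
by rewrite Num.Theory.pnatr_eq0.
Qed.

Lemma theta_divpow y k :
  theta ((q (k.+1`!%:R^-1))%:P * y ^+ k.+1) = theta y * ((q (k`!%:R^-1))%:P * y ^+ k).
Proof.
rewrite thetaCM theta_exp -(qfact k) polyCM polyC_natr -mulr_natr; ring.
Qed.

Lemma theta_expserX D c (y : {poly K}) : y`_0 = 0 ->
  eqmod D (theta (expser D (GRing.exp c) y)) (c%:P * theta y * expser D (GRing.exp c) y).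
Proof.
move=> y0; set e := expser _ _ _.
(* The subtracted term is the truncation error; it contains [theta y * y ^+ D] and so starts in
   degree D + 1. *)
suff -> : theta e = c%:P * theta y * e
   - theta y * y ^+ D * ((c * q (D`!%:R^-1) * c ^+ D)%:P).
  move=> i iD; rewrite coefB [X in _ - X](_ : _ = 0) ?subr0 //.
  have v1 : vanish 1 (theta y) by apply: vanish0; rewrite coef_theta mulr0n.
  have v2 := @vanishX _ D _ (vanish0 y0); rewrite muln1 in v2.
  have := vanishM (vanishM v1 v2) (b := 0) (g := (c * q (D`!%:R^-1) * c ^+ D)%:P).
  by apply => //; rewrite addn0 add1n ltnS.
pose u k := (q (k`!%:R^-1) * c ^+ k)%:P * y ^+ k.
have tu0 : theta (u 0) = 0 by rewrite /u !expr0 !mulr1 /theta derivC mulr0.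
have tuS k : theta (u k.+1) = c%:P * theta y * u k.
  have -> : u k.+1 = (c * c ^+ k)%:P * ((q (k.+1`!%:R^-1))%:P * y ^+ k.+1).
    by rewrite /u (exprS c) !polyCM; ring.
  by rewrite thetaCM theta_divpow /u !polyCM; ring.
rewrite /e /expser theta_sum big_ord_recl -/(u 0) tu0 add0r.
rewrite [X in c%:P * _ * X]big_ord_recr mulrDr mulr_sumr /=.
rewrite (_ : c%:P * theta y * (_ * y ^+ D) = theta y * y ^+ D * (c * q D`!%:R^-1 * c ^+ D)%:P);
  last by rewrite !polyCM; ring.
by rewrite addrK; apply: eq_bigr => i _; rewrite -/(u _) -tuS.
Qed.

End TruncatedSeries.

Arguments expser {K} q D a y.

(** * The logarithmic derivative of E(tz) - t E(z) *)

Section EulerianTransform.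
Variable K : comNzRingType.
Variable q : {rmorphism rat -> K}.
Implicit Types (f g h y : {poly K}) (D : nat).

Lemma eqmod_comp D f g y : y`_0 = 0 -> eqmod D f g -> eqmod D (f \Po y) (g \Po y).
Proof.
move=> y0 e i iD; apply/eqP; rewrite -subr_eq0 -coefB -comp_polyB; apply/eqP.
rewrite comp_polyE coef_sum big1 // => j _; rewrite coefZ coefB.
have [jD|Dj] := leqP j D; first by rewrite e // subrr mul0r.
rewrite (@vanishX _ 1 _ _ (vanish0 y0)) ?mulr0 // muln1.
exact: leq_ltn_trans Dj.
Qed.

Lemma expserE D a y : expser q D a y = \poly_(k < D.+1) (q (k`!%:R^-1) * a k) \Po y.
Proof.
rewrite poly_def raddf_sum; apply: eq_bigr => k _.
by rewrite /= comp_polyZ comp_Xn_poly mul_polyC.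
Qed.

Lemma qbin i j : q ((i + j)`!%:R^-1) * 'C(i + j, i)%:R = q (i`!%:R^-1) * q (j`!%:R^-1).
Proof.
rewrite -(rmorph_nat q) -!rmorphM; congr (q _).
rewrite -(bin_fact (leq_addr j i)) addKn !natrM !invfM mulrAC mulVf ?mul1r //.
by rewrite Num.Theory.pnatr_eq0 -lt0n bin_gt0 leq_addr.
Qed.

Lemma expserM D a b y : y`_0 = 0 ->
  eqmod D (expser q D a y * expser q D b y)
    (expser q D (fun m => \sum_(k < m.+1) 'C(m, k)%:R * a k * b (m - k)%N) y).
Proof.
move=> y0; rewrite !expserE -comp_polyM; apply: eqmod_comp => // m mD.
rewrite coefM coef_poly ltnS mD mulr_sumr; apply: eq_bigr => k _.
have km : (k <= m)%N by rewrite -ltnS.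
rewrite !coef_poly !ltnS (leq_trans km mD) (leq_trans (leq_subr _ _) mD).
by have := qbin k (m - k); rewrite subnKC // => e; rewrite mulrACA -e !mulrA.
Qed.

Lemma expser0 D a y : y`_0 = 0 -> (expser q D a y)`_0 = a 0%N.
Proof.
move=> y0; rewrite coef_sum big_ord_recl big1 ?addr0 => [|i _].
  by rewrite fact0 invr1 rmorph1 mul1r expr0 mulr1 coefC.
rewrite lift0 coefCM (@vanishX _ 1 _ _ (vanish0 y0)) ?mulr0 //.
Qed.

Variables (t : K) (D : nat).
Hypothesis t_reg : forall a : K, (1 - t) * a = 0 -> a = 0.
Variables (a : nat -> K) (p : nat -> K) (E F T : {poly K}).
(* In terms of the exponential generating function A of a:
   A(y) (e^((t - 1) y) - t) = 1 - t, the equation of the Eulerian polynomials. *)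
Hypothesis Ha : forall m, \sum_(k < m.+1) 'C(m, k)%:R * a k * (t - 1) ^+ (m - k)
  = t * a m + (1 - t) *+ (m == 0%N).

Definition qnum m : K := \sum_(i < m) t ^+ i.

Lemma qnumE m : (1 - t) * qnum m = 1 - t ^+ m.
Proof. by rewrite -opprB mulNr -subrX1 opprB. Qed.

Definition dil f := f \Po (t *: 'X).

Lemma coef_dil f i : (dil f)`_i = t ^+ i * f`_i.
Proof.
rewrite /dil comp_polyE coef_sum.
under eq_bigr => j _ do rewrite exprZn coefZ coefZ coefXn.
have [fi|fi] := ltnP i (size f); last first.
  rewrite nth_default // mulr0 big1 // => j _.
  rewrite gtn_eqF ?mulr0 // (leq_trans _ fi) //.
rewrite (bigD1 (Ordinal fi)) //= eqxx mulr1 mulrC big1 ?addr0 // => j ji.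
by rewrite eq_sym -val_eqE /= in ji; rewrite (negPf ji) !mulr0.
Qed.

Lemma theta_dil f : theta (dil f) = dil (theta f).
Proof. by apply/polyP => i; rewrite coef_theta !coef_dil coef_theta mulrnAr. Qed.

Lemma eqmod_dil D' f g : eqmod D' f g -> eqmod D' (dil f) (dil g).
Proof. by move=> e i iD; rewrite !coef_dil e. Qed.

(** [P] is theta E / E up to degree D. As (1 - t) theta y = P(z) - P(tz), the series exp((t - 1) y)
    is E(tz) / E(z); the factor [qnum i], which is (1 - t^i) / (1 - t), absorbs the division by 1 -
    t. *)
Let P := \poly_(i < D.+1) (if i is j.+1 then (-1) ^+ j * p i else 0).
Let y := \poly_(i < D.+1)
  (if i is j.+1 then q (i%:R^-1) * ((-1) ^+ j * p i * qnum i) else 0).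

Hypothesis E0 : E`_0 = 1.
Hypothesis HE : eqmod D (theta E) (P * E).
Hypothesis HF : (1 - t)%:P * F = dil E - t%:P * E.
Hypothesis F0 : F`_0 = 1.
Hypothesis HT : eqmod D (F * T) (- theta F).

Lemma y_coef0 : y`_0 = 0. Proof. by rewrite coef_poly. Qed.

Lemma theta_y : (1 - t)%:P * theta y = P - dil P.
Proof.
apply/polyP => i; rewrite coefCM coef_theta coefB coef_dil !coef_poly.
case: ltnP => _; last by rewrite mul0rn !mulr0 subr0.
case: i => [|i]; first by rewrite mul0rn !mulr0 subr0.
transitivity ((q i.+1%:R^-1 * i.+1%:R) * ((-1) ^+ i * p i.+1) * ((1 - t) * qnum i.+1)); first by ring.
by rewrite qK // qnumE; ring.
Qed.

Let W := expser q D (GRing.exp (t - 1)) y.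

(** Both sides solve theta f = P(tz) f with constant term 1, so [ode_unique] applies. *)
Lemma E_mul_W : eqmod D (E * W) (dil E).
Proof.
have tW := @theta_expserX _ q D (t - 1) _ y_coef0; rewrite -/W in tW.
have e1 : (t - 1)%:P * theta y = dil P - P.
  by rewrite -opprB polyCN mulNr theta_y opprB.
rewrite e1 in tW.
apply: (@ode_unique _ q _ (dil P)).
- by rewrite coef_dil coef_poly mulr0.
- rewrite thetaM; apply: eqmod_trans (_ : eqmod D (P * E * W + E * ((dil P - P) * W)) _).
    by apply: eqmodD; apply: eqmodM.
  by apply: eqmod_eq; ring.
- by rewrite theta_dil /dil -comp_polyM; apply: eqmod_dil.
- by rewrite coef0M expser0 ?y_coef0 // coef_dil E0 expr0 mul1r.
Qed.

Let A := expser q D a y.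

(** By [expserM] the product [A * W] is the exponential series of the binomial convolution in
    [Ha]. *)
Lemma A_mul_W : eqmod D (A * (W - t%:P)) (1 - t)%:P.
Proof.
rewrite mulrBr; apply: eqmod_trans (eqmodB (expserM _ _ y_coef0) (@eqmod_refl _ _ _)) _.
apply: eqmod_eq; rewrite [A * _]mulrC mulr_sumr -sumrB [LHS]big_ord_recl [X in _ + X]big1 => [|k _] /=.
  by rewrite Ha fact0 invr1 rmorph1 expr0 !mul1r mulr1n !mulr1 polyCD polyCM; ring.
by rewrite Ha /= mulr0n addr0 !polyCM; ring.
Qed.

(** Since (1 - t) F = E (W - t), formally - theta F / F = - P + (1 - t) theta y W / (W - t). With A
    = (1 - t) / (W - t) the last term is (1 - t) theta y + t theta y A, and (1 - t) theta y = P(z) -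
    P(tz) leaves this expression. *)
Let C := t%:P * theta y * A - dil P.

Lemma eqmod_reg f : eqmod D ((1 - t)%:P * f) 0 -> eqmod D f 0.
Proof. by move=> e i /e; rewrite coefCM !coef0 => /t_reg. Qed.

(** Multiplied by (1 - t) F, both sides become t P E - P(tz) E(tz). The factor F cancels because its
    constant term is 1, the factor 1 - t because it is regular. *)
Lemma T_eq_C : eqmod D T C.
Proof.
suff : eqmod D (T - C) 0.
  by move=> e i /e; rewrite coefB coef0 => /eqP; rewrite subr_eq0 => /eqP.
apply: (eqmod_cancel F0); apply: eqmod_reg.
have AE : eqmod D (A * (dil E - t%:P * E)) ((1 - t)%:P * E).
  apply: eqmod_trans (_ : eqmod D (A * (W - t%:P) * E) _).
    rewrite (_ : A * (W - t%:P) * E = A * (E * W - t%:P * E)); last by ring.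
    apply: eqmodM (@eqmod_refl _ _ _) _; apply: eqmodB (@eqmod_refl _ _ _).
    exact: eqmod_sym E_mul_W.
  by apply: eqmodM (@eqmod_refl _ _ _); exact: A_mul_W.
have e1 : eqmod D ((1 - t)%:P * (F * T)) (t%:P * (P * E) - dil P * dil E).
  apply: eqmod_trans (_ : eqmod D ((1 - t)%:P * - theta F) _).
    exact: eqmodM (@eqmod_refl _ _ _) HT.
  rewrite mulrN -thetaCM HF thetaB thetaCM theta_dil opprB.
  apply: eqmodB; first exact: eqmodM (@eqmod_refl _ _ _) HE.
  by rewrite /dil -comp_polyM; apply: eqmod_dil.
have e2 : eqmod D ((1 - t)%:P * (F * C)) (t%:P * (P * E) - dil P * dil E).
  rewrite mulrA HF /C.
  apply: eqmod_trans (_ : eqmod D (t%:P * theta y * ((1 - t)%:P * E) - dil P * (dil E - t%:P * E)) _).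
    rewrite (_ : _ * (_ - dil P) = t%:P * theta y * (A * (dil E - t%:P * E)) - dil P * (dil E - t%:P * E));
      last by ring.
    by apply: eqmodB (@eqmod_refl _ _ _); apply: eqmodM (@eqmod_refl _ _ _) AE.
  rewrite (_ : t%:P * theta y * _ = t%:P * ((1 - t)%:P * theta y) * E); last by ring.
  by rewrite theta_y; apply: eqmod_eq; ring.
rewrite mulrBr mulrBr -[0](subrr (t%:P * (P * E) - dil P * dil E)).
exact: eqmodB.
Qed.

Lemma T_coef : (0 < D)%N -> T`_D =
  D%:R * t * (\sum_(k < D.+1) a k * (q (k.+1`!%:R^-1) * (y ^+ k.+1)`_D))
   - t ^+ D * ((-1) ^+ D.-1 * p D).
Proof.
move=> D0; rewrite T_eq_C // /C coefB coef_dil coef_poly ltnSn.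
rewrite [X in t ^+ D * X](_ : _ = (-1) ^+ D.-1 * p D); last by case: (D) D0.
congr (_ - _); rewrite -mulrA coefCM.
(* Integration term by term: a_k y^k / k! theta y is theta of a_k y^(k+1) / (k+1)!. This is the
   shift by which k + 1 power sums go with [a k]. *)
have -> : theta y * A = theta (\sum_(k < D.+1) (a k)%:P * ((q (k.+1`!%:R^-1))%:P * y ^+ k.+1)).
  rewrite theta_sum mulr_sumr; apply: eq_bigr => k _.
  by rewrite thetaCM theta_divpow polyCM; ring.
rewrite coef_theta coef_sum mulrnAr -[LHS]mulr_natl mulrA; congr (_ * _).
by apply: eq_bigr => k _; rewrite !coefCM.
Qed.

End EulerianTransform.

(** * Partitions and Eulerian polynomials *)

(** Partitions of [n] with parts at most [M], sorted by the multiplicity [m] of [M]. This recursion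
    fits the binomial expansion in [coef_divpow] and splits the factor of [M] off [zpart]. *)
Fixpoint parts (M n : nat) : seq (seq nat) :=
  if M is M'.+1 then
    flatten [seq [seq nseq m M ++ la | la <- parts M' (n - m * M)]
            | m <- iota 0 (n %/ M).+1]
  else if n == 0%N then [:: [::]] else [::].

Lemma partsS M n : parts M.+1 n =
  flatten [seq [seq nseq m M.+1 ++ la | la <- parts M (n - m * M.+1)]
          | m <- iota 0 (n %/ M.+1).+1].
Proof. by []. Qed.

Lemma big_parts (V : nmodType) (F : seq nat -> V) M n :
  \sum_(la <- parts M.+1 n) F la =
  \sum_(m < (n %/ M.+1).+1) \sum_(la <- parts M (n - m * M.+1)) F (nseq m M.+1 ++ la).
Proof.
rewrite partsS big_flatten big_map.
rewrite -(big_mkord xpredT (fun m => \sum_(la <- parts M (n - m * M.+1)) F (nseq m M.+1 ++ la))).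
by rewrite /index_iota subn0; apply: eq_bigr => m _; rewrite big_map.
Qed.

Lemma partsP M n la : reflect (is_partn n la /\ all (leq^~ M) la) (la \in parts M n).
Proof.
elim: M n la => [|M IH] n la.
  apply: (iffP idP) => [|[/and3P[_ la0 /eqP <-] laM]].
    by rewrite /=; case: eqP => // ->; rewrite inE => /eqP ->.
  by case: la la0 laM => //= -[|a] la.
apply: (iffP flattenP) => [[s /mapP[m]]|[/and3P[sla la0 /eqP sn] laM]].
  rewrite mem_iota add0n /= ltnS => mn -> {s} /mapP[la' /IH[/and3P[s1 s2 /eqP s3] s4] ->].
  have mM : (m * M.+1 <= n)%N by rewrite -leq_divRL.
  have all1 : all (leq^~ M.+1) la' by apply: sub_all s4 => x /leqW.
  split; last by rewrite all_cat all_nseq leqnn orbT.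
  rewrite /is_partn mem_cat negb_or s2 sumn_cat sumn_nseq s3 mulnC subnKC // eqxx andbT.
  rewrite mem_nseq /= andbF /= andbT; elim: m {mn mM s3} => [|m IHm] //=.
  rewrite path_sortedE; last by move=> x y z; exact: (rev_trans leq_trans).
  by rewrite IHm all_cat all1 all_nseq /= leqnn orbT.
have [m [la' [e laM' sla' la0']]] : exists m la', [/\ la = nseq m M.+1 ++ la',
    all (leq^~ M) la', sorted geq la' & 0%N \notin la'].
  elim: la sla la0 laM {sn} => [|x la IHla] /=; first by exists 0%N, [::].
  rewrite path_sortedE; last by move=> a b c; exact: (rev_trans leq_trans).
  case/andP=> xla sla; rewrite inE negb_or => /andP[x0 la0] /andP[xM laM].
  move: xM; rewrite leq_eqVlt => /orP[/eqP xM|xM].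
    case: (IHla sla la0 laM) => m [la' [-> h1 h2 h3]].
    by exists m.+1, la'; rewrite xM.
  exists 0%N, (x :: la); split=> //=.
  - by rewrite -ltnS xM /=; apply: sub_all xla => y yx; rewrite (leq_trans yx).
  - rewrite path_sortedE ?xla //; by move=> a b c; exact: (rev_trans leq_trans).
  - by rewrite inE negb_or x0.
move: sn; rewrite e sumn_cat sumn_nseq => sn.
exists [seq nseq m M.+1 ++ la | la <- parts M (n - m * M.+1)].
  apply/mapP; exists m => //.
  by rewrite mem_iota add0n /= ltnS leq_divRL // -sn mulnC leq_addr.
apply: map_f; apply/IH; rewrite /is_partn sla' la0' laM' -sn mulnC addKn eqxx.
by split.
Qed.

Lemma parts_uniq M n : uniq (parts M n).
Proof.
elim: M n => [|M IH] n; first by rewrite /=; case: ifP.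
rewrite partsS; have : uniq (iota 0 (n %/ M.+1).+1) by apply: iota_uniq.
set f := fun m => _; elim: (iota _ _) => //= m s IHs /andP[ms us].
rewrite cat_uniq IHs // andbT map_inj_uniq ?IH => [/=|x y /eqP]; last first.
  by rewrite eqseq_cat // => /andP[_ /eqP].
apply/hasPn => x /flattenP[y /mapP[m' m's ->] xy]; apply/negP => xm.
have cnt m1 : x \in f m1 -> count_mem M.+1 x = m1.
  case/mapP=> la /partsP[_ laM] ->; rewrite count_cat count_nseq /= eqxx mul1n.
  rewrite (_ : count _ la = 0%N) ?addn0 //; apply/count_memPn/negP => /(allP laM).
  by rewrite ltnn.
by move: ms; rewrite -(cnt _ xm) (cnt _ xy) m's.
Qed.

Lemma mem_parts n la : (la \in parts n n) = is_partn n la.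
Proof.
apply/partsP/idP => [[]//|la_n]; split=> //.
case/and3P: la_n => _ _ /eqP <-; elim: la => //= x la IH.
by rewrite leq_addr /=; apply: sub_all IH => y /leq_trans -> //; rewrite leq_addl.
Qed.

Lemma zpart_nseq_cat m M la : M \notin la ->
  zpart (nseq m M ++ la) = (M ^ m * m`! * zpart la)%N.
Proof.
move=> Mla; case: m => [|m]; first by rewrite !mul1n.
have cntM : count_mem M la = 0%N by apply/count_memPn.
have e : undup (nseq m.+1 M ++ la) = M :: undup la.
  elim: m => [|m IHm]; first by rewrite /= (negPf Mla).
  have us (s : seq nat) : M \in s -> undup (M :: s) = undup s by move=> /= ->.
  by rewrite -IHm -[RHS]us // mem_cat mem_nseq eqxx.
rewrite /zpart e.
rewrite big_cons count_cat count_nseq /= eqxx mul1n cntM addn0; congr (_ * _)%N.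
apply: eq_big_seq => i; rewrite mem_undup => ila.
have Mi : (M == i) = false by apply/negbTE; apply: contraNneq Mla => ->.
by rewrite Mi count_cat count_nseq /= Mi.
Qed.

Lemma zpart_gt0 la : 0%N \notin la -> (0 < zpart la)%N.
Proof.
move=> la0; rewrite /zpart big_seq prodn_cond_gt0 // => i; rewrite mem_undup => ila.
by rewrite muln_gt0 fact_gt0 expn_gt0 lt0n; case: eqP ila la0 => // -> ->.
Qed.

(** * Divided powers of a series as sums over partitions *)

Section DividedPowers.
Variables (K : comNzRingType) (q : {rmorphism rat -> K}) (w : nat -> K).

Definition wpoly M : {poly K} :=
  \poly_(i < M.+1) (if i is j.+1 then q (i%:R^-1) * w i else 0).

Lemma wpolyS M : wpoly M.+1 = wpoly M + (q (M.+1%:R^-1) * w M.+1)%:P * 'X^(M.+1).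
Proof.
apply/polyP => i; rewrite coefD coefCM coefXn !coef_poly ltnS leq_eqVlt.
by case: eqP => [->|_]; rewrite ?ltnn ?mulr1 ?add0r // mulr0 addr0.
Qed.

(** The multinomial theorem, by induction on the largest part: in the expansion of (wpoly M + c
    X^(M+1))^k, the m-th binomial term collects the partitions with m parts equal to M + 1. The m!
    in [zpart] comes from the binomial coefficient, the power of M + 1 from the denominator of
    [c]. *)
Lemma coef_divpow M n k : q (k`!%:R^-1) * (wpoly M ^+ k)`_n =
  \sum_(la <- parts M n | size la == k) q ((zpart la)%:R^-1) * \prod_(l <- la) w l.
Proof.
elim: M n k => [|M IH] n k.
  have -> : wpoly 0 = 0.
    by apply/polyP => -[|i]; rewrite coef_poly ?coef0.
  rewrite /=; case: k => [|k]; last first.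
    rewrite expr0n /= coef0 mulr0; case: ifP => _; last by rewrite big_nil.
    by rewrite big_cons !big_nil.
  rewrite expr0 coef1; case: ifP => _; last by rewrite big_nil mulr0.
  by rewrite big_cons !big_nil /= addr0 /zpart big_nil.
rewrite big_mkcond big_parts wpolyS exprDn coef_sum mulr_sumr.
set c := q _ * w _.
(* A common bound for the two ranges of m, which stop at k and at the quotient of n by M + 1. *)
pose N := (k + n %/ M.+1).+1.
rewrite (big_ord_widen N (fun m => q k`!%:R^-1 *
  (wpoly M ^+ (k - m) * (c%:P * 'X^(M.+1)) ^+ m *+ 'C(k, m) : {poly K})`_n)) ?ltnS ?leq_addr //.
rewrite (big_ord_widen N (fun m => \sum_(la <- parts M (n - m * M.+1))
  if size (nseq m M.+1 ++ la) == k then q (zpart (nseq m M.+1 ++ la))%:R^-1 *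
  \prod_(l <- nseq m M.+1 ++ la) w l else 0)) ?ltnS ?leq_addl //.
rewrite big_mkcond [RHS]big_mkcond /=; apply: eq_bigr => m _; rewrite !ltnS leq_divRL //.
have -> : ((wpoly M ^+ (k - m) * (c%:P * 'X^(M.+1)) ^+ m) *+ 'C(k, m))`_n =
    (c ^+ m * if (m * M.+1 <= n)%N then (wpoly M ^+ (k - m))`_(n - m * M.+1) else 0) *+ 'C(k, m).
  rewrite coefMn exprMn -polyC_exp -exprM [(M.+1 * m)%N]mulnC mulrCA coefCM coefMXn.
  by rewrite ltnNge; case: leqP.
case: (leqP m k) => mk; last first.
  case: ifP => // _; rewrite big1 // => la _; case: eqP => // e.
  by move: mk; rewrite -e size_cat size_nseq ltnNge leq_addr.
case: ifP => _; last by rewrite mulr0 mul0rn mulr0.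
transitivity (q ((M.+1 ^ m * m`!)%:R^-1) * w M.+1 ^+ m *
   (q ((k - m)`!%:R^-1) * (wpoly M ^+ (k - m))`_(n - m * M.+1))).
  have := qbin q m (k - m); rewrite subnKC // => e.
  have em : q ((M.+1 ^ m)%:R^-1) = (q (M.+1%:R^-1)) ^+ m.
    by rewrite natrX -exprVn rmorphXn.
  rewrite -mulrnAr mulrCA -[(wpoly M ^+ _)`_ _ *+ _]mulr_natl mulrA -mulrA.
  rewrite [q _ * (_ * _)]mulrA e natrM invfM [q (_ * _)]rmorphM em /c exprMn; ring.
rewrite IH mulr_sumr big_mkcond; apply: eq_big_seq => la /partsP[_ laM].
rewrite size_cat size_nseq (_ : (_ + _ == k) = (size la == k - m))%N; last first.
  by rewrite -[RHS](eqn_add2l m) subnKC.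
case: eqP => // _.
rewrite zpart_nseq_cat; last by apply/negP => /(allP laM); rewrite ltnn.
rewrite big_cat big_nseq iter_mulr_1 [((_ * zpart la)%N)%:R]natrM invfM rmorphM /=; ring.
Qed.
End DividedPowers.

(** Generates the permutations of m + 1 letters with first letter i by descents. The remaining
    letters, renumbered, begin with some j < m, and the first step is a descent iff j < i. The same
    recursion later orders the arcs of the cycle. *)
Fixpoint eul_from (m i : nat) : {poly rat} :=
  if m is m'.+1 then \sum_(j < m) 'X^(j < i)%N * eul_from m' j else 1.

Lemma desE m (s : 'S_m.+1) :
  des s = (\sum_(i < m) (s (lift ord0 i) < s (widen_ord (leqnSn m) i)))%N.
Proof.
pose A := [set i : 'I_m | (s (lift ord0 i) < s (widen_ord (leqnSn m) i))%N].
have -> : (\sum_(i < m) (s (lift ord0 i) < s (widen_ord (leqnSn m) i)))%N = #|A|.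
  by rewrite -sum1_card [RHS]big_mkcond; apply: eq_bigr => i _; rewrite inE; case: ifP.
pose f (i : 'I_m) := (widen_ord (leqnSn m) i, lift ord0 i).
have fI : injective f by move=> i j [] /val_inj.
rewrite -(card_imset _ fI); apply: eq_card => -[i j]; rewrite inE /=.
apply/andP/imsetP => [[/eqP ij sij]|[k kA [-> ->]]].
  have im : (i < m)%N by rewrite -ltnS -ij ltn_ord.
  have ei : i = widen_ord (leqnSn m) (Ordinal im) by apply: val_inj.
  have ej : j = lift ord0 (Ordinal im) by apply: val_inj.
  by exists (Ordinal im); rewrite ?inE -?ei -?ej //= /f -ei -ej.
by rewrite inE in kA.
Qed.

Lemma ltn_lift n (h : 'I_n.+1) (i j : 'I_n) : (lift h i < lift h j)%N = (i < j)%N.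
Proof. by rewrite !ltnNge /= leq_bump2. Qed.

Lemma ltn_lift_self n (h : 'I_n.+1) (i : 'I_n) : (lift h i < h)%N = (i < h)%N.
Proof.
rewrite /= /bump; case: (leqP h i) => hi.
  by apply/negbTE; rewrite -leqNgt (leq_trans hi) // leq_addl.
exact: hi.
Qed.

Lemma des_lift_perm m (j : 'I_m.+2) (s : 'S_m.+1) :
  des (lift_perm ord0 j s) = ((s ord0 < j) + des s)%N.
Proof.
rewrite !desE big_ord_recl; congr (_ + _)%N.
  have -> : widen_ord (leqnSn m.+1) ord0 = ord0 by apply: val_inj.
  by rewrite lift_perm_id lift_perm_lift ltn_lift_self.
apply: eq_bigr => i _.
have -> : widen_ord (leqnSn m.+1) (lift ord0 i) = lift ord0 (widen_ord (leqnSn m) i) by apply: val_inj.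
by rewrite !lift_perm_lift ltn_lift.
Qed.

Lemma sum_lift_perm (V : nmodType) m (j : 'I_m.+2) (F : 'S_m.+2 -> V) :
  \sum_(s : 'S_m.+2 | s ord0 == j) F s = \sum_(s : 'S_m.+1) F (lift_perm ord0 j s).
Proof.
have liftI : injective (lift_perm ord0 j : 'S_m.+1 -> 'S_m.+2).
  move=> s1 s2 /permP e; apply/permP => k; apply: (@lift_inj _ j).
  by have := e (lift ord0 k); rewrite !lift_perm_lift.
rewrite (eq_bigl (mem [set lift_perm ord0 j s | s in [set: 'S_m.+1]])); last first.
  move=> s; apply/eqP/imsetP => [s0|[s1 _ ->]]; last by rewrite lift_perm_id.
  pose f k := odflt k (unlift j (s (lift ord0 k))).
  have fE k : lift j (f k) = s (lift ord0 k).
    rewrite /f; case: unliftP => [l -> //|]; rewrite -s0 => /perm_inj e.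
    by have := neq_lift ord0 k; rewrite e eqxx.
  have fI : injective f.
    by move=> k l e; apply: (@lift_inj _ ord0); apply: (@perm_inj _ s); rewrite -!fE e.
  exists (perm fI) => //; apply/permP => k; have [k' ->|->] := unliftP ord0 k.
    by rewrite lift_perm_lift permE fE.
  by rewrite lift_perm_id.
by rewrite big_imset => [|s1 s2 _ _ /liftI //]; apply: eq_bigl => s; rewrite inE.
Qed.

Lemma sum_des_first m (j : 'I_m.+1) :
  \sum_(s : 'S_m.+1 | s ord0 == j) 'X^(des s) = eul_from m j.
Proof.
elim: m j => [|m IH] j.
  rewrite (big_pred1 1%g) => [|s].
    by rewrite desE big_ord0.
  by rewrite !ord1 eqxx; apply/esym/eqP/permP => i; rewrite !ord1.
rewrite sum_lift_perm /= (partition_big (fun s : 'S_m.+1 => s ord0) xpredT) //=.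
apply: eq_bigr => i _; rewrite -IH mulr_sumr; apply: eq_bigr => s /eqP si.
by rewrite des_lift_perm si exprD.
Qed.

Lemma eulerianE m : eulerian m = eul_from m 0.
Proof.
case: m => [|m].
  rewrite /eulerian /= (big_pred1 1%g) => [|s].
    by rewrite /des eq_card0 // => -[[]].
  by apply/esym/eqP/permP => -[].
rewrite /eulerian (partition_big (fun s : 'S_m.+1 => s ord0) xpredT) //=.
by apply: eq_bigr => i _; rewrite sum_des_first mul1r.
Qed.

(** Only the summand j = i notices the change from i to i + 1: its exponent rises from 0 to 1. *)
Lemma eul_fromS m i : (i <= m)%N ->
  eul_from m.+1 i.+1 = eul_from m.+1 i + ('X - 1) * eul_from m i.
Proof.
move=> im /=; have im' : (i < m.+1)%N by [].
rewrite (bigD1 (Ordinal im')) //= [in RHS](bigD1 (Ordinal im')) //= ltnSn ltnn.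
rewrite expr1 expr0 (eq_bigr (fun j : 'I_m.+1 => 'X^(j < i)%N * eul_from m j)) => [|j ji].
  by ring.
rewrite -val_eqE /= in ji; congr ('X^_ * _).
by rewrite ltnS leq_eqVlt (negPf ji).
Qed.

(** Newton's forward difference formula: by [eul_fromS], a difference in i is multiplication by
    ['X - 1] with m lowered by one. *)
Lemma eul_from_newton m i : (i <= m)%N ->
  eul_from m i = \sum_(k < i.+1) 'C(i, k)%:R * ('X - 1) ^+ k * eul_from (m - k) 0.
Proof.
elim: i m => [|i IH] m im; first by rewrite big_ord1 subn0 !mul1r.
case: m im => // m im; rewrite eul_fromS // !IH // ?leqW // mulr_sumr.
rewrite [RHS]big_ord_recl [X in X + _ = _]big_ord_recl -addrA.
congr (_ + _); first by rewrite !bin0.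
have -> : \sum_(k < i.+1) 'C(i.+1, lift ord0 k)%:R * ('X - 1) ^+ lift ord0 k *
      eul_from (m.+1 - lift ord0 k) 0
    = \sum_(k < i.+1) 'C(i, k.+1)%:R * ('X - 1) ^+ k.+1 * eul_from (m - k) 0
    + \sum_(k < i.+1) ('X - 1) * ('C(i, k)%:R * ('X - 1) ^+ k * eul_from (m - k) 0).
  rewrite -big_split /=; apply: eq_bigr => k _.
  by rewrite binS natrD subSS exprS; ring.
congr (_ + _); rewrite [RHS]big_ord_recr /= bin_small // !mul0r addr0.
by apply: eq_bigr => k _; rewrite subSS.
Qed.

Lemma eul_from_top m : eul_from m.+1 m.+1 = 'X * eul_from m.+1 0.
Proof.
by rewrite /= mulr_sumr; apply: eq_bigr => j _; rewrite ltn_ord mul1r.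
Qed.

(** Two values of [eul_from m m]: the Newton expansion, and the remark that a largest first letter
    is always followed by a descent. For m = 0 no letter follows, whence the correction [1 - 'X]. *)
Lemma eulerian_rec m :
  \sum_(k < m.+1) 'C(m, k)%:R * eulerian k * ('X - 1) ^+ (m - k)
  = 'X * eulerian m + (1 - 'X) *+ (m == 0%N).
Proof.
rewrite (reindex_inj rev_ord_inj) /= eulerianE.
transitivity (eul_from m m).
  rewrite eul_from_newton //; apply: eq_bigr => k _.
  have km : (k <= m)%N by rewrite -ltnS.
  by rewrite subSS subKn // bin_sub // eulerianE mulrAC.
case: m => [|m]; first by rewrite /= mulr1 mulr1n addrC subrK.
by rewrite eul_from_top mulr0n addr0.
Qed.

(** * The traces of powers of a cycle matrix *)

Section Newton.
Variable K : comNzRingType.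

Lemma deriv_prod (I : finType) (f : I -> {poly K}) :
  (\prod_i f i)^`() = \sum_i \prod_j (if j == i then (f j)^`() else f j).
Proof.
have derivs (r : seq I) : uniq r -> (\prod_(i <- r) f i)^`() =
    \sum_(i <- r) \prod_(j <- r) (if j == i then (f j)^`() else f j).
  elim: r => [_|i r IH /= /andP[ir ur]]; first by rewrite !big_nil -polyC1 derivC.
  rewrite !big_cons derivM IH // eqxx mulr_sumr; congr (_ * _ + _).
    by apply: eq_big_seq => j jr; case: eqP ir => // <-; rewrite jr.
  apply: eq_big_seq => j jr; rewrite big_cons; congr (_ * _).
  by case: eqP ir => // ->; rewrite jr.
by rewrite derivs // index_enum_uniq.
Qed.

(** Jacobi's formula: the product rule gives one determinant for each differentiated row, which is
    then expanded along that row. *)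
Lemma deriv_det n (M : 'M[{poly K}]_n) :
  (\det M)^`() = \sum_i \sum_j (M i j)^`() * cofactor M i j.
Proof.
pose Mi i := \matrix_(k, j) if k == i then (M k j)^`() else M k j.
transitivity (\sum_i \det (Mi i)).
  rewrite /determinant raddf_sum exchange_big /=; apply: eq_bigr => s _.
  rewrite derivM -mulr_sumr [X in X * _ + _](_ : _ = 0); last first.
    by rewrite -(rmorph_sign polyC) derivC.
  rewrite mul0r add0r deriv_prod; congr (_ * _); apply: eq_bigr => i _.
  by apply: eq_bigr => k _; rewrite mxE.
apply: eq_bigr => i _; rewrite (expand_det_row _ i); apply: eq_bigr => j _.
rewrite mxE eqxx /cofactor; congr (_ * (_ * \det _)).
by apply/matrixP => k l; rewrite !mxE eq_sym (negPf (neq_lift _ _)).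
Qed.

Variables (n : nat) (A : 'M[K]_n.+1).

Definition charser : {poly K} := \det (1%:M - 'X *: map_mx polyC A).
Definition trser D : {poly K} := \poly_(i < D.+1) (if i is 0 then 0 else \tr (A ^+ i)).

Lemma charser0 : charser`_0 = 1.
Proof.
rewrite -horner_coef0 -[LHS]/(horner_eval 0 _) -det_map_mx.
rewrite (_ : map_mx _ _ = 1%:M) ?det1 //; apply/matrixP => i j.
by rewrite !mxE /= /horner_eval hornerD hornerN hornerM hornerX mul0r subr0 hornerMn -polyC1 hornerC.
Qed.

(** By Jacobi's formula - theta det(1 - zA) is z tr(A adj(1 - zA)). The identity M adj M = det M
    gives the coefficients G_k of the adjugate the recursion G_(k+1) = c_(k+1) + A G_k, with c_k the
    coefficients of the determinant; unrolled, it yields the powers of A. *)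
Lemma theta_charser D : eqmod D (charser * trser D) (- theta charser).
Proof.
set M := 1%:M - 'X *: map_mx polyC A.
pose G k := map_mx (fun p : {poly K} => p`_k) (\adj M).
have GE : \adj M = charser%:M + 'X *: (map_mx polyC A *m \adj M).
  have := mul_mx_adj M; rewrite {1}/M mulmxBl mul1mx -scalemxAl => /eqP.
  by rewrite subr_eq => /eqP.
have AGE k : map_mx (fun p : {poly K} => p`_k) (map_mx polyC A *m \adj M) = A *m G k.
  apply/matrixP => i j; rewrite !mxE coef_sum; apply: eq_bigr => l _.
  by rewrite !mxE coefCM.
have G0 : G 0%N = (charser`_0)%:M.
  rewrite /G GE; apply/matrixP => i j; rewrite !mxE coefD coefXM addr0.
  by rewrite coefMn.
have GS k : G k.+1 = (charser`_k.+1)%:M + A *m G k.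
  rewrite -AGE {1}/G {1}GE; apply/matrixP => i j.
  by rewrite !mxE coefD coefXM coefMn.
have GA k : A *m G k = \sum_(j < k.+1) charser`_j *: A ^+ (k - j).+1.
  elim: k => [|k IH]; first by rewrite G0 big_ord1 mul_mx_scalar expr1.
  rewrite GS mulmxDr mul_mx_scalar IH [RHS]big_ord_recr /= subnn addrC expr1.
  congr (_ + _); rewrite mulmx_sumr; apply: eq_bigr => j _.
  by rewrite -scalemxAr mulmxE -exprS subSn // -ltnS.
have thE : theta charser = - ('X * \tr (map_mx polyC A *m \adj M)).
  rewrite /theta deriv_det -mulrN; congr (_ * _).
  rewrite /mxtrace -sumrN; apply: eq_bigr => i _.
  rewrite !mxE -sumrN; apply: eq_bigr => j _.
  rewrite !mxE derivB derivM derivC mulr0 addr0 derivX mul1r.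
  by rewrite derivMn -polyC1 derivC mul0rn sub0r mulNr.
move=> i iD; rewrite thE opprK coefXM; case: i iD => [|i] iD.
  by rewrite coef0M coef_poly mulr0.
have -> : (\tr (map_mx polyC A *m \adj M))`_i.+1.-1 = \tr (A *m G i).
  by rewrite -AGE coef_sum; apply: eq_bigr => j _; rewrite !mxE.
rewrite GA raddf_sum coefM big_ord_recr /= subnn [(trser D)`_0]coef_poly mulr0 addr0.
apply: eq_bigr => j _; have ji : (j <= i)%N by rewrite -ltnS.
rewrite linearZ /=; congr (_ * _); rewrite coef_poly subSn // ltnS.
by rewrite (leq_trans _ iD) // ltnS leq_subr.
Qed.
End Newton.

(** The determinant is that of a bordered matrix in which [s] occurs only in the first row, where it
    enters affinely. *)
Lemma det_add_rank1 (R : comNzRingType) n (B : 'M[R]_n) (v : 'rV[R]_n) :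
  exists d, forall s, \det (B + s *: (const_mx 1 *m v)) = \det B + s * d.
Proof.
pose N s : 'M_(1 + n) := block_mx 1%:M (- (s *: v)) (const_mx 1) B.
exists (- \det (block_mx (0 : 'M_1) v (const_mx 1) B)) => s.
transitivity (\det (N s)).
  have -> : \det (N s) = \det (N s *m block_mx 1%:M (s *: v) 0 1%:M).
    by rewrite det_mulmx det_ublock !det1 !mulr1.
  rewrite mulmx_block !mulmx1 !mul1mx !mulmx0 !addr0 subrr det_lblock det1 mul1r.
  by congr (\det _); rewrite addrC -scalemxAr.
have rowE1 (i : 'I_(1 + n).-1) : lift (lshift n (ord0 : 'I_1)) i = rshift 1 (i : 'I_n) by apply: val_inj.
rewrite (@determinant_multilinear _ _ (N s) (block_mx 1%:M 0 (const_mx 1) B)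
   (block_mx 0 v (const_mx 1) B) (lshift n ord0) 1 (- s)).
- by rewrite mul1r det_lblock det1 mul1r mulNr mulrN.
- by rewrite /N /block_mx !rowKu !row_id !scale_row_mx add_row_mx !scale1r scaler0 addr0 add0r scaleNr.
- by apply/matrixP => i j; rewrite 2![row' _ _ _ _]mxE rowE1 /N /block_mx !col_mxEd.
- by apply/matrixP => i j; rewrite 2![row' _ _ _ _]mxE rowE1 /N /block_mx !col_mxEd.
Qed.

(** * The characteristic polynomial of the colouring matrix *)

Section CycleMatrix.
Variables (K : comNzRingType) (t : K) (N : nat) (x : 'I_N.+1 -> K).

(* The nonzero closed walks of length n of this matrix are the proper colorings
   of the n-cycle. *)
Definition cyc_mx : 'M[K]_N.+1 :=
  \matrix_(i, j) (if (i < j)%N then t * x j else if (j < i)%N then x j else 0).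

Definition eser : {poly K} := \prod_i (1 + (x i)%:P * 'X).

(** Adding s x_j z to every entry of column j of 1 - zM makes the matrix upper triangular for s = 1
    and lower triangular for s = t, with determinants E(z) and E(tz). The determinant is affine in
    s, so these two values give the one at s = 0. *)
Lemma charser_cyc : (1 - t)%:P * charser cyc_mx = dil t eser - t%:P * eser.
Proof.
pose B := 1%:M - 'X *: map_mx polyC cyc_mx.
have [d Hd] := det_add_rank1 B (\row_j ((x j)%:P * 'X)).
have Bs s i j : (B + s *: (const_mx 1 *m \row_j ((x j)%:P * 'X))) i j
    = (i == j)%:R + (x j)%:P * 'X * (s - if (i < j)%N then t%:P else (j < i)%N%:R).
  rewrite !mxE big_ord1 !mxE; case: (ltngtP i j) => ij.
  - by rewrite polyCM; ring.
  - by rewrite mulr1n; ring.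
  - by rewrite polyC0 mulr0n; ring.
have e1 : charser cyc_mx + d = eser.
  have := Hd 1; rewrite mul1r -/(charser _) => <-.
  rewrite -det_tr det_trig; last first.
    apply/is_trig_mxP => i j ij; rewrite mxE Bs ltnNge (ltnW ij) ij /=.
    by rewrite -val_eqE /= gtn_eqF // subrr mulr0 addr0.
  by apply: eq_bigr => i _; rewrite mxE Bs eqxx ltnn subr0 mulr1.
have et : charser cyc_mx + t%:P * d = dil t eser.
  have := Hd t%:P; rewrite -/(charser _) => <-.
  rewrite det_trig; last first.
    apply/is_trig_mxP => i j ij; rewrite Bs ij subrr mulr0 addr0.
    by rewrite -val_eqE /= ltn_eqF.
  rewrite /dil /eser rmorph_prod; apply: eq_bigr => i _.
  rewrite Bs eqxx ltnn subr0 rmorphD rmorph1 rmorphM /= comp_polyC comp_polyX.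
  by rewrite !comp_polyC polyC1 -mul_polyC; ring.
by rewrite -et -e1 polyCB polyC1; ring.
Qed.

Lemma eser0 : eser`_0 = 1.
Proof.
rewrite -horner_coef0 /eser horner_prod big1 // => i _.
by rewrite hornerD hornerM hornerX mulr0 addr0 -polyC1 hornerC.
Qed.

Definition pser D : {poly K} :=
  \poly_(i < D.+1) (if i is j.+1 then (-1) ^+ j * \sum_l x l ^+ i else 0).

Lemma theta_eser D : eqmod D (theta eser) (pser D * eser).
Proof.
pose c1 l i : K := if i is j.+1 then (-1) ^+ j * x l ^+ i else 0.
(* The expansion of x_l z / (1 + x_l z), the logarithmic derivative of a single factor under
   theta. *)
pose P1 l : {poly K} := \poly_(i < D.+1) c1 l i.
have -> : pser D = \sum_l P1 l.
  apply/polyP => i; rewrite coef_sum coef_poly.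
  have Pl l : (P1 l)`_i = if (i < D.+1)%N then c1 l i else 0 by rewrite coef_poly.
  rewrite (eq_bigr _ (fun l _ => Pl l)).
  case: ifP => _; last by rewrite big1.
  by case: (i) => [|j]; [rewrite big1 | rewrite mulr_sumr].
rewrite /eser; elim: (index_enum _) => [|l r IH].
  by rewrite !big_nil mul0r /theta -polyC1 derivC mulr0.
rewrite !big_cons thetaM.
set e := \prod_(i <- r) _; set f := 1 + _; set S := \sum_(i <- r) _.
apply: eqmod_trans (_ : eqmod D (P1 l * f * e + f * (S * e)) _).
  apply: eqmodD; apply: eqmodM => // {IH e S}.
  move=> i iD; rewrite /f mulrDr mulr1 mulrCA coefD coefCM coefMX coef_theta.
  rewrite coefD coef1 coefCM coefX !coef_poly ltnS iD.
  case: i iD => [|[|i]] iD /=.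
    by rewrite mulr0n mulr0 addr0.
    by rewrite mulr1n; ring.
  by rewrite ltnS (ltnW iD) mulr0 addr0 mul0rn !exprS; ring.
by apply: eqmod_eq; ring.
Qed.

Lemma trser_cyc (q : {rmorphism rat -> K}) (a : nat -> K) D :
  (forall c : K, (1 - t) * c = 0 -> c = 0) ->
  (forall m, \sum_(k < m.+1) 'C(m, k)%:R * a k * (t - 1) ^+ (m - k)
     = t * a m + (1 - t) *+ (m == 0%N)) ->
  \tr (cyc_mx ^+ D.+1) =
  \sum_(la <- parts D.+1 D.+1) q ((zpart la)%:R^-1) *
     (D.+1%:R * t * a (size la).-1 * \prod_(l <- la) qnum t l
      - (t ^+ D.+1 *+ D.+1) *+ (la == [:: D.+1])) *
     \prod_(l <- la) ((-1) ^+ l.-1 * \sum_i x i ^+ l).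
Proof.
move=> t_reg Ha.
pose p l := \sum_i x i ^+ l.
have := T_coef q t_reg Ha eser0 (@theta_eser D.+1
  : eqmod _ _ (\poly_(i < D.+2) (if i is j.+1 then (-1) ^+ j * p i else 0) * _))
  charser_cyc (charser0 _)
  (@theta_charser _ _ cyc_mx D.+1).
rewrite coef_poly ltnSn => -> //.
pose w l := (-1) ^+ l.-1 * p l * qnum t l.
have -> : \poly_(i < D.+2) (if i is j.+1 then q (i%:R^-1) * ((-1) ^+ j * p i * qnum t i) else 0)
  = wpoly q w D.+1.
  by apply/polyP => -[|i]; rewrite !coef_poly.
under eq_bigr => k _ do rewrite coef_divpow mulr_sumr big_mkcond.
rewrite exchange_big mulr_sumr.
transitivity (\sum_(la <- parts D.+1 D.+1) q ((zpart la)%:R^-1) *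
     (D.+1%:R * t * a (size la).-1 * \prod_(l <- la) w l) -
   \sum_(la <- parts D.+1 D.+1) q ((zpart la)%:R^-1) *
     ((t ^+ D.+1 * \prod_(l <- la) ((-1) ^+ l.-1 * p l)) *+ D.+1) *+ (la == [:: D.+1])).
  congr (_ - _).
    apply: eq_big_seq => la; rewrite mem_parts => /and3P[_ la0 /eqP sla].
    have [s0 sD] : (0 < size la)%N /\ (size la <= D.+1)%N.
      split; first by case: (la) sla.
      rewrite -sla; elim: (la) la0 => //= -[|l] s IH //.
      by rewrite inE negb_or /= => /IH h; rewrite addSn ltnS (leq_trans h) ?leq_addl.
    have k0 : ((size la).-1 < D.+2)%N by rewrite ltnS (leq_trans (leq_pred _)).
    rewrite (bigD1 (Ordinal k0)) //= prednK // eqxx [X in _ + X]big1 => [|k kk0].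
      by rewrite addr0; ring.
    case: eqP => // e; case/eqP: kk0; apply: val_inj; by rewrite /= e.
  (* The isolated power sum is assigned to the partition with one part, whose [zpart] is [D.+1];
     this explains the compensating multiple [D.+1]. *)
  have mD : [:: D.+1] \in parts D.+1 D.+1.
    by rewrite mem_parts /is_partn /= addn0 eqxx.
  rewrite (bigD1_seq [:: D.+1]) ?parts_uniq //= eqxx [X in _ + X]big1 => [|la /negPf->]; last by rewrite mulr0n.
  have -> : zpart [:: D.+1] = D.+1 by rewrite /zpart big_seq1 /= eqxx muln1.
  by rewrite mulr1n big_seq1 addr0 mulrnAr -mulrnAl -[q _ *+ _]mulr_natr qK // mul1r.
rewrite -sumrB; apply: eq_bigr => la _.
rewrite /w big_split /= -/(p _); case: eqP => _; rewrite ?mulr1n ?mulr0n; ring.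
Qed.
End CycleMatrix.

(** * Power sum expansions and omega *)

Lemma expcmnE (I : choiceType) (m : {cmonom I}) k i : expcmn m k i = (k * m i)%N.
Proof.
elim: k => [|[|k] IH]; rewrite ?mul1n //; first exact: onecmE.
by rewrite -[expcmn m k.+2]/(mulcm m (expcmn m k.+1)) mulcmE IH mulSn.
Qed.

Lemma cm_eqP (I : choiceType) (m1 m2 : {cmonom I}) : (forall i, m1 i = m2 i) -> m1 = m2.
Proof. by move=> e; apply/eqP/cmP. Qed.

Lemma mulcm_divK (m a : {cmonom nat}) : (forall i, (a i <= m i)%N) -> mulcm a (divcm m a) = m.
Proof. by move=> am; apply: cm_eqP => i; rewrite mulcmE divcmE subnKC. Qed.

Lemma mulcm_divcm (a b : {cmonom nat}) : divcm (mulcm a b) a = b.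
Proof. by apply: cm_eqP => i; rewrite divcmE mulcmE addKn. Qed.

Definition xpow (j k : nat) : {cmonom nat} := expcmn (ucm j) k.

Arguments xpow : simpl never.

Lemma xpowE j k i : xpow j k i = if j == i then k else 0%N.
Proof. by rewrite expcmnE ucmE; case: eqP; rewrite ?muln1 ?muln0. Qed.

Lemma xpow_le (m : {cmonom nat}) j k : (k <= m j)%N -> forall i, (xpow j k i <= m i)%N.
Proof. by move=> km i; rewrite xpowE; case: eqP => [<-|]. Qed.

Lemma mdeg_xpow j k : mdeg (xpow j k) = k.
Proof.
rewrite (mdegEw (d := [fset j]%fset)) ?big_seq_fset1 ?xpowE ?eqxx //.
apply/fsubsetP => i; rewrite -cmE_neq0 xpowE inE [i == j]eq_sym.
by case: (j == i).
Qed.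

Lemma mdeg_div_xpow (m : {cmonom nat}) j k : (k <= m j)%N ->
  mdeg m = (k + mdeg (divcm m (xpow j k)))%N.
Proof.
move=> km; rewrite -{1}(mulcm_divK (xpow_le km)).
by rewrite [LHS]mdegM mdeg_xpow.
Qed.

Lemma mdeg_div_eq (m : {cmonom nat}) j i k : (i < m j)%N -> (i <= k)%N ->
  (mdeg (divcm m (xpow j i.+1)) == k - i)%N = (mdeg m == k.+1).
Proof.
move=> ij ik; have dm := mdeg_div_xpow ij.
apply/idP/idP => /eqP h; apply/eqP.
  by apply: (etrans dm); apply: (etrans (congr1 (addn i.+1) h)); rewrite addSn subnKC.
by apply: (@addnI i.+1); apply: (etrans (esym dm)); apply: (etrans h); rewrite addSn subnKC.
Qed.

Lemma mulcm_xpow_divP m j k b : (mulcm (xpow j k) b = m) <->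
  (k <= m j)%N /\ b = divcm m (xpow j k).
Proof.
split=> [<-|[km ->]]; last by rewrite mulcm_divK //; apply: xpow_le.
by rewrite mulcm_divcm mulcmE xpowE eqxx leq_addr.
Qed.

(** * Newton's identities for the complete and elementary series *)

Section PowerSeriesLaws.
Variable R : comNzRingType.
Implicit Types (f g : fps R) (m : {cmonom nat}).

Lemma psmul_psum i f m : psmul (psum R i.+1) f m =
  \sum_(j <- finsupp m | (i < m j)%N) f (divcm m (xpow j i.+1)).
Proof.
pose r := [seq (xpow j i.+1, divcm m (xpow j i.+1)) | j <- finsupp m & (i < m j)%N].
have xI : injective (fun j => (xpow j i.+1, divcm m (xpow j i.+1))).
  move=> j j' /(congr1 (fun ab : {cmonom nat} * {cmonom nat} => ab.1 j)) /=.
  by rewrite !xpowE eqxx; case: eqP.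
rewrite /psmul (fsbigE r); first last.
- case=> a b /= abm; rewrite /psum; case: asboolP => [[j aj]|_]; last by rewrite mul0r.
  move: abm; rewrite {a}aj -/(xpow _ _) => /mulcm_xpow_divP[ijm ->] /negP[].
  by apply: map_f; rewrite mem_filter ijm -cmE_neq0 -lt0n (leq_ltn_trans _ ijm).
- case=> a b /= /mapP[j]; rewrite mem_filter => /andP[ijm _] [-> ->].
  by apply/mulcm_xpow_divP.
- by rewrite map_inj_uniq // filter_uniq // fset_uniq.
rewrite big_map big_filter_cond; apply: eq_big => [j|j _] /=.
  rewrite andb_idr // => ijm; rewrite inE /=; apply/mulcm_xpow_divP; by split.
rewrite /psum; case: asboolP => [_|[]]; first by rewrite mul1r.
by exists j.
Qed.

Lemma psmul_const c f : psmul (psconst c) f = fun m => c * f m.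
Proof.
apply/funext => m; rewrite /psmul (fsbigE [:: (onecm nat, m)]) //=; first last.
- case=> a b /= abm; rewrite /psconst; case: (a =P onecm _) => [a1|_]; last by rewrite mul0r.
  by move: abm; rewrite a1 mul0cm => ->; rewrite inE eqxx.
- by move=> ab /=; rewrite inE => /eqP ->; rewrite /= mul0cm.
by rewrite big_cons big_nil ifT ?inE /= ?mul0cm // /psconst eqxx addr0.
Qed.

Lemma complete0 : complete R 0 = psconst 1.
Proof. by apply/funext => m; rewrite /complete /psconst mdeg_eq0; case: eqP. Qed.

Lemma elem0 : elem R 0 = psconst 1.
Proof.
apply/funext => m; rewrite /elem /psconst mdeg_eq0; case: eqP => // ->.
by rewrite (_ : all _ _) //; apply/allP => i _; rewrite cm1.
Qed.

(** Every monomial has coefficient 1 in the complete series of its degree, so the right side counts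
    the pairs (j, i) with i < m_j; there are deg m of them. *)
Lemma complete_newton k m :
  k.+1%:R * complete R k.+1 m =
  \sum_(i < k.+1) psmul (psum R i.+1) (complete R (k - i)) m.
Proof.
under eq_bigr => i _ do rewrite psmul_psum big_mkcond.
rewrite exchange_big /= /complete.
have e j (i : 'I_k.+1) : (if (i < m j)%N then (mdeg (divcm m (xpow j i.+1)) == k - i)%N%:R else 0)
    = (mdeg m == k.+1)%:R * (i < m j)%N%:R :> R.
  case: ifP => ij; last by rewrite mulr0.
  by rewrite mulr1 mdeg_div_eq // -ltnS.
case: (mdeg m =P k.+1) e => dm e; last first.
  by rewrite mulr0 big1 // => j _; rewrite big1 // => i _; rewrite e mul0r.
rewrite mulr1 -[X in X%:R = _]dm mdegE natr_sum; apply: eq_big_seq => j jm.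
rewrite (eq_bigr (fun i : 'I_k.+1 => (i < m j)%N%:R)) => [|i _]; last by rewrite e mul1r.
have mk : (m j <= k.+1)%N by rewrite -dm mdegE (big_rem j) //= leq_addr.
rewrite -natr_sum -(big_mkord xpredT (fun i => (i < m j)%N : nat)).
rewrite (big_cat_nat (leq0n (m j)) mk) /= [X in (_ + X)%N]big_nat_cond [X in (_ + X)%N]big1 => [|i].
  rewrite addn0 big_nat_cond (eq_bigr (fun=> 1%N)) => [|i]; last by rewrite andbT => /andP[_ ->].
  by rewrite -big_nat_cond sum_nat_const_nat subn0 muln1.
by rewrite andbT => /andP[mi _]; rewrite ltnNge mi.
Qed.

Lemma elemE k m : elem R k m = ((mdeg m == k) && all (fun i => m i <= 1)%N (finsupp m))%:R.
Proof. by []. Qed.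

Lemma all_le1P m : reflect (forall i, (m i <= 1)%N) (all (fun i => m i <= 1)%N (finsupp m)).
Proof.
apply: (iffP allP) => [h i|h i _] //; have := h i; rewrite -cmE_neq0.
by case: (m i) => // n; apply.
Qed.

Lemma sum_sign_last2 a : \sum_(i < a.+1) (-1) ^+ i * (a - i <= 1)%N%:R = (a == 0%N)%:R :> R.
Proof.
case: a => [|a]; first by rewrite big_ord1 mulr1.
rewrite !big_ord_recr /= big1 => [|i _].
  by rewrite subnn subSnn leqnn add0r !mulr1 exprS mulN1r addrC addNr.
by rewrite subSn ?(ltnW (ltn_ord i)) // ltnS leqn0 subn_eq0 leqNgt ltn_ord mulr0.
Qed.

(** For fixed j the quotient of m by x_j^(i+1) is squarefree only if the other exponents are at most
    1 and i is one of the last two values below m_j. Their signs cancel unless m_j = 1, where a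
    single value exists. *)
Lemma elem_newton k m :
  k.+1%:R * elem R k.+1 m =
  \sum_(i < k.+1) (-1) ^+ i * psmul (psum R i.+1) (elem R (k - i)) m.
Proof.
under eq_bigr => i _ do rewrite psmul_psum big_mkcond mulr_sumr.
rewrite exchange_big /=.
pose O j := all (fun i => (i == j) || (m i <= 1)%N) (finsupp m).
have OP j : reflect (forall i, i != j -> (m i <= 1)%N) (O j).
  apply: (iffP allP) => [h i ij|h i _]; last by case: eqP => //= /eqP /h.
  have := h i; rewrite -cmE_neq0 (negPf ij).
  by case: (m i) => // n; apply.
have e j (i : 'I_k.+1) : (-1) ^+ i * (if (i < m j)%N then elem R (k - i) (divcm m (xpow j i.+1)) else 0)
    = ((mdeg m == k.+1) && O j)%:R * (if (i < m j)%N then (-1) ^+ i * ((m j).-1 - i <= 1)%N%:R else 0) :> R.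
  case: ifP => ij; last by rewrite !mulr0.
  have ik : (i <= k)%N by rewrite -ltnS.
  rewrite elemE (mdeg_div_eq ij ik) mulrCA -natrM; congr (_ * _%:R).
  case: (mdeg m == k.+1) => //=; rewrite mulnb; congr nat_of_bool.
  apply/all_le1P/andP => [h|[/OP Oj mj] i'].
    split; first by apply/OP => i' ij'; have := h i'; rewrite divcmE xpowE eq_sym (negPf ij') subn0.
    by have := h j; rewrite divcmE xpowE eqxx subnS -subn1 -subnDA addnC subnDA subn1.
  rewrite divcmE xpowE; case: eqP => [<-|/eqP]; last by rewrite eq_sym subn0 => /Oj.
  by rewrite subnS -subn1 -subnDA addnC subnDA subn1.
case: (mdeg m =P k.+1) e => dm e; last first.
  rewrite elemE; case: (mdeg m =P k.+1) => // _; rewrite mulr0.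
  by rewrite big1 // => j _; rewrite big1 // => i _; rewrite e mul0r.
have inner j : j \in finsupp m -> \sum_(i < k.+1) (-1) ^+ i *
    (if (i < m j)%N then elem R (k - i) (divcm m (xpow j i.+1)) else 0) = (O j && (m j == 1%N))%:R.
  move=> jm; have mk : (m j <= k.+1)%N by rewrite -dm mdegE (big_rem j) //= leq_addr.
  under eq_bigr => i _ do rewrite e /=.
  rewrite -mulr_sumr -big_mkcond -(big_ord_widen _ (fun i => (-1) ^+ i * ((m j).-1 - i <= 1)%N%:R) mk).
  move: jm; rewrite -cmE_neq0; case: (m j) => // a _; rewrite sum_sign_last2 -natrM mulnb //.
rewrite (eq_big_seq _ inner) elemE dm eqxx /=.
case: (all_le1P m) => h.
  rewrite mulr1 -[X in X%:R = _]dm mdegE natr_sum; apply: eq_big_seq => j.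
  rewrite -cmE_neq0; have := h j; have -> : O j by apply/OP.
  by case: (m j) => [|[]].
rewrite mulr0 big1_seq // => j /andP[_ jm]; case: (OP j) => //= Oj.
case: eqP => // mj; case: h => i; have [->|/Oj//] := eqVneq i j.
by rewrite mj.
Qed.

End PowerSeriesLaws.

(** * Series restricted to finitely many variables, as polynomials *)

Section Representation.
Variable R : comNzRingType.
Implicit Types (f g : fps R) (m : {cmonom nat}).
Local Notation K := {malg R[{cmonom nat}]}.
Implicit Types P Q : K.

Definition below N m := forall i, (N <= i)%N -> m i = 0%N.

Lemma below_mul N a b : below N (mulcm a b) -> below N a /\ below N b.
Proof.
move=> ab; split=> i /ab; rewrite mulcmE => /eqP; rewrite addn_eq0 => /andP[].
  by move=> /eqP.
by move=> _ /eqP.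
Qed.

Lemma below_exists m : exists N, below N.+1 m.
Proof.
exists (\max_(i <- finsupp m) i)%N => i ni; apply/eqP; rewrite cmE_eq0.
by apply: contraL ni => im; rewrite -ltnNge ltnS; apply: leq_bigmax_seq.
Qed.

(* P is f with the variables x_N, x_(N+1), ... set to 0. *)
Definition rep N f P := forall m, below N m -> f m = P@_m.

Lemma rep_psconst N c : rep N (psconst c) (c%:MP).
Proof. by move=> m _; rewrite mcoeffC /psconst; case: (m =P onecm _). Qed.

Lemma rep_psadd N f g P Q : rep N f P -> rep N g Q -> rep N (psadd f g) (P + Q).
Proof. by move=> hf hg m mN; rewrite /psadd hf // hg // mcoeffD. Qed.

Lemma rep_psmul N f g P Q : rep N f P -> rep N g Q -> rep N (psmul f g) (P * Q).
Proof.
move=> hf hg m mN.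
pose r := [seq ab <- [seq (a, b) | a <- (msupp P : seq _), b <- (msupp Q : seq _)] | mulcm ab.1 ab.2 == m].
rewrite /psmul (eq_fsbigr (fun ab => P@_ab.1 * Q@_ab.2)); last first.
  case=> a b; rewrite inE /= => abm; move: mN; rewrite -abm => /below_mul[aN bN].
  by rewrite hf // hg.
rewrite (fsbigE r); first last.
- case=> a b /= /eqP abm; rewrite mem_filter /= abm /= => h.
  have [aP|aP] := boolP (a \in msupp P); last by rewrite (mcoeff_outdom aP) mul0r.
  have [bQ|bQ] := boolP (b \in msupp Q); last by rewrite (mcoeff_outdom bQ) mulr0.
  by case/negP: h; apply/allpairsP; exists (a, b).
- by case=> a b /=; rewrite mem_filter => /andP[/eqP].
- apply: filter_uniq; apply: allpairs_uniq; rewrite ?fset_uniq //.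
  by case=> [a b] [c d] _ _ [-> ->].
rewrite mcoeffMl big_filter_cond big_mkcond big_allpairs.
apply: eq_bigr => a _; apply: eq_bigr => b _ /=.
have -> : (mmul a b == m) = (mulcm a b == m) by [].
case: eqP => [abm|]; last by rewrite mulr0n.
by rewrite ifT // inE.
Qed.

Lemma rep_inj f g (P : nat -> K) : (forall N, rep N.+1 f (P N)) -> (forall N, rep N.+1 g (P N)) -> f = g.
Proof.
by move=> hf hg; apply/funext => m; have [N mN] := below_exists m; rewrite (hf N) // (hg N).
Qed.

Definition xvar (i : nat) : K := << ucm i >>.

Lemma xvarX i k : xvar i ^+ k = << xpow i k >>.
Proof.
elim: k => [|k IH].
  by rewrite expr0; congr << _ >>; apply: cm_eqP => j; rewrite xpowE onecmE if_same.
rewrite exprS IH malgM_def fgmulUU mulr1; congr << _ >>; apply: cm_eqP => j.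
by rewrite -[mmul _ _]/(mulcm _ _) mulcmE ucmE !xpowE; case: eqP.
Qed.

Definition psumN N k : K := \sum_(i < N) xvar i ^+ k.

Lemma rep_psum N k : rep N (psum R k.+1) (psumN N k.+1).
Proof.
move=> m mN; rewrite /psumN raddf_sum /=.
under eq_bigr => i _ do rewrite xvarX mcoeffU1.
rewrite /psum; case: asboolP => [[i mi]|nm].
  have iN : (i < N)%N.
    rewrite ltnNge; apply/negP => /mN; rewrite mi -/(xpow _ _) xpowE eqxx //.
  rewrite (bigD1 (Ordinal iN)) //= mi -/(xpow _ _) eqxx big1 ?addr0 // => j ji.
  case: eqP => // /(congr1 (fun a : {cmonom nat} => a j)); rewrite !xpowE eqxx.
  by move: ji; rewrite -val_eqE /= eq_sym => /negPf ->.
by rewrite big1 // => i _; case: eqP => // e; case: nm; exists (nat_of_ord i).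
Qed.

Lemma coef_xvarM i k P m : (xvar i ^+ k * P)@_m =
  if (k <= m i)%N then P@_(divcm m (xpow i k)) else 0.
Proof.
rewrite xvarX mcoeffMl msuppU1 big_seq_fset1.
under eq_bigr => b _ do rewrite mcoeffU1 eqxx mul1r.
case: ifP => km; last first.
  rewrite big1 // => b _; case: eqP => // /mulcm_xpow_divP[].
  by rewrite km.
have e b : (mulcm (xpow i k) b == m) = (b == divcm m (xpow i k)).
  by apply/eqP/eqP => [/mulcm_xpow_divP[]//|->]; rewrite mulcm_divK //; apply: xpow_le.
under eq_bigr => b _ do rewrite -[mmul _ _]/(mulcm _ _) e.
set d := divcm _ _; have [dP|dP] := boolP (d \in msupp P); last first.
  rewrite (mcoeff_outdom dP) big1_seq // => b /andP[_ bP].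
  by case: eqP => // bd; move: dP; rewrite -bd bP.
rewrite (bigD1_seq d) ?fset_uniq //= eqxx mulr1n big1 ?addr0 // => b /negPf ->.
by rewrite mulr0n.
Qed.

Lemma prod_xvar (I : Type) (r : seq I) (f : I -> nat) :
  \prod_(i <- r) xvar (f i) = << \big[@mulcm nat/onecm nat]_(i <- r) ucm (f i) >>.
Proof.
elim: r => [|i r IH]; first by rewrite !big_nil.
rewrite big_cons IH [in RHS]big_cons [LHS]malgM_def fgmulUU mulr1; congr mkmalgU.
Qed.

End Representation.

(** * Monomials in products of power sums *)

Section Assignments.
Implicit Types (s la mu : seq nat) (m : {cmonom nat}).

(** Expanding a product of power sums means choosing a variable [s_i] for each part [la_i]; this is
    the resulting monomial. *)
Fixpoint asgn s la : {cmonom nat} :=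
  match s, la with
  | i :: s', j :: la' => mulcm (xpow i j) (asgn s' la')
  | _, _ => onecm nat
  end.

Lemma asgn_notin s la i : i \notin s -> asgn s la i = 0%N.
Proof.
elim: s la => [|k s IH] [|j la] //=; rewrite ?onecmE //.
by rewrite inE negb_or mulcmE xpowE eq_sym => /andP[/negPf-> /IH->].
Qed.

Lemma asgn_gt0 s la i : size s = size la -> 0%N \notin la -> i \in s -> (0 < asgn s la i)%N.
Proof.
elim: s la => [|k s IH] [|j la] //= [ss]; rewrite !inE negb_or => /andP[j0 la0].
rewrite mulcmE xpowE [k == i]eq_sym; case: eqP => /= [_ _|_ /(IH _ ss la0)//].
by rewrite addn_gt0 lt0n eq_sym j0.
Qed.

Lemma map_asgn s la : uniq s -> size s = size la -> map (asgn s la) s = la.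
Proof.
elim: s la => [|k s IH] [|j la] //= /andP[ks us] [ss].
rewrite mulcmE xpowE eqxx asgn_notin // addn0; congr (_ :: _).
rewrite -[RHS]IH //; apply/eq_in_map => i is_; rewrite mulcmE xpowE.
by case: eqP ks => // ->; rewrite is_.
Qed.

(** All variables of the monomial must occur in [s], so [mu] has at least as many parts as [la].
    With equally many, [s] lists each variable once and the exponents are exactly the parts. *)
Lemma asgn_iota_eq s la mu : 0%N \notin la -> size s = size mu ->
  asgn s mu = asgn (iota 0 (size la)) la ->
  (size la <= size mu)%N /\ (size la = size mu -> perm_eq la mu).
Proof.
move=> la0 ss e; set I := iota 0 (size la).
have sI : size I = size la by rewrite size_iota.
have sub : {subset I <= s}.
  move=> i iI; apply: contraTT (asgn_gt0 sI la0 iI) => /asgn_notin is_.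
  by rewrite -e is_.
have uI : uniq I by apply: iota_uniq.
split; first by rewrite -ss -sI; apply: uniq_leq_size.
move=> slm; have sIs : (size s <= size I)%N by rewrite ss sI slm.
have [_ eIs] := uniq_min_size uI sub sIs.
have us : uniq s by apply: (leq_size_uniq uI sub sIs).
have pIs : perm_eq I s by apply: uniq_perm.
by rewrite -(map_asgn uI sI) -(map_asgn us ss) e; apply: perm_map.
Qed.

(** The coefficient of [m] in the product of power sums in N variables, kept as a natural number so
    that its positivity expresses the existence of an assignment. *)
Fixpoint asgn_count N la m : nat :=
  if la is j :: la' then
    (\sum_(i < N) if j <= m i then asgn_count N la' (divcm m (xpow i j)) else 0)%N
  else m == onecm nat.

Lemma asgn_countP N la m :
  reflect (exists s, [/\ size s = size la, all (ltn^~ N) s & m = asgn s la])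
    (0 < asgn_count N la m)%N.
Proof.
elim: la m => [|j la IH] m /=.
  rewrite lt0b; apply: (iffP eqP) => [->|[s []]].
    by apply: (ex_intro _ (nil : seq nat)).
  by case: s.
rewrite lt0n sum_nat_eq0 negb_forall; apply: (iffP existsP) => [[i]|[s []]].
  case: ifP => // jm; rewrite -lt0n => /IH[s [ss sN e]].
  by exists (val i :: s); rewrite /= ss ltn_ord sN -e mulcm_divK //; apply: xpow_le.
case: s => [|i s] //= [ss] /andP[iN sN] ->.
exists (Ordinal iN); rewrite /= mulcmE xpowE eqxx leq_addr mulcm_divcm -lt0n.
by apply/IH; exists s.
Qed.

End Assignments.

(** * Uniqueness of power sum expansions, and omega *)

Section RatSeries.
Local Notation R := {poly rat}.
Local Notation K := {malg {poly rat}[{cmonom nat}]}.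

Definition psumpart N (la : seq nat) : K := \prod_(l <- la) psumN _ N l.

Lemma coef_psumpart N la m : (psumpart N la)@_m = (asgn_count N la m)%:R.
Proof.
rewrite /psumpart; elim: la m => [|j la IH] m; first by rewrite big_nil mcoeff1.
rewrite big_cons mulr_suml raddf_sum /= natr_sum; apply: eq_bigr => i _.
by rewrite coef_xvarM; case: ifP.
Qed.

Lemma psumpart_perm N la mu : perm_eq la mu -> psumpart N la = psumpart N mu.
Proof. by move=> p; apply: perm_big. Qed.

(** Read off from the commutativity of the polynomial product, natural numbers being faithfully
    embedded in the coefficients. *)
Lemma asgn_count_perm N la mu m : perm_eq la mu -> asgn_count N la m = asgn_count N mu m.
Proof.
move=> /(psumpart_perm N) /(congr1 (mcoeff m)); rewrite !coef_psumpart => /eqP.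
by rewrite -!polyC_natr (inj_eq polyC_inj) Num.Theory.eqr_nat => /eqP.
Qed.

Definition pexp N (h : seq nat -> R) (l : seq (R * seq nat)) : K :=
  \sum_(x <- l) (x.1 * h x.2) *: psumpart N x.2.

(** The terms are grouped by their sorted index sequence, which represents the class under
    [perm_eq]. *)
Lemma sum_classes0 (V : lmodType R) (l : seq (R * seq nat)) (P : pred (seq nat)) (g : seq nat -> V) :
  (forall la mu, perm_eq la mu -> P la = P mu) ->
  (forall la mu, perm_eq la mu -> g la = g mu) ->
  (forall la, la \in map snd l -> P la -> \sum_(x <- l | perm_eq x.2 la) x.1 = 0) ->
  \sum_(x <- l | P x.2) x.1 *: g x.2 = 0.
Proof.
move=> Pp gp H; pose k := sort leq.
have kp la mu : (k la == k mu) = perm_eq la mu.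
  by apply/eqP/idP => /(perm_sortP leq_total leq_trans anti_leq).
have kk la : perm_eq la (k la) by rewrite perm_sym perm_sort.
pose U := undup [seq k x.2 | x <- l].
transitivity (\sum_(mu <- U) \sum_(x <- l | P x.2) if k x.2 == mu then x.1 *: g x.2 else 0).
  rewrite exchange_big /= big_seq_cond [RHS]big_seq_cond; apply: eq_bigr => x /andP[xl _].
  rewrite (bigD1_seq (k x.2)) ?undup_uniq ?mem_undup //=; last by apply: (map_f (fun x : R * seq nat => k x.2)).
  by rewrite eqxx big1 ?addr0 // => mu; rewrite eq_sym => /negPf ->.
apply: big1_seq => mu /andP[_]; rewrite mem_undup => /mapP[y yl ->].
rewrite -big_mkcondr.
have [Py|nPy] := boolP (P y.2); last first.
  by apply: big1 => x /andP[Px]; rewrite kp => /Pp e; rewrite -e Px in nPy.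
rewrite (eq_bigl (fun x => perm_eq x.2 y.2)) => [|x]; last first.
  by rewrite kp; case: (boolP (perm_eq _ _)) => [/Pp->|]; rewrite ?andbF // Py.
rewrite (eq_bigr (fun x => x.1 *: g y.2)) => [|x /gp ->//].
by rewrite -scaler_suml H ?scale0r //; apply: map_f.
Qed.

(* By decreasing size of la: in N = size la variables, the monomial with exponents
   la occurs in no p_mu with size mu <= N other than those with mu ~ la. *)
Lemma pexp_classes0 l : all (fun x => 0%N \notin x.2) l ->
  (forall N, pexp N (fun=> 1) l = 0) ->
  forall la, 0%N \notin la -> \sum_(x <- l | perm_eq x.2 la) x.1 = 0.
Proof.
move=> lpos l0; pose B := (\max_(x <- l) size x.2).+1.
suff H n la : (B <= size la + n)%N -> 0%N \notin la -> \sum_(x <- l | perm_eq x.2 la) x.1 = 0.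
  by move=> la; apply: (H B); apply: leq_addl.
elim: n la => [|n IH] la; first rewrite addn0.
  move=> Bla _; apply: big1_seq => x /andP[/perm_size e xl].
  by move: Bla; rewrite -e ltnNge /= (leq_bigmax_seq (F := fun x : R * seq nat => size x.2)).
move=> Bla la0; pose m := asgn (iota 0 (size la)) la; pose N := size la.
have := congr1 (mcoeff m) (l0 N); rewrite mcoeff0 raddf_sum /=.
rewrite (bigID (fun x => N < size x.2)%N) /=.
under eq_bigr => x _ do rewrite mcoeffZ mulr1 coef_psumpart.
(* The terms with more than N parts disappear together, since their class sums vanish by
   induction. *)
rewrite (@sum_classes0 R^o l (fun mu => N < size mu)%N (fun mu => (asgn_count N mu m)%:R)); first last.
- move=> mu /mapP[x xl ->] Nmu; apply: IH; last by exact: (allP lpos).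
  by rewrite (leq_trans Bla) // addnS -addSn leq_add2r.
- by move=> mu nu /(asgn_count_perm N m) ->.
- by move=> mu nu /perm_size ->.
rewrite add0r (eq_bigr (fun x => if perm_eq x.2 la then x.1 * (asgn_count N la m)%:R else 0)).
  rewrite -big_mkcondr (eq_bigl (fun x => perm_eq x.2 la)) => [|x]; last first.
    by rewrite andb_idl // => /perm_size ->; rewrite ltnn.
  rewrite -mulr_suml => /eqP; rewrite mulf_eq0 => /orP[/eqP//|].
  rewrite -polyC_natr polyC_eq0 Num.Theory.pnatr_eq0 -leqn0 leqNgt => /negP[].
  apply/asgn_countP; exists (iota 0 (size la)); split; rewrite ?size_iota //.
  by apply/allP => i; rewrite mem_iota.
move=> x Nx; rewrite mcoeffZ mulr1 coef_psumpart.
case: ifP => [/(asgn_count_perm N m)->//|npx].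
case: (posnP (asgn_count N x.2 m)) => [->|]; first by rewrite mulr0.
case/asgn_countP => s [ss _ e]; have [h1 h2] := asgn_iota_eq la0 ss (esym e).
move: npx; rewrite perm_sym h2 //; apply/eqP; rewrite eqn_leq h1 leqNgt; exact: Nx.
Qed.

Definition psscale (c : R) (f : fps R) : fps R := fun m => c * f m.

Lemma psmulZl c (f g : fps R) : psmul (psscale c f) g = psscale c (psmul f g).
Proof.
apply/funext => m; rewrite /psmul /psscale mulr_fsumr.
by apply: eq_fsbigr => ab _; rewrite mulrA.
Qed.

Lemma psmulr1 (f : fps R) : psmul f (psconst 1) = f.
Proof.
apply/funext => m; rewrite /psmul (fsbigE [:: (m, onecm nat)]) //=; first last.
- case=> a b /= abm; rewrite /psconst; case: (b =P onecm _) => [b1|_]; last by rewrite mulr0.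
  by move: abm; rewrite b1 mulcm0 => ->; rewrite inE eqxx.
- by move=> ab /=; rewrite inE => /eqP ->; rewrite /= mulcm0.
by rewrite big_cons big_nil ifT ?inE /= ?mulcm0 // /psconst eqxx addr0 mulr1.
Qed.

(** Satisfied both by the graph of omega and by [has_expansion]. Newton's identities then lead from
    e and h to p for the former and from p to e and h for the latter. *)
Definition is_algebra_rel (C : fps R -> fps R -> Prop) : Prop :=
  [/\ forall c, C (psconst c) (psconst c),
      forall f f' g g', C f f' -> C g g' -> C (psadd f g) (psadd f' g')
    & forall f f' g g', C f f' -> C g g' -> C (psmul f g) (psmul f' g')].

Section AlgebraRel.
Variable C : fps R -> fps R -> Prop.
Hypothesis HC : is_algebra_rel C.

Lemma algrel_scale c f g : C f g -> C (psscale c f) (psscale c g).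
Proof.
by case: HC => hc _ hm fg; have := hm _ _ _ _ (hc c) fg; rewrite !psmul_const.
Qed.

Lemma algrel_sum (I : eqType) (r : seq I) (F G : I -> fps R) :
  (forall i, i \in r -> C (F i) (G i)) ->
  C (fun m => \sum_(i <- r) F i m) (fun m => \sum_(i <- r) G i m).
Proof.
case: HC => hc ha _; elim: r => [|i r IH] h.
  have := hc 0; rewrite (_ : psconst 0 = fun=> 0); last first.
    by apply/funext => m; rewrite /psconst if_same.
  by congr C; apply/funext => m; rewrite big_nil.
have -> : (fun m => \sum_(i <- i :: r) F i m) = psadd (F i) (fun m => \sum_(i <- r) F i m).
  by apply/funext => m; rewrite big_cons.
have -> : (fun m => \sum_(i <- i :: r) G i m) = psadd (G i) (fun m => \sum_(i <- r) G i m).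
  by apply/funext => m; rewrite big_cons.
apply: ha; first by apply: h; rewrite mem_head.
by apply: IH => j jr; apply: h; rewrite inE jr orbT.
Qed.

(** p_(k+1) is isolated in both Newton identities. Replacing e by h, and each earlier p_(i+1) by its
    signed image, makes the signs in the first identity cancel; its right side becomes that of the
    second times (-1)^k. *)
Lemma algrel_psum k :
  (forall k, C (elem R k) (complete R k)) ->
  C (psum R k.+1) (psscale ((-1) ^+ k) (psum R k.+1)).
Proof.
move=> he; have [hc ha hm] := HC; elim/ltn_ind: k => k IH.
pose F f (i : 'I_k) := psscale ((-1) ^+ i) (psmul (psum R i.+1) (f (k - i)%N)) : fps R.
pose G f (i : 'I_k) := psscale ((-1) ^+ i) (psmul (psscale ((-1) ^+ i) (psum R i.+1)) (f (k - i)%N)) : fps R.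
have e1 : psum R k.+1 = psscale ((-1) ^+ k) (psadd (psscale k.+1%:R (elem R k.+1))
    (psscale (-1) (fun m => \sum_i F (elem R) i m))).
  apply/funext => m; have := elem_newton R k m; rewrite big_ord_recr /= subnn elem0.
  rewrite /psscale /psadd => ->; rewrite mulN1r addrAC subrr add0r mulrA.
  rewrite -expr2 sqrr_sign mul1r.
  by rewrite psmulr1.
have e2 : psum R k.+1 = psadd (psscale k.+1%:R (complete R k.+1))
    (psscale (-1) (fun m => \sum_i G (complete R) i m)).
  apply/funext => m; have := complete_newton R k m; rewrite big_ord_recr /= subnn complete0.
  have e : \sum_i G (complete R) i m = \sum_(i < k) psmul (psum R i.+1) (complete R (k - i)) m.
    apply: eq_bigr => i _.
    by rewrite /G psmulZl /psscale mulrA -expr2 sqrr_sign mul1r.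
  by rewrite /psscale /psadd => ->; rewrite psmulr1 e mulN1r addrAC subrr add0r.
rewrite [X in C X _]e1 [X in C _ (psscale _ X)]e2.
apply: algrel_scale; apply: ha; first exact: algrel_scale.
apply: algrel_scale; apply: algrel_sum => i _; apply: algrel_scale; apply: hm => //.
exact: IH.
Qed.

(** The same identities solved for e_(k+1) and h_(k+1), which takes a division by k + 1. *)
Lemma algrel_elem k :
  (forall k, C (psum R k.+1) (psscale ((-1) ^+ k) (psum R k.+1))) ->
  C (elem R k) (complete R k).
Proof.
move=> hp; have [hc ha hm] := HC; elim/ltn_ind: k => -[|k] IH.
  by rewrite elem0 complete0.
have k1 : (k.+1%:R^-1)%:P * k.+1%:R = 1 :> R.
  by rewrite -polyC_natr -polyCM mulVf // Num.Theory.pnatr_eq0.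
have -> : elem R k.+1 = psscale (k.+1%:R^-1)%:P (fun m => \sum_(i < k.+1)
    psscale ((-1) ^+ i) (psmul (psum R i.+1) (elem R (k - i))) m).
  apply/funext => m; rewrite {1}/psscale.
  by rewrite -[LHS]mul1r -[X in X * _]k1 -mulrA elem_newton.
have -> : complete R k.+1 = psscale (k.+1%:R^-1)%:P (fun m => \sum_(i < k.+1)
    psscale ((-1) ^+ i) (psmul (psscale ((-1) ^+ i) (psum R i.+1)) (complete R (k - i))) m).
  apply/funext => m; rewrite {1}/psscale.
  rewrite -[LHS]mul1r -[X in X * _]k1 -mulrA complete_newton; congr (_ * _).
  apply: eq_bigr => i _.
  by rewrite psmulZl /psscale mulrA -expr2 sqrr_sign mul1r.
apply: algrel_scale; apply: algrel_sum => i _; apply: algrel_scale; apply: hm => //.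
by apply: IH; rewrite ltnS leq_subr.
Qed.

End AlgebraRel.

Lemma omega_graph_algebra : is_algebra_rel (@omega_graph R).
Proof. by split=> *; [apply: OmegaConst | apply: OmegaAdd | apply: OmegaMul]. Qed.

Definition sgnpart (la : seq nat) : R := \prod_(l <- la) (-1) ^+ l.-1.

Lemma omega_graph_psum_part la : 0%N \notin la ->
  omega_graph (psum_part R la) (psscale (sgnpart la) (psum_part R la)).
Proof.
rewrite /psum_part /sgnpart; elim: la => [|[|l] la IH] //.
  move=> _; rewrite !big_nil (_ : psscale 1 _ = psconst 1); first exact: OmegaConst.
  by apply/funext => m; rewrite /psscale mul1r.
rewrite inE negb_or => /andP[_ /IH h]; rewrite !big_cons.
have -> : forall c d f g, psscale (c * d) (psmul f g) = psmul (psscale c f) (psscale d g).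
  move=> c d f g; apply/funext => m; rewrite psmulZl /psscale -mulrA; congr (_ * _).
  rewrite /psmul mulr_fsumr; apply: eq_fsbigr => ab _; ring.
apply: OmegaMul h; apply: algrel_psum; first exact: omega_graph_algebra.
exact: OmegaElem.
Qed.

Lemma rep_psum_part N la : 0%N \notin la -> rep N (psum_part R la) (psumpart N la).
Proof.
rewrite /psum_part /psumpart; elim: la => [|[|l] la IH] //.
  by move=> _; rewrite !big_nil -mpolyC1E; apply: rep_psconst.
rewrite inE negb_or => /andP[_ /IH h]; rewrite !big_cons.
by apply: rep_psmul h; apply: rep_psum.
Qed.

(* Being an algebra relation, this contains the graph of omega; the uniqueness of
   power sum expansions then makes omega single-valued. *)
Definition has_expansion f g := exists l : seq (R * seq nat),
  all (fun x => 0%N \notin x.2) l /\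
  forall N, rep N f (pexp N (fun=> 1) l) /\ rep N g (pexp N sgnpart l).

Lemma pexp_mul N (h : seq nat -> R) l1 l2 :
  (forall la mu, h (la ++ mu) = h la * h mu) ->
  pexp N h l1 * pexp N h l2 = pexp N h [seq (x.1 * y.1, x.2 ++ y.2) | x <- l1, y <- l2].
Proof.
move=> hM; rewrite /pexp big_distrlr /= big_flatten big_map.
apply: eq_bigr => x _; rewrite big_map; apply: eq_bigr => y _ /=.
rewrite hM /psumpart big_cat /=.
by rewrite -scalerAl -scalerAr scalerA mulrACA.
Qed.

Lemma sgnpart_nil : sgnpart [::] = 1.
Proof. exact: big_nil. Qed.

Lemma pexp_cat N h l1 l2 : pexp N h (l1 ++ l2) = pexp N h l1 + pexp N h l2.
Proof. exact: big_cat. Qed.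

Lemma pexp_const N (h : seq nat -> R) c : h [::] = 1 -> pexp N h [:: (c, [::])] = c%:MP.
Proof.
move=> h0; rewrite /pexp big_seq1 [psumpart N _]big_nil h0 mulr1.
by rewrite -mul_malgC mulr1.
Qed.

Lemma has_expansion_algebra : is_algebra_rel has_expansion.
Proof.
split.
- move=> c; exists [:: (c, [::])]; split=> // N.
  by rewrite !pexp_const ?sgnpart_nil //; split; apply: rep_psconst.
- move=> f f' g g' [l1 [p1 h1]] [l2 [p2 h2]]; exists (l1 ++ l2).
  split=> [|N]; first by rewrite all_cat p1.
  have [a b] := h1 N; have [c d] := h2 N; rewrite !pexp_cat.
  by split; [exact: rep_psadd a c | exact: rep_psadd b d].
- move=> f f' g g' [l1 [p1 h1]] [l2 [p2 h2]].
  exists [seq (x.1 * y.1, x.2 ++ y.2) | x <- l1, y <- l2].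
  split=> [|N].
    apply/allP => _ /allpairsP[[x y] /= [xl yl ->]] /=.
    by rewrite mem_cat negb_or (allP p1) ?(allP p2).
  rewrite -!pexp_mul.
  + have [a b] := h1 N; have [c d] := h2 N.
    by split; [exact: rep_psmul a c | exact: rep_psmul b d].
  + by move=> la mu; rewrite /sgnpart big_cat.
  + by move=> *; rewrite mulr1.
Qed.

Lemma has_expansion_psum k :
  has_expansion (psum R k.+1) (psscale ((-1) ^+ k) (psum R k.+1)).
Proof.
exists [:: (1, [:: k.+1])]; split=> // N.
have e h : pexp N h [:: (1, [:: k.+1])] = h [:: k.+1] *: psumN _ N k.+1.
  by rewrite /pexp big_seq1 [psumpart N _]big_seq1 mul1r.
rewrite !e scale1r [sgnpart _]big_seq1; split; first exact: rep_psum.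
by move=> m mN; rewrite /psscale mcoeffZ -(rep_psum _ _ mN).
Qed.

Lemma omega_graph_expansion f g : omega_graph f g -> has_expansion f g.
Proof.
have [hc ha hm] := has_expansion_algebra.
elim=> *; [|exact: hc|exact: ha|exact: hm].
by apply: algrel_elem; [exact: has_expansion_algebra | exact: has_expansion_psum].
Qed.

Lemma sgnpart_perm la mu : perm_eq la mu -> sgnpart la = sgnpart mu.
Proof. by move=> p; apply: perm_big. Qed.

Lemma pexp_below N h l m : (pexp N h l)@_m != 0 -> below N m.
Proof.
move=> nz i Ni; apply/eqP; apply: contraNT nz => mi; apply/eqP.
rewrite /pexp raddf_sum big1 // => x _; rewrite /= mcoeffZ coef_psumpart.
case: (posnP (asgn_count N x.2 m)) => [->|]; first by rewrite mulr0.
case/asgn_countP => s [ss /allP sN e]; case/negP: mi; rewrite e asgn_notin //.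
by apply: contraL Ni => /sN; rewrite -ltnNge.
Qed.

(** [rep N] only controls monomials in the first N variables, and by [pexp_below] these expansions
    contain no others. *)
Lemma rep_pexp_eq N f h1 h2 l1 l2 : rep N f (pexp N h1 l1) -> rep N f (pexp N h2 l2) ->
  pexp N h1 l1 = pexp N h2 l2.
Proof.
move=> r1 r2; apply/malgP => m.
have [b|nb] := pselect (below N m); first exact: etrans (esym (r1 m b)) (r2 m b).
have z h l : (pexp N h l)@_m = 0.
  by apply/eqP; apply: contra_notT nb; apply: pexp_below.
exact: etrans (z h1 l1) (esym (z h2 l2)).
Qed.

Definition negl (l : seq (R * seq nat)) := [seq (- x.1, x.2) | x <- l].

Lemma pexp_negl N h l1 l2 : pexp N h (l1 ++ negl l2) = pexp N h l1 - pexp N h l2.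
Proof.
rewrite pexp_cat /pexp big_map -sumrN; congr (_ + _).
by apply: eq_bigr => x _; rewrite /= mulNr scaleNr.
Qed.

Lemma negl_pos l1 l2 : all (fun x => 0%N \notin x.2) l1 -> all (fun x => 0%N \notin x.2) l2 ->
  all (fun x => 0%N \notin x.2) (l1 ++ negl l2).
Proof. by move=> p1 p2; rewrite all_cat p1 all_map. Qed.

(** The two expansions of [f] differ by a combination that vanishes in all numbers of variables, so
    its class sums vanish. Signs are constant on classes, hence the signed expansions of the images
    agree too. *)
Lemma omega_graph_fun (f g1 g2 : fps R) : omega_graph f g1 -> omega_graph f g2 -> g1 = g2.
Proof.
move=> /omega_graph_expansion[l1 [p1 h1]] /omega_graph_expansion[l2 [p2 h2]].
have p12 := negl_pos p1 p2.
have z N : pexp N (fun=> 1) (l1 ++ negl l2) = 0.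
  by rewrite pexp_negl (rep_pexp_eq (proj1 (h1 N)) (proj1 (h2 N))) subrr.
have cz := pexp_classes0 p12 z.
have e N : pexp N sgnpart l1 = pexp N sgnpart l2.
  apply/eqP; rewrite -subr_eq0 -pexp_negl; apply/eqP; apply/malgP => m.
  rewrite mcoeff0 /pexp raddf_sum /=.
  under eq_bigr => x _ do rewrite mcoeffZ coef_psumpart -mulrA.
  apply: (@sum_classes0 R^o _ xpredT (fun la => sgnpart la * (asgn_count N la m)%:R)) => //.
    by move=> la mu p; rewrite (sgnpart_perm p) (asgn_count_perm N m p).
  by move=> la /mapP[x xl ->] _; apply: cz; apply: (allP p12).
apply/funext => m; have [N mN] := below_exists m.
by rewrite (proj2 (h1 N.+1) m mN) e -(proj2 (h2 N.+1) m mN).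
Qed.

Lemma omegaE (f g : fps R) : omega_graph f g -> omega f = g.
Proof.
move=> fg; apply: xget_unique => // g' fg'; exact: omega_graph_fun fg' fg.
Qed.

End RatSeries.

Lemma sum_tupleS (V : nmodType) (T : finType) n (F : n.+1.-tuple T -> V) :
  \sum_(u : n.+1.-tuple T) F u = \sum_(x : T) \sum_(w : n.-tuple T) F [tuple of x :: w].
Proof.
rewrite pair_big /= (reindex (fun xw : T * n.-tuple T => [tuple of xw.1 :: xw.2])) //=.
exists (fun u : n.+1.-tuple T => (thead u, [tuple of behead u])) => [[x w] _|u _] /=.
  by congr (_, _); apply: val_inj.
by rewrite [u in RHS]tuple_eta; apply: val_inj.
Qed.

Lemma ordS_inj n : injective (@ordS n).
Proof. exact: can_inj (@ordSK n). Qed.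

(** * The chromatic series of the cycle *)

Section TraceWalks.
Variables (K : comNzRingType) (N : nat) (A : 'M[K]_N.+1).

Fixpoint walk_prod (x : 'I_N.+1) (s : seq 'I_N.+1) : K :=
  if s is y :: s' then A x y * walk_prod y s' else 1.

Lemma mx_exp_walks n i j : (A ^+ n.+1) i j =
  \sum_(w : n.-tuple 'I_N.+1) walk_prod i (rcons w j).
Proof.
elim: n i => [|n IH] i.
  rewrite (big_pred1 [tuple]) => [|w]; first by rewrite /= mulr1 expr1.
  by apply/esym/eqP; exact: tuple0.
rewrite exprS mxE sum_tupleS; apply: eq_bigr => k _.
by rewrite IH mulr_sumr; apply: eq_bigr.
Qed.

Lemma walk_prodE x s y0 : walk_prod x s =
  \prod_(i < size s) A (nth y0 (x :: s) i) (nth y0 s i).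
Proof.
elim: s x => [|y s IH] x /=; first by rewrite big_ord0.
by rewrite big_ord_recl IH.
Qed.

Lemma mxtrace_exp_walks n : \tr (A ^+ n.+1) =
  \sum_(u : n.+1.-tuple 'I_N.+1) \prod_i A (tnth u i) (tnth u (ordS i)).
Proof.
rewrite sum_tupleS; apply: eq_bigr => x _; rewrite mx_exp_walks; apply: eq_bigr => w _.
rewrite (walk_prodE _ _ x) size_rcons size_tuple; apply: eq_bigr => i _.
rewrite !(tnth_nth x) /=; congr (A _ _).
  rewrite -rcons_cons nth_rcons /= size_tuple ltn_ord //.
rewrite nth_rcons size_tuple; have [im|mi] := ltnP i n.
  by rewrite modn_small.
have -> : i = n :> nat by apply/eqP; rewrite eqn_leq mi -ltnS ltn_ord.
by rewrite modnn eqxx.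
Qed.

End TraceWalks.

Lemma cycle_proper n (k : {ffun 'I_n -> nat}) :
  proper_coloring (@cycle_digraph n) k <-> forall i, k i != k (ordS i).
Proof.
split=> [h i|h u v]; first by apply/eqP/h; rewrite /adj /cycle_digraph eqxx.
by case/orP => /eqP -> e; [have := h u; rewrite e eqxx | have := h v; rewrite -e eqxx].
Qed.

Lemma cycle_asc n (k : {ffun 'I_n -> nat}) :
  asc (@cycle_digraph n) k = (\sum_i (k i < k (ordS i)))%N.
Proof.
rewrite /asc; pose f (i : 'I_n) := (i, ordS i).
have fI : injective f by move=> i j [].
have -> : (\sum_i (k i < k (ordS i)) = #|[set i | k i < k (ordS i)]|)%N.
  by rewrite -sum1_card [RHS]big_mkcond; apply: eq_bigr => i _; rewrite inE; case: ifP.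
rewrite -(card_imset _ fI); apply: eq_card => -[i j]; rewrite inE /=.
apply/andP/imsetP => [[/eqP -> h]|[i' h [-> ->]]]; first by exists i; rewrite ?inE.
by rewrite inE in h; rewrite /cycle_digraph eqxx.
Qed.

Lemma coloring_monE (V : finType) (k : {ffun V -> nat}) j :
  coloring_mon k j = (\sum_v (k v == j))%N.
Proof.
rewrite /coloring_mon (big_morph (fun m : {cmonom nat} => m j)
  (fun a b => mulcmE a b j) (onecmE j)).
by apply: eq_bigr => v _; rewrite ucmE.
Qed.

Section ChromaticTrace.
Variable R : comNzRingType.
Local Notation K := {malg R[{cmonom nat}]}.
Variables (t : R) (N n : nat).
Implicit Type u : n.+1.-tuple 'I_N.+1.

Definition tK : K := t%:MP.
Definition xK (i : 'I_N.+1) : K := xvar _ i.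

Definition col_of u : {ffun 'I_n.+1 -> nat} := [ffun i => val (tnth u i)].

Lemma col_of_inj : injective col_of.
Proof.
move=> u v /ffunP e; apply: eq_from_tnth => i; apply: val_inj.
by have := e i; rewrite !ffunE.
Qed.

(** An entry carries the variable of the vertex it leads to; around the cycle each vertex is reached
    once, so all variables of the colouring appear. *)
Lemma prod_cyc_mx u : \prod_i cyc_mx tK xK (tnth u i) (tnth u (ordS i)) =
  (\prod_i (if (tnth u i < tnth u (ordS i))%N then t
           else (tnth u (ordS i) < tnth u i)%N%:R) : R)%:MP
  * << coloring_mon (col_of u) >>.
Proof.
have -> : << coloring_mon (col_of u) >> = \prod_i xK (tnth u (ordS i)).
  transitivity (\prod_i xK (tnth u i)); last first.
    by rewrite [LHS](reindex_inj (@ordS_inj n.+1)).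
  rewrite /xK prod_xvar.
  rewrite /coloring_mon (eq_bigr (fun i => ucm (val (tnth u i)))) => [|i _].
    by [].
  by rewrite ffunE.
rewrite rmorph_prod -big_split; apply: eq_bigr => i _; rewrite mxE /=.
case: ifP => // _; case: ifP => _; first by rewrite mpolyC1E mul1r.
by rewrite mulr0n malgC0E mul0r.
Qed.

Lemma prod_asc u : \prod_i (if (tnth u i < tnth u (ordS i))%N then t
           else (tnth u (ordS i) < tnth u i)%N%:R) =
  t ^+ asc (@cycle_digraph n.+1) (col_of u) *+ [forall i, col_of u i != col_of u (ordS i)].
Proof.
rewrite cycle_asc; case: forallP => h.
  rewrite mulr1n -prodrXr; apply: eq_bigr => i _; have := h i; rewrite !ffunE /=.
  by case: ltngtP => // _; rewrite ?expr1 ?expr0.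
rewrite mulr0n; have /existsP[i] : [exists i, ~~ (col_of u i != col_of u (ordS i))].
  by rewrite -negb_forall; apply/forallP.
rewrite negbK !ffunE => /eqP e; rewrite (bigD1 i) //= e ltnn mul0r //.
Qed.

End ChromaticTrace.

Lemma rep_chromatic N n :
  rep N.+1 (chromatic (@cycle_digraph n.+1)) (\tr (cyc_mx (tK 'X) (@xK _ N) ^+ n.+1)).
Proof.
move=> m mN; rewrite mxtrace_exp_walks raddf_sum /chromatic /=.
pose A := [set k | proper_coloring (@cycle_digraph n.+1) k /\ coloring_mon k = m]%classic.
pose r := [seq k <- [seq @col_of N n u | u : n.+1.-tuple 'I_N.+1] | `[< A k >]].
rewrite (fsbigE r); first last.
- move=> k Ak; case/negP; rewrite mem_filter; apply/andP; split; first exact/asboolP.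
  have kN i : (k i < N.+1)%N.
    rewrite ltnNge; apply/negP => /mN /eqP; case: Ak => _ <-.
    by rewrite coloring_monE (bigD1 i) //= eqxx.
  apply/mapP; exists [tuple (Ordinal (kN i)) | i < n.+1]; first by rewrite mem_enum.
  by apply/ffunP => i; rewrite ffunE tnth_mktuple.
- by move=> k /=; rewrite mem_filter => /andP[/asboolP].
- by rewrite filter_uniq // map_inj_uniq ?enum_uniq //; apply: col_of_inj.
rewrite big_filter_cond big_map big_enum_cond /= big_mkcond; apply: eq_bigr => u _.
rewrite prod_cyc_mx mcoeffCM mcoeffU1 prod_asc.
have AE : A (col_of u) <-> [forall i, col_of u i != col_of u (ordS i)] /\ coloring_mon (col_of u) = m.
  by split=> -[h1 h2]; split=> //; [apply/forallP/cycle_proper | apply/cycle_proper/forallP].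
case: asboolP => Au.
  case/AE: (Au) => -> ->; rewrite eqxx mulr1 mulr1n ifT // inE; exact: Au.
rewrite andFb; case: forallP => [/forallP h|]; last by rewrite mulr0n mul0r.
case: (coloring_mon _ =P m) => [e|]; last by rewrite mulr0.
by case: Au; apply/AE.
Qed.

(** * The chromatic series and its image in power sums *)

Section TraceExpansion.
Variables (R : comNzRingType) (q0 : {rmorphism rat -> R}) (t : R) (a : nat -> R).
Local Notation K := {malg R[{cmonom nat}]}.
Hypothesis t_reg : forall c : R, (1 - t) * c = 0 -> c = 0.
Hypothesis Ha : forall m, \sum_(k < m.+1) 'C(m, k)%:R * a k * (t - 1) ^+ (m - k)
  = t * a m + (1 - t) *+ (m == 0%N).

Lemma tK_reg (c : K) : (1 - tK t) * c = 0 -> c = 0.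
Proof.
move=> e; apply/malgP => m; rewrite mcoeff0; apply: t_reg.
by rewrite -mcoeffCM rmorphB rmorph1 -/(tK t) e mcoeff0.
Qed.

Lemma trace_expansion N D :
  \tr (cyc_mx (tK t) (@xK R N) ^+ D.+1) = \sum_(la <- parts D.+1 D.+1)
   (q0 ((zpart la)%:R^-1) * (D.+1%:R * t * a (size la).-1 * \prod_(l <- la) qnum t l
      - (t ^+ D.+1 *+ D.+1) *+ (la == [:: D.+1])) * \prod_(l <- la) (-1) ^+ l.-1)
    *: \prod_(l <- la) psumN R N.+1 l.
Proof.
pose q : {rmorphism rat -> K} := malgC \o q0.
rewrite (@trser_cyc _ (tK t) N _ q (fun m => (a m)%:MP)).
- apply: eq_bigr => la _; rewrite big_split /= mulrA -mul_malgC.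
  congr (_ * _).
  have qn l : qnum (tK t) l = (qnum t l)%:MP.
    by rewrite /qnum rmorph_sum; apply: eq_bigr => i _; rewrite rmorphXn.
  have e1 : (\prod_(l <- la) qnum t l)%:MP = \prod_(l <- la) qnum (tK t) l :> K.
    by rewrite rmorph_prod; apply: eq_bigr => l _; rewrite qn.
  have e2 : (\prod_(l <- la) (-1) ^+ l.-1)%:MP = \prod_(l <- la) (-1) ^+ l.-1 :> K.
    by rewrite rmorph_prod; apply: eq_bigr => l _; rewrite rmorph_sign.
  apply: esym; rewrite mpolyCM; apply: (congr2 *%R _ e2).
  rewrite mpolyCM; apply: (congr2 *%R (erefl _)).
  rewrite monalgUB; apply: (congr2 (fun u v => u - v)).
    rewrite mpolyCM; apply: (congr2 *%R _ e1).
    by rewrite mpolyCM mpolyCM mpolyC_nat.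
  rewrite monalgUMn monalgUMn; apply: (congr1 (fun u : K => u *+ _ *+ _)).
  exact: rmorphXn.
- exact: tK_reg.
- move=> m.
  have t1 : (t - 1)%:MP = tK t - 1 :> K by rewrite monalgUB mpolyC1E.
  transitivity (\sum_(k < m.+1) ('C(m, k)%:R * a k * (t - 1) ^+ (m - k))%:MP : K).
    apply: eq_bigr => k _; rewrite mpolyCM -t1.
    apply: (congr2 *%R); last by apply: esym; exact: rmorphXn.
    by rewrite mpolyCM mpolyC_nat.
  have -> : \sum_(k < m.+1) ('C(m, k)%:R * a k * (t - 1) ^+ (m - k))%:MP =
      (\sum_(k < m.+1) 'C(m, k)%:R * a k * (t - 1) ^+ (m - k))%:MP :> K.
    by rewrite rmorph_sum.
  rewrite Ha monalgUD mpolyCM monalgUMn; apply: (congr2 +%R (erefl _)).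
  by rewrite monalgUB mpolyC1E.
Qed.

End TraceExpansion.

Lemma psum_expansionE n (c : seq nat -> {poly rat}) :
  psum_expansion n c = fun m => \sum_(la <- parts n n)
    ((zpart la)%:R^-1 : rat)%:P * c la * psum_part {poly rat} la m.
Proof.
apply/funext => m; rewrite /psum_expansion (fsbigE (parts n n)).
- rewrite big_seq_cond [RHS]big_seq_cond; apply: eq_big => [la|la _].
    by rewrite andbT; case: (boolP (la \in _)) => //= h; apply/mem_set; rewrite /= -mem_parts.
  by rewrite -mulrA mul_polyC.
- exact: parts_uniq.
- by move=> la /=; rewrite mem_parts.
- by move=> la /= h; rewrite mem_parts h.
Qed.

Definition cycle_coef n (la : seq nat) : {poly rat} :=
  if la == [:: n] then n%:R * 'X * qint n.-1
  else n%:R * 'X * eulerian (size la).-1 * \prod_(l <- la) qint l.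

Lemma X1_reg (c : {poly rat}) : (1 - 'X) * c = 0 -> c = 0.
Proof.
move/eqP; rewrite mulf_eq0 subr_eq0 => /orP[/eqP e|/eqP//].
have := congr1 (fun p : {poly rat} => p`_1) e; rewrite coefX coef1 /= => /eqP.
by rewrite eq_sym oner_eq0.
Qed.

Lemma eulerian0 : eulerian 0 = 1. Proof. by rewrite eulerianE. Qed.

(** For the partition with one part, n t [n]_t - n t^n = n t [n-1]_t. *)
Lemma cycle_coefE D la :
  D.+1%:R * 'X * eulerian (size la).-1 * \prod_(l <- la) qnum 'X l
      - ('X ^+ D.+1 *+ D.+1) *+ (la == [:: D.+1]) = cycle_coef D.+1 la.
Proof.
rewrite /cycle_coef; case: eqP => [->|_]; last by rewrite mulr0n subr0.
rewrite big_seq1 /= eulerian0 mulr1 mulr1n /qnum big_ord_recr mulrDr /=.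
by rewrite -!mulrA -exprS mulr_natl -/(qint D) mulr_natl addrK.
Qed.

Lemma psscaleA c d f : psscale c (psscale d f) = psscale (c * d) f.
Proof. by apply/funext => m; rewrite /psscale mulrA. Qed.

Lemma sgnpart_sqr la : sgnpart la * sgnpart la = 1.
Proof.
rewrite /sgnpart -big_split big1 // => l _ /=.
by rewrite -expr2 sqrr_sign.
Qed.

Definition expansion_list n (c : seq nat -> {poly rat}) :=
  [seq (((zpart la)%:R^-1 : rat)%:P * c la, la) | la <- parts n n].

Lemma parts_pos n la : la \in parts n n -> 0%N \notin la.
Proof. by rewrite mem_parts => /and3P[]. Qed.

Lemma expansion_list_pos n c : all (fun x => 0%N \notin x.2) (expansion_list n c).
Proof. by apply/allP => _ /mapP[la /parts_pos h ->]. Qed.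

Lemma rep_expansion N n c :
  rep N (fun m => \sum_(la <- parts n n)
     ((zpart la)%:R^-1 : rat)%:P * c la * psum_part {poly rat} la m)
  (pexp N (fun=> 1) (expansion_list n c)).
Proof.
move=> m mN; rewrite /pexp big_map raddf_sum; apply: eq_big_seq => la /parts_pos la0.
by rewrite /= mcoeffZ mulr1 (rep_psum_part la0 mN).
Qed.

(** Each p_l occurs with the sign (-1)^(l-1) that it has in log E; omega multiplies by the same
    sign, so none is left in [omega_chromatic]. *)
Lemma chromatic_expansion D :
  chromatic (@cycle_digraph D.+1) = fun m => \sum_(la <- parts D.+1 D.+1)
    ((zpart la)%:R^-1 : rat)%:P * (cycle_coef D.+1 la * sgnpart la)
      * psum_part {poly rat} la m.
Proof.
apply: (rep_inj (P := fun N => pexp N.+1 (fun=> 1)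
    (expansion_list D.+1 (fun la => cycle_coef D.+1 la * sgnpart la)))) => N; last first.
  exact: rep_expansion.
have := @rep_chromatic N D.
rewrite (@trace_expansion _ polyC 'X eulerian X1_reg eulerian_rec).
suff -> : pexp N.+1 (fun=> 1) (expansion_list D.+1 (fun la => cycle_coef D.+1 la * sgnpart la))
   = \sum_(la <- parts D.+1 D.+1)
   (((zpart la)%:R^-1)%:P * (D.+1%:R * 'X * eulerian (size la).-1 * \prod_(l <- la) qnum 'X l
      - ('X ^+ D.+1 *+ D.+1) *+ (la == [:: D.+1])) * \prod_(l <- la) (-1) ^+ l.-1)
    *: \prod_(l <- la) psumN {poly rat} N.+1 l by [].
rewrite /pexp big_map; apply: eq_bigr => la _.
by rewrite cycle_coefE /= mulr1 mulrA.
Qed.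

Lemma omega_chromatic D :
  omega (chromatic (@cycle_digraph D.+1)) = psum_expansion D.+1 (cycle_coef D.+1).
Proof.
apply: omegaE; rewrite chromatic_expansion psum_expansionE.
pose c la : {poly rat} := ((zpart la)%:R^-1 : rat)%:P * (cycle_coef D.+1 la * sgnpart la).
rewrite [X in omega_graph _ X](_ : _ = fun m => \sum_(la <- parts D.+1 D.+1)
    psscale (c la) (psscale (sgnpart la) (psum_part {poly rat} la)) m); last first.
  apply/funext => m; apply: eq_bigr => la _.
  rewrite psscaleA /psscale /c -!mulrA; congr (_ * (_ * _)).
  by rewrite mulrA sgnpart_sqr mul1r.
apply: (@algrel_sum _ omega_graph_algebra _ _ (fun la => psscale (c la) (psum_part {poly rat} la))).
move=> la /parts_pos la0; apply: algrel_scale; first exact: omega_graph_algebra.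
exact: omega_graph_psum_part.
Qed.

Lemma psum_expansion_inj n c d : psum_expansion n c = psum_expansion n d ->
  forall la, is_partn n la -> c la = d la.
Proof.
rewrite !psum_expansionE => e la la_n.
pose l := expansion_list n c ++ negl (expansion_list n d).
have z N : pexp N (fun=> 1) l = 0.
  rewrite pexp_negl; have r := @rep_expansion N n c; rewrite e in r.
  by rewrite (rep_pexp_eq r (@rep_expansion N n d)) subrr.
have := pexp_classes0 (negl_pos (expansion_list_pos n c) (expansion_list_pos n d)) z.
move=> /(_ la); rewrite (parts_pos (n := n)) ?mem_parts // => /(_ isT).
rewrite /l big_cat /negl /expansion_list -map_comp !big_map /=.
(* Partitions are sorted, so each class under [perm_eq] contains only one. *)
have pick (f : seq nat -> {poly rat}) : \sum_(mu <- parts n n | perm_eq mu la) f mu = f la.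
  rewrite big_mkcond (bigD1_seq la) ?parts_uniq ?mem_parts //= perm_refl.
  rewrite big_seq_cond big1 ?addr0 // => mu /andP[mun mula]; case: ifP => // pm.
  case/eqP: mula; move: mun; rewrite mem_parts => /and3P[smu _ _].
  case/and3P: la_n => sla _ _.
  apply: (sorted_eq (leT := geq)) => //.
    by move=> x y z'; exact: (rev_trans leq_trans).
  by move=> x y /andP[xy yx]; apply/eqP; rewrite eqn_leq; apply/andP; split.
rewrite !pick -mulrBr => /eqP; rewrite mulf_eq0 polyC_eq0 invr_eq0.
rewrite Num.Theory.pnatr_eq0 gtn_eqF ?zpart_gt0 //=; last by case/and3P: la_n.
by rewrite subr_eq0 => /eqP.
Qed.

Lemma omega_chromatic_cycle n (c : seq nat -> {poly rat}) : (0 < n)%N ->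
  omega (chromatic (@cycle_digraph n)) = psum_expansion n c
  <-> c [:: n] = n%:R * 'X * qint n.-1
      /\ (forall la : seq nat, is_partn n la -> la <> [:: n] ->
            c la = n%:R * 'X * eulerian (size la).-1 * \prod_(l <- la) qint l).
Proof.
case: n => // D _; rewrite omega_chromatic; split=> [/psum_expansion_inj h|[h1 h2]].
  split=> [|la la_n /eqP /negPf nla].
    by rewrite -h /cycle_coef ?eqxx // /is_partn /= addn0 eqxx.
  by rewrite -h // /cycle_coef nla.
rewrite !psum_expansionE; apply/funext => m; apply: eq_big_seq => la.
rewrite mem_parts /cycle_coef => la_n; case: eqP => [->|nla]; first by rewrite h1.
by rewrite h2.
Qed.

(** * Counting the data of permutations *)

Lemma inv_cycle n (s : 'S_n) :
  inv_digraph (@cycle_digraph n) s = (\sum_(i < n) poslt s (ordS i) i)%N.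
Proof.
rewrite /inv_digraph; pose f (i : 'I_n) := (i, ordS i).
have fI : injective f by move=> i j [].
have -> : (\sum_i poslt s (ordS i) i = #|[set i | poslt s (ordS i) i]|)%N.
  by rewrite -sum1_card [RHS]big_mkcond; apply: eq_bigr => i _; rewrite inE; case: ifP.
rewrite -(card_imset _ fI); apply: eq_card => -[i j]; rewrite inE /=.
apply/andP/imsetP => [[/eqP -> h]|[i' h [-> ->]]]; first by exists i; rewrite ?inE.
by rewrite inE in h; rewrite /cycle_digraph eqxx.
Qed.

Lemma sum_Nset n K (la : seq nat) : (1 < n)%N -> sumn la = n -> 0%N \notin la ->
  size la = K.+1 ->
  \sum_(s in Nset (@cycle_digraph n) la) 'X^(inv_digraph (@cycle_digraph n) s) =
  \sum_(p : {ffun 'I_n -> 'I_K.+1} * {ffun 'I_n -> bool} | valid_data la p)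
     'X^(\sum_i p.2 i) :> {poly rat}.
Proof.
move=> n1 sla la0 laK.
have inj := @seg_data_inj _ K _ n1 sla la0 laK.
rewrite (eq_bigl (mem [set (seg_block K la s, seg_dir s) | s in Nset (@cycle_digraph n) la])).
  rewrite big_imset //=; apply: eq_bigr => s _; rewrite inv_cycle; congr 'X^_.
  by apply: eq_bigr => i _; rewrite ffunE.
case=> c d; apply/idP/imsetP => [/(valid_exists n1 sla la0 laK)[s sN <-]|[s sN ->]].
  by exists s.
exact: seg_data_valid.
Qed.

(** Double counting of pairs (object, marked vertex): rotation carries the objects marked at one
    vertex to those marked at the next, so all vertices contribute equally. *)
Lemma sum_marked n (X : finType) (P : pred X) (M : X -> pred 'I_n.+1) (rot : X -> X)
    (F : X -> {poly rat}) :
  injective rot -> (forall x, P (rot x) = P x) -> (forall x, F (rot x) = F x) ->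
  (forall x i, M (rot x) i = M x (ordS i)) -> (forall x, P x -> #|M x| = 1%N) ->
  \sum_(x | P x) F x = n.+1%:R * \sum_(x | P x && M x ord0) F x.
Proof.
move=> rI rP rF rM M1.
have SS i : \sum_(x | P x && M x (ordS i)) F x = \sum_(x | P x && M x i) F x.
  rewrite [RHS](reindex_inj rI); apply: eq_big => [x|x _]; rewrite ?rF //.
  by rewrite rP rM.
have S0 i : \sum_(x | P x && M x i) F x = \sum_(x | P x && M x ord0) F x.
  by have [k <-] := ordS_reach ord0 i; elim: k => //= k <-; rewrite SS.
transitivity (\sum_(x | P x) \sum_(i | M x i) F x).
  by apply: eq_bigr => x /M1 Mx; rewrite sumr_const Mx.
transitivity (\sum_(i < n.+1) \sum_(x | P x && M x i) F x).
  by rewrite (exchange_big_dep xpredT).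
by rewrite (eq_bigr _ (fun i _ => S0 i)) sumr_const card_ord mulr_natl.
Qed.

(** * Rotation of colourings and orientations *)

Section Rotation.
Variables (n K : nat) (la : seq nat).
Implicit Type p : {ffun 'I_n -> 'I_K.+1} * {ffun 'I_n -> bool}.

Definition rot_data p : {ffun 'I_n -> 'I_K.+1} * {ffun 'I_n -> bool} :=
  ([ffun i => p.1 (ordS i)], [ffun i => p.2 (ordS i)]).

Lemma rot_data_inj : injective rot_data.
Proof.
case=> [c d] [c' d'] [/ffunP ec /ffunP ed']; congr (_, _); apply/ffunP => i.
  by have := ec (ord_pred i); rewrite !ffunE ord_predK.
by have := ed' (ord_pred i); rewrite !ffunE ord_predK.
Qed.

Lemma forall_ordS (P : pred 'I_n) : [forall i, P (ordS i)] = [forall i, P i].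
Proof.
apply/forallP/forallP => h i; last exact: h.
by rewrite -[i]ord_predK.
Qed.

Lemma card_ordS (P : pred 'I_n) : #|[set i | P (ordS i)]| = #|[set i | P i]|.
Proof.
have oI : injective (@ordS n) := can_inj (@ordSK n).
rewrite -(card_imset _ oI); apply: eq_card => i.
apply/imsetP/idP => [[j]|]; first by rewrite !inE => Pj ->.
by rewrite inE => Pi; exists (ord_pred i); rewrite ?inE ord_predK.
Qed.

Lemma ed_rot (d : {ffun 'I_n -> bool}) x y :
  ed [ffun i => d (ordS i)] y x = ed d (ordS y) (ordS x).
Proof.
by rewrite /ed !ffunE !(inj_eq (can_inj (@ordSK n))).
Qed.

Lemma root_rot p x : block_root (rot_data p).1 (rot_data p).2 x = block_root p.1 p.2 (ordS x).
Proof.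
rewrite /block_root -[RHS]forall_ordS; apply: eq_forallb => y.
by rewrite ed_rot !ffunE.
Qed.

Lemma valid_rot p : valid_data la (rot_data p) = valid_data la p.
Proof.
rewrite /valid_data; congr [&& _, _, _ & _].
- apply: eq_forallb => j; rewrite -[in RHS](card_ordS (fun x => p.1 x == j)).
  by congr (_ == _); apply: eq_card => x; rewrite !inE ffunE.
- by rewrite -[RHS]forall_ordS; apply: eq_forallb => j; rewrite !ffunE.
- by rewrite -[RHS]forall_ordS; apply: eq_forallb => j; rewrite !ffunE.
- apply: eq_forallb => j; rewrite -[in RHS](card_ordS (fun x => (p.1 x == j) && block_root p.1 p.2 x)).
  by congr (_ == _); apply: eq_card => x; rewrite !inE root_rot ffunE.
Qed.

Lemma weight_rot p : (\sum_i (rot_data p).2 i = \sum_i p.2 i)%N.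
Proof.
rewrite [RHS](reindex_inj (can_inj (@ordSK n))).
by apply: eq_bigr => i _; rewrite ffunE.
Qed.

Lemma block_rootE p x : block_root p.1 p.2 x =
  ~~ ((p.1 (ord_pred x) == p.1 x) && ~~ p.2 (ord_pred x)) && ~~ ((p.1 (ordS x) == p.1 x) && p.2 x).
Proof.
apply/forallP/andP => [h|[h1 h2] y].
  split; apply/negP => /andP[h1 h2].
    by have := h (ord_pred x); rewrite /ed ord_predK eqxx h2 h1.
  by have := h (ordS x); rewrite /ed eqxx h2 orbT h1.
apply/negP => /andP[/orP[/andP[/eqP e h]|/andP[/eqP e h]] h3].
  by case/negP: h1; rewrite e ordSK h -e h3.
by case/negP: h2; rewrite -e h3 h.
Qed.

End Rotation.

(** * The partition with one part *)

Section OneBlock.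
Variable m : nat.
Implicit Type d : {ffun 'I_m.+1 -> bool}.

(** Vertex 0 is a source, and along the rest of the cycle the direction switches only once, from
    false to true, at the unique sink. *)
Definition one_sink d := (d ord_max && ~~ d ord0) &&
  [forall i : 'I_m.+1, (0 < i)%N ==> (d (ord_pred i) ==> d i)].

(** The sink is the vertex m - p. The parameter is chosen so that p + 1 edges are reversed. *)
Definition step_dir (p : 'I_m) : {ffun 'I_m.+1 -> bool} := [ffun i : 'I_m.+1 => (m - p <= i)%N].

Lemma val_ord_pred (i : 'I_m.+1) : (0 < i)%N -> ord_pred i = i.-1 :> nat.
Proof.
move=> i0 /=; have -> : (i + m.+1).-1 = (i.-1 + m.+1)%N by lia.
by rewrite modnDr modn_small // (leq_ltn_trans (leq_pred i)).
Qed.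

Lemma sum_step_dir p : (\sum_i step_dir p i = p.+1)%N.
Proof.
rewrite (eq_bigr (fun i : 'I_m.+1 => (m - p <= i)%N : nat)) => [|i _]; last by rewrite ffunE.
rewrite -(big_mkord xpredT (fun i => (m - p <= i)%N : nat)).
have pm := ltn_ord p.
rewrite (big_cat_nat (leq0n (m - p)) (_ : m - p <= m.+1)%N) /=; last by lia.
rewrite big_nat_cond big1 => [|i /andP[/andP[_ im] _]]; last by rewrite leqNgt im.
rewrite add0n big_nat_cond (eq_bigr (fun=> 1%N)) => [|i /andP[/andP[im _] _]]; last by rewrite im.
by rewrite -big_nat_cond sum_nat_const_nat muln1; lia.
Qed.

Lemma one_sink_step d : one_sink d -> exists p, d = step_dir p.
Proof.
case/andP => /andP[dm d0] /forallP mono.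
have monok k (i j : 'I_m.+1) : j = (i + k)%N :> nat -> d i -> d j.
  elim: k j => [|k IH] j e di; first by rewrite (_ : j = i) //; apply: val_inj; rewrite /= e addn0.
  have j0 : (0 < j)%N by rewrite e addnS.
  have := mono j; rewrite j0 /= => /implyP; apply; apply: IH => //.
  by rewrite val_ord_pred // e addnS.
have ex : exists q, [exists i : 'I_m.+1, (val i == q) && d i].
  by exists m; apply/existsP; exists ord_max; rewrite eqxx.
case: (ex_minnP ex) => q /existsP[i /andP[/eqP iq di]] qmin.
have q0 : (0 < q)%N.
  by rewrite -iq lt0n; apply: contraNneq d0 => i0; rewrite (_ : ord0 = i) //; apply: val_inj.
have qm : (q <= m)%N by rewrite -iq -ltnS ltn_ord.
have pm : (m - q < m)%N by lia.
exists (Ordinal pm); apply/ffunP => j; rewrite ffunE /= subKn //.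
apply/idP/idP => [dj|qj]; first by apply: qmin; apply/existsP; exists j; rewrite eqxx.
by apply: (monok (j - q)%N i) => //; rewrite -iq /= in qj *; lia.
Qed.

Lemma step_one_sink p : one_sink (step_dir p).
Proof.
have pm := ltn_ord p.
rewrite /one_sink !ffunE /= leq_subr leqn0 subn_eq0 -ltnNge pm /=.
apply/forallP => i; apply/implyP => i0; rewrite !ffunE val_ord_pred //; lia.
Qed.

Lemma sum_one_sink : \sum_(d | one_sink d) 'X^(\sum_i d i)%N = 'X * qint m :> {poly rat}.
Proof.
rewrite (eq_bigl (mem [set step_dir p | p in 'I_m])); last first.
  move=> d; apply/idP/imsetP => [/one_sink_step[p ->]|[p _ ->]]; first by exists p.
  exact: step_one_sink.
rewrite big_imset /=; last first.
  move=> p q _ _ e; apply: val_inj; apply: succn_inj.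
  by rewrite -!sum_step_dir e.
rewrite /qint mulr_sumr; apply: eq_bigr => p _.
by rewrite sum_step_dir exprS.
Qed.

Lemma sum_valid_one_block : (0 < m)%N ->
  \sum_(p : {ffun 'I_m.+1 -> 'I_1} * {ffun 'I_m.+1 -> bool} | valid_data [:: m.+1] p)
     'X^(\sum_i p.2 i)%N = m.+1%:R * 'X * qint m :> {poly rat}.
Proof.
move=> m0.
(* The mark is the unique source, which rotation brings to vertex 0. *)
rewrite (@sum_marked m _ (valid_data [:: m.+1]) (fun p i => block_root p.1 p.2 i) (@rot_data _ _)).
- rewrite -mulrA -sum_one_sink; congr (_ * _).
  pose h d : {ffun 'I_m.+1 -> 'I_1} * {ffun 'I_m.+1 -> bool} := ([ffun=> ord0], d).
  rewrite (reindex_onto h (fun p => p.2)) /=; last first.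
    by case=> c d _; congr (_, _); apply/ffunP => i; rewrite !ord1.
  apply: eq_bigl => d; rewrite eqxx andbT.
  have rE x : block_root (h d).1 (h d).2 x = d (ord_pred x) && ~~ d x.
    by rewrite block_rootE /= !ffunE eqxx negbK.
  have p0 : ord_pred ord0 = ord_max :> 'I_m.+1.
    by apply: val_inj; rewrite /= modn_small.
  rewrite rE p0; apply/andP/andP => [[/and4P[_ _ _ /forallP/(_ ord0)/cards1P[y /setP hy]] r0]|[r0 /forallP mono]].
    have rP x : (d (ord_pred x) && ~~ d x) = (x == y).
      by have := hy x; rewrite !inE rE ffunE eqxx.
    have y0 : ord0 = y by apply/eqP; rewrite -rP p0.
    split=> //; apply/forallP => i; apply/implyP => i0; apply/implyP => di.
    apply: contraT => ndi; have := rP i; rewrite di ndi -y0 => /esym/eqP i0'.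
    by rewrite i0' in i0.
  split=> //; apply/and4P; split; apply/forallP => j.
  - rewrite (ord1 j) (eq_card (B := predT)) ?card_ord //= => x.
    by rewrite !inE ffunE eqxx.
  - by rewrite !ffunE ltnn.
  - by rewrite !ffunE ltnn.
  apply/cards1P; exists ord0; apply/setP => x; rewrite !inE rE ffunE (ord1 j) eqxx /=.
  apply/andP/eqP => [[dp nd]|->]; last by rewrite p0; apply/andP.
  apply/eqP; rewrite -val_eqE /= -leqn0 leqNgt; apply/negP => x0.
  by have := mono x; rewrite x0 dp (negPf nd).
- exact: rot_data_inj.
- by move=> p; rewrite valid_rot.
- by move=> p; rewrite weight_rot.
- by move=> p i; rewrite root_rot.
- move=> p /and4P[_ _ _ /forallP/(_ ord0)/eqP e]; apply: etrans e.
  by apply: eq_card => i; rewrite [RHS]inE (ord1 (p.1 i)) eqxx.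
Qed.
End OneBlock.

(** * Reading the cycle as a word *)

Section Automaton.
Variable la : seq nat.
Hypothesis la_pos : 0%N \notin la.
Implicit Types (b j r : nat) (ph e : bool) (S : seq nat) (w : seq (nat * bool)).

(* A letter (b', e) is the color of the next vertex along the cycle and whether
   that vertex precedes the current one. Of the current color b, r vertices are
   still to come; ph tells whether the root of this color has not been passed;
   S lists the colors not yet met. *)
Fixpoint accepts b ph r S w : bool :=
  match w with
  | [::] => (r == 0%N) && (S == [::])
  | (b', e) :: w' =>
      if r is r'.+1 then [&& b' == b, ph || ~~ e & accepts b e r' S w']
      else [&& b' \in S, e == (b' < b)%N & accepts b' true (nth 0%N la b').-1 (rem b' S) w']
  end.

(** [ph] says that the vertex just read is not disqualified as a root by the one before it. Within a
    colour it becomes [e], and a new colour resets it; this is also the phase kept by [accepts]. *)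
Fixpoint nroots j b ph w : nat :=
  match w with
  | [::] => ph && (b == j)
  | (b', e) :: w' =>
      if b' == b then ((ph && ~~ e && (b == j)) + nroots j b e w')%N
      else ((ph && (b == j)) + nroots j b' true w')%N
  end.

Fixpoint chain b w : bool :=
  match w with
  | [::] => true
  | (b', e) :: w' => [&& (b < b')%N ==> ~~ e, (b' < b)%N ==> e & chain b' w']
  end.

Definition colors w := [seq x.1 | x <- w].

Lemma nroots0 j b ph w : b != j -> j \notin colors w -> nroots j b ph w = 0%N.
Proof.
elim: w b ph => [|[b' e] w IH] b ph /= bj; first by rewrite (negPf bj) andbF.
rewrite inE negb_or => /andP[jb' jw]; rewrite (negPf bj) !andbF !add0n.
by case: eqP => _; apply: IH => //; rewrite eq_sym.
Qed.

(** In a run of one colour entered with [ph] true, either some step has [e] false and ends at a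
    root, or [ph] stays true and the last vertex of the run is a root. *)
Lemma nroots_gt0 j b ph w :
  (b == j) && ph || (b != j) && (j \in colors w) -> (0 < nroots j b ph w)%N.
Proof.
elim: w b ph => [|[b' e] w IH] b ph /=; first by rewrite andbF orbF andbC => ->.
case: (eqVneq b j) => [->|bj] /=.
  rewrite orbF => ->; case: (eqVneq b' j) => _; rewrite ?add1n //.
  by case: e => //=; apply: IH; rewrite eqxx.
rewrite inE !andbF !add0n => jw; case: (eqVneq b' b) jw => [->|b'b] jw.
  by apply: IH; move: jw; rewrite eq_sym (negPf bj).
by apply: IH; rewrite andbT; case: (eqVneq b' j) jw.
Qed.

Definition counts b r S w := forall j, count_mem j (colors w) =
  if j == b then r else if j \in S then nth 0%N la j else 0%N.

(** Of the current colour one root is still expected exactly when [ph] holds; of an unmet colour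
    there must be one. *)
Definition roots b ph S w := forall j, j \in b :: S ->
  nroots j b ph w = (if j == b then ph : nat else 1%N).

(** Here the counting of roots is seen to force arcs: the automaton admits only words whose colours
    come in single runs, while the right side asks for the number of vertices and roots of each
    colour. *)
Lemma acceptsP b ph r S w : uniq S -> b \notin S -> {in S, forall j, (j < size la)%N} ->
  accepts b ph r S w <-> [/\ chain b w, counts b r S w & roots b ph S w].
Proof.
elim: w b ph r S => [|[b' e] w IH] b ph r S uS bS Sla.
  split=> [/= /andP[/eqP -> /eqP ->]|[_ cn _]].
    split=> // j; first by rewrite if_same.
    by rewrite inE => /eqP ->; rewrite /= eqxx andbT.
  have /= r0 := cn b; rewrite eqxx in r0; rewrite /= -r0 eqxx /=.
  case: S uS bS Sla cn => // j S _; rewrite inE negb_or => /andP[bj _] Sla cn.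
  have := cn j; rewrite /= eq_sym (negPf bj) inE eqxx /= => e0.
  by move: la_pos; rewrite e0 mem_nth // Sla // inE eqxx.
case: r => [|r] /=.
  split.
    case/and3P => b'S /eqP -> ac.
    have b'b : b' == b = false by apply: contraNF bS => /eqP <-.
    have la_b' : (0 < nth 0%N la b')%N.
      by rewrite lt0n; apply: contraNneq la_pos => <-; rewrite mem_nth // Sla.
    have [ch cn ro] := (IH _ _ _ _ (rem_uniq b' uS) (negbT (mem_rem_uniqF b' uS)) (fun j js => Sla j (mem_rem js))).1 ac.
    split.
    - by rewrite ch andbT; apply/andP; split; apply/implyP => //; lia.
    - move=> j /=; rewrite cn mem_rem_uniq // !inE [b' == j]eq_sym.
      case: (eqVneq j b') => [->|jb'] /=; last by rewrite add0n; case: eqP => // ->; rewrite (negPf bS).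
      by rewrite b'b b'S; lia.
    - move=> j /=; rewrite inE b'b; case: (eqVneq j b) => [-> _|jb /= jS].
        rewrite andbT nroots0 ?addn0 ?b'b //.
        rewrite -has_pred1 has_count cn mem_rem_uniq // inE (negPf bS) andbF [b == b']eq_sym b'b //.
      rewrite andbF add0n ro; first by case: eqP.
      by rewrite inE mem_rem_uniq // inE jS andbT orbN.
  case=> /and3P[c1 c2 ch] cn ro.
  have b'b : b' == b = false.
    by apply/negP => /eqP b'b; have := cn b; rewrite /= b'b !eqxx.
  have b'S : b' \in S.
    by have := cn b'; rewrite /= eqxx b'b; case: ifP.
  rewrite b'S (_ : e == (b' < b)%N) /=; last by case: (e) c1 c2; lia.
  apply/IH; [exact: rem_uniq | by rewrite mem_rem_uniqF | by move=> j /mem_rem/Sla |].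
  split=> //.
    move=> j; have := cn j; rewrite /= mem_rem_uniq // !inE [b' == j]eq_sym.
    case: (eqVneq j b') => [->|jb'] /=; first by rewrite b'b b'S add1n => <-.
    by rewrite add0n => ->; case: eqP => // ->; rewrite (negPf bS).
  move=> j; rewrite inE mem_rem_uniq // inE => jS.
  have jS' : j \in S by case/orP: jS => [/eqP->|/andP[]].
  have jb : b == j = false by apply: contraNF bS => /eqP ->.
  have := ro j; rewrite inE jS' orbT /= b'b jb andbF add0n [j == b]eq_sym jb => -> //.
  by case: ifP.
split.
  case/and3P => /eqP -> phe ac; have [ch cn ro] := (IH _ _ _ _ uS bS Sla).1 ac.
  rewrite ltnn ch; split=> //.
    by move=> j /=; rewrite cn [b == j]eq_sym; case: eqP => // ->; rewrite add1n.
  move=> j jS /=; rewrite eqxx ro // [b == j]eq_sym; case: eqP => _; last by rewrite andbF.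
  by case: (ph) (e) phe => [] [].
case=> /and3P[c1 c2 ch] cn ro.
have rb := ro b; rewrite inE eqxx /= in rb; have {}rb := rb isT.
(* If colour b were left while vertices of it remain, the finished run would have used up the root
   counted by [ph], and the later run would contain another. *)
have b'b : b' = b.
  apply/eqP; apply: contraT => b'b; move: rb; rewrite (negPf b'b) ?eqxx andbT.
  have bw : b \in colors w.
    have := cn b; rewrite /= (negPf b'b) eqxx add0n => h.
    by rewrite -has_pred1 has_count h.
  by have := @nroots_gt0 b b' true w; rewrite (negPf b'b) /= bw => /(_ isT); lia.
subst b'; rewrite eqxx andbT in rb; rewrite eqxx /=.
have phe : ph || ~~ e.
  move: rb; case: (e); last by rewrite orbT.
  rewrite andbF orbF add0n => h.
  by have := @nroots_gt0 b b true w; rewrite eqxx h => /(_ isT); case: (ph).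
rewrite phe; apply/IH => //; split=> //.
  move=> j; have := cn j; rewrite /= [b == j]eq_sym; case: eqP => _; last by rewrite add0n.
  by rewrite add1n => -[].
move=> j jS; have := ro j jS; rewrite /= eqxx [b == j]eq_sym; case: eqP => [->|_]; last by rewrite andbF.
by rewrite andbT; case: (ph) (e) phe => [] [] //=; lia.
Qed.

End Automaton.

(** * The generating function of the accepted words *)

Section CountAccepted.
Variables (la : seq nat) (k : nat).
Hypotheses (la_pos : 0%N \notin la) (lak : size la = k).

Definition natw (w : seq ('I_k * bool)) : seq (nat * bool) := [seq (val x.1, x.2) | x <- w].

Definition wsum b ph r S m : {poly rat} :=
  \sum_(w : m.-tuple ('I_k * bool))
     if accepts la b ph r S (natw w) then 'X^(\sum_(x <- w) x.2)%N else 0.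

Lemma wsum0 b ph r S : wsum b ph r S 0 = ((r == 0%N) && (S == [::]))%:R.
Proof.
rewrite /wsum (big_pred1 [tuple]) => [|w]; last by apply/esym/eqP; exact: tuple0.
by rewrite /= big_nil expr0; case: ifP.
Qed.

Definition wstep b ph r S m (b' : 'I_k) (e : bool) : {poly rat} :=
  if r is r'.+1 then
    ('X^e * wsum b e r' S m) *+ ((b' == b :> nat) && (ph || ~~ e))
  else ('X^e * wsum b' true (nth 0%N la b').-1 (rem (val b') S) m)
         *+ ((val b' \in S) && (e == (b' < b)%N)).

Lemma wsumS b ph r S m :
  wsum b ph r S m.+1 = \sum_(b' : 'I_k) \sum_(e : bool) wstep b ph r S m b' e.
Proof.
rewrite {1}/wsum sum_tupleS (eq_bigr (fun x : 'I_k * bool => wstep b ph r S m x.1 x.2)).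
  by rewrite -(pair_bigA _ (wstep b ph r S m)).
case=> b' e _; rewrite /wstep /=; case: r => [|r].
  rewrite /wsum mulr_sumr -sumrMnl; apply: eq_bigr => w _; rewrite big_cons andbA exprD.
  by case: accepts; rewrite ?andbT ?andbF ?mulr0 ?mul0rn //; case: (_ && _); rewrite ?mulr1n ?mulr0n.
rewrite /wsum mulr_sumr -sumrMnl; apply: eq_bigr => w _; rewrite big_cons andbA exprD.
by case: accepts; rewrite ?andbT ?andbF ?mulr0 ?mul0rn //; case: (_ && _); rewrite ?mulr1n ?mulr0n.
Qed.

Lemma qintS r : qint r.+1 = 1 + 'X * qint r.
Proof.
rewrite /qint big_ord_recl expr0 mulr_sumr; congr (_ + _).
by apply: eq_bigr => i _; rewrite -exprS.
Qed.

Lemma count_lt_rem b (S : seq nat) : count (ltn^~ b) (rem b S) = count (ltn^~ b) S.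
Proof.
have [bS|nbS] := boolP (b \in S); last by rewrite rem_id.
by have /seq.permP/(_ (ltn^~ b)) := perm_to_rem bS; rewrite /= ltnn add0n => ->.
Qed.

Lemma count_lt_nth (S : seq nat) i : sorted ltn S -> (i < size S)%N ->
  count (ltn^~ (nth 0%N S i)) S = i.
Proof.
elim: S i => // a S IH [|i] /= sS iS.
  rewrite ltnn (_ : count _ S = 0%N) //; apply/eqP; rewrite -leqn0 leqNgt -has_count.
  apply/hasPn => x xS; rewrite -leqNgt ltnW //.
  by move: sS; rewrite path_sortedE => [/andP[/allP/(_ x xS)]|]; [|exact: ltn_trans].
rewrite IH ?(path_sorted sS) //.
have -> : (a < nth 0%N S i)%N; last by [].
by move: sS; rewrite path_sortedE => [/andP[/allP h _]|]; [apply: h; exact: mem_nth|exact: ltn_trans].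
Qed.

Lemma nth_lt_count (S : seq nat) b i : sorted ltn S -> (i < size S)%N ->
  (nth 0%N S i < b)%N = (i < count (ltn^~ b) S)%N.
Proof.
elim: S i => // a S IH i /= sS; case: (ltnP a b) => ab.
  case: i => [|i] iS /=; first by rewrite ab.
  by rewrite add1n ltnS IH // (path_sorted sS).
have aS : all (fun x => b <= x)%N S.
  apply/allP => x xS; apply: leq_trans ab _; apply: ltnW.
  by move: sS; rewrite path_sortedE => [/andP[/allP/(_ x xS)]|]; [|exact: ltn_trans].
have -> : count (ltn^~ b) S = 0%N.
  apply/eqP; rewrite -leqn0 leqNgt -has_count; apply/hasPn => x /(allP aS).
  by rewrite -leqNgt.
case: i => [|i] iS /=; first by rewrite ltnNge ab.
by rewrite ltnNge (allP aS) // mem_nth.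
Qed.

(** In an arc, steps with [e] true may continue until the root is chosen and none may follow it; its
    r + 1 possible places give [qint r.+1]. The step to the next arc is dictated by the two colours,
    so the order of the arcs is counted by [eul_from], which sees the current colour only through
    the number of smaller unmet ones. *)
Lemma wsumE b ph r S m : (b < k)%N -> sorted ltn S -> {in S, forall j, (j < k)%N} ->
  m = (r + \sum_(j <- S) nth 0%N la j)%N ->
  wsum b ph r S m = (if ph then qint r.+1 else 1) * \prod_(j <- S) qint (nth 0%N la j)
     * eul_from (size S) (count (ltn^~ b) S).
Proof.
have la0 j : (j < k)%N -> (0 < nth 0%N la j)%N.
  by move=> jk; rewrite lt0n; apply: contraNneq la_pos => <-; rewrite mem_nth // lak.
elim: m b ph r S => [|m IH] b ph r S bk sS Sk e.
  rewrite wsum0; case: r e => // e; case: S sS Sk e => [_ _ _|j S _ Sk].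
    by rewrite big_nil /= /qint big_ord1 expr0; case: ph; rewrite !mulr1.
  by rewrite big_cons; have := la0 j (Sk j (mem_head _ _)); lia.
rewrite wsumS /wstep; case: r e => [|r] e; last first.
  rewrite (bigD1 (Ordinal bk)) //= [X in _ + X]big1 ?addr0 => [|b' bb']; last first.
    by apply: big1 => e' _; rewrite -val_eqE /= in bb'; rewrite (negPf bb') mulr0n.
  have em : m = (r + \sum_(j <- S) nth 0%N la j)%N by lia.
  rewrite big_bool /= eqxx !orbT /= !IH // orbF mulr1n.
  by case: ph; rewrite /= ?mulr1n ?mulr0n ?(qintS r.+1) /=; ring.
have uS : uniq S by apply: (sorted_uniq ltn_trans ltnn).
transitivity (\sum_(b' < k | val b' \in S) 'X^(b' < b)%N *
    (qint (nth 0%N la b') * \prod_(j <- rem (val b') S) qint (nth 0%N la j)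
      * eul_from (size S).-1 (count (ltn^~ (val b')) S))).
  rewrite [RHS]big_mkcond; apply: eq_bigr => b' _; case: ifP => b'S; last first.
    by apply: big1 => e' _; rewrite mulr0n.
  have b'k := ltn_ord b'.
  have eb : \sum_(e' : bool) 'X^e' * wsum b' true (nth 0%N la b').-1 (rem (val b') S) m *+ (e' == (b' < b)%N)
     = 'X^(b' < b)%N * wsum b' true (nth 0%N la b').-1 (rem (val b') S) m :> {poly rat}.
    by rewrite big_bool; case: (b' < b)%N; rewrite /= mulr1n mulr0n ?addr0 ?add0r.
  rewrite (eq_bigr (fun e' : bool => 'X^e' * wsum b' true (nth 0%N la b').-1 (rem (val b') S) m
    *+ (e' == (b' < b)%N))) => [|e' _]; last by [].
  rewrite eb IH //.
  - by rewrite prednK ?la0 // size_rem // count_lt_rem.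
  - apply: (subseq_sorted ltn_trans) sS; exact: rem_subseq.
  - by move=> j /mem_rem/Sk.
  by apply: succn_inj; rewrite e add0n (big_rem (val b') b'S) /= -addSn prednK ?la0.
transitivity (\sum_(j <- S) 'X^(j < b)%N * (\prod_(j <- S) qint (nth 0%N la j)
      * eul_from (size S).-1 (count (ltn^~ j) S)) : {poly rat}).
  pose F j : {poly rat} := 'X^(j < b)%N * (\prod_(j <- S) qint (nth 0%N la j)
      * eul_from (size S).-1 (count (ltn^~ j) S)).
  transitivity (\sum_(b' < k | val b' \in S) F b').
    by apply: eq_bigr => b' b'S; rewrite /F [in RHS](big_rem (val b')).
  rewrite -(big_mkord (fun b' => b' \in S) F) -big_filter; apply: perm_big.
  apply: uniq_perm => //; first by rewrite filter_uniq // iota_uniq.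
  by move=> j; rewrite mem_filter mem_index_iota; case: (boolP (j \in S)) => // /Sk.
(* Numbering the unmet colours increasingly makes the choice of the next colour the summation index
   in [eul_from]. *)
set Q := \prod_(j <- S) _; rewrite [LHS](big_nth 0%N) big_mkord.
have S1 : (0 < size S)%N by case: (S) e => //; rewrite big_nil.
have -> c : eul_from (size S) c = \sum_(j < size S) 'X^(j < c)%N * eul_from (size S).-1 j.
  by case: (size S) S1.
have -> : (if ph then qint 1 else 1) = 1 by rewrite /qint big_ord1 expr0 if_same.
rewrite mul1r mulr_sumr; apply: eq_bigr => i _.
by rewrite nth_lt_count // count_lt_nth //; ring.
Qed.

Lemma accepts_head b ph r S w : accepts la b ph r S w -> take r (colors w) = nseq r b.
Proof.
elim: w b ph r S => [|[b' e] w IH] b ph [|r] S //=.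
by case/and3P => /eqP -> _ /IH ->.
Qed.

End CountAccepted.

(** * Cutting the cycle open *)

Section Linearise.
Variables (m K : nat) (la : seq nat).
Hypotheses (sla : sumn la = m.+1) (la_pos : 0%N \notin la) (laK : size la = K.+1) (K0 : (0 < K)%N).
Implicit Type p : {ffun 'I_m.+1 -> 'I_K.+1} * {ffun 'I_m.+1 -> bool}.

(** Vertices numbered by naturals modulo [m.+1], so that the closing edge also goes from [vtx i] to
    [vtx i.+1]. *)
Definition vtx i : 'I_m.+1 := iter i (@ordS m.+1) ord0.

Arguments vtx : simpl never.

Lemma vtxS i : ordS (vtx i) = vtx i.+1. Proof. by []. Qed.

Lemma vtx_small i : (i <= m)%N -> vtx i = i :> nat.
Proof. by move=> im; rewrite /vtx val_iter_ordS add0n modn_small. Qed.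

Lemma vtx_ord (i : 'I_m.+1) : vtx i = i.
Proof. by apply: val_inj; rewrite /= vtx_small // -ltnS. Qed.

Lemma vtx_max : vtx m = ord_max. Proof. by apply: val_inj; rewrite /= vtx_small. Qed.

Lemma vtx_wrap : vtx m.+1 = ord0.
Proof. by apply: val_inj; rewrite [LHS]val_iter_ordS add0n modnn. Qed.

Lemma sum_vtx (F : 'I_m.+1 -> nat) :
  (\sum_x F x = F ord0 + \sum_(i <- iota 1 m) F (vtx i))%N.
Proof.
rewrite big_ord_recl; congr (_ + _)%N.
rewrite -(addn0 1%N) iotaDl big_map -[X in iota 0 X]subn0 -/(index_iota 0 m) big_mkord.
apply: eq_bigr => i _; congr F; apply: val_inj.
by rewrite [RHS](vtx_small (ltn_ord i)).
Qed.

Section OneDatum.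
Variable p : {ffun 'I_m.+1 -> 'I_K.+1} * {ffun 'I_m.+1 -> bool}.
Let C i : nat := p.1 (vtx i).
Let D i : bool := p.2 (vtx i).

(** The letter of vertex i carries the direction at i - 1, which tells whether vertex i precedes
    vertex i - 1. *)
Definition linw a r : seq (nat * bool) :=
  [seq (nat_of_ord (p.1 (vtx i)), p.2 (vtx i.-1)) | i <- iota a.+1 r].

Lemma chain_lin a r : chain (C a) (linw a r) =
  all (fun i => ((C i < C i.+1)%N ==> ~~ D i) && ((C i.+1 < C i)%N ==> D i)) (iota a r).
Proof. by elim: r a => //= r IH a; rewrite -/(linw a.+1 r) -/(C a.+1) IH andbA. Qed.

Lemma nroots_lin j a r ph : C (a + r).+1 != C (a + r) ->
  nroots j (C a) ph (linw a r) =
  ((ph && ~~ ((C a.+1 == C a) && D a) && (C a == j)) +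
   \sum_(i <- iota a.+1 r) (~~ ((C i.-1 == C i) && ~~ D i.-1)
       && ~~ ((C i.+1 == C i) && D i) && (C i == j)))%N.
Proof.
elim: r a ph => [|r IH] a ph h.
  by rewrite addn0 in h; rewrite big_nil addn0 (negPf h) /= andbT.
rewrite /= -/(linw a.+1 r) -/(C a.+1) -/(D a) big_cons /= -/(D a).
rewrite addnS -addSn in h.
rewrite [C a == C a.+1]eq_sym; case: (eqVneq (C a.+1) (C a)) => e /=.
  by rewrite -[X in nroots _ X]e IH // e negbK.
by rewrite IH //= andbT.
Qed.

(** The cut is placed where the largest colour begins, so that the closing edge joins two different
    colours and always rises. *)
Hypotheses (c0 : p.1 ord0 = ord_max) (cm : p.1 ord_max != ord_max).

Lemma color0 : C 0 = K. Proof. by rewrite /C /= c0. Qed.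

Lemma wrap_neq : C (0 + m).+1 != C (0 + m).
Proof. by rewrite add0n /C vtx_wrap vtx_max c0 eq_sym. Qed.

Lemma card_roots_lin (j : 'I_K.+1) :
  #|[set x | (p.1 x == j) && block_root p.1 p.2 x]| = nroots j K true (linw 0 m).
Proof.
transitivity (nroots j (C 0) true (linw 0 m)); last by rewrite color0.
rewrite (nroots_lin _ _ wrap_neq) cardsE -sum1_card big_mkcond sum_vtx.
congr (_ + _)%N.
  have -> : (ord0 \in (fun x => (p.1 x == j) && block_root p.1 p.2 x)) =
      (p.1 ord0 == j) && block_root p.1 p.2 ord0 by [].
  have e0 : ord_pred ord0 = ord_max :> 'I_m.+1 by rewrite -vtx_max -vtx_wrap -vtxS ordSK.
  rewrite block_rootE e0 c0 (negPf cm) /= andbC -c0 -!val_eqE /=.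
  by rewrite -[ordS ord0]/(vtx 1) -/(C 1) -[ord0]/(vtx 0) -/(C 0) -/(D 0); case: (_ && _).
apply: eq_big_seq => i; rewrite mem_iota => /andP[i0 _].
have -> : (vtx i \in (fun x => (p.1 x == j) && block_root p.1 p.2 x)) =
    (p.1 (vtx i) == j) && block_root p.1 p.2 (vtx i) by [].
case: i i0 => // i _; have ep : ord_pred (vtx i.+1) = vtx i by rewrite -vtxS ordSK.
rewrite block_rootE ep vtxS andbC -!val_eqE /= -/(C i) -/(C i.+1) -/(C i.+2) -/(D i) -/(D i.+1).
by case: (_ && _ && _).
Qed.

Lemma card_fiber_lin (j : 'I_K.+1) :
  #|[set x | p.1 x == j]| = ((K == j) + count_mem (val j) (colors (linw 0 m)))%N.
Proof.
rewrite cardsE -sum1_card big_mkcond sum_vtx; congr (_ + _)%N.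
  have -> : (ord0 \in (fun x => p.1 x == j)) = (p.1 ord0 == j) by [].
  by rewrite c0 -val_eqE /=; case: eqP.
rewrite /colors /linw -map_comp count_map -sum1_count [RHS]big_mkcond.
apply: eq_bigr => i _ /=.
by have -> : (vtx i \in (fun x => p.1 x == j)) = (p.1 (vtx i) == j) by [].
Qed.

(** The closing edge rises in colour, which settles the direction at [ord_max]; all other conditions
    are those of [acceptsP]. Vertex 0 is already read, so one vertex less of colour K remains. *)
Lemma valid_lin : valid_data la p =
  ~~ p.2 ord_max && accepts la K true (nth 0%N la K).-1 (iota 0 K) (linw 0 m).
Proof.
have laK0 : (0 < nth 0%N la K)%N.
  by rewrite lt0n; apply: contraNneq la_pos => <-; rewrite mem_nth // laK.
have uI : uniq (iota 0 K) := iota_uniq 0 K.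
have KI : K \notin iota 0 K by rewrite mem_iota add0n ltnn andbF.
have Ila : {in iota 0 K, forall j, (j < size la)%N}.
  by move=> j; rewrite mem_iota laK => /andP[_ jK]; apply: leqW.
have acc := acceptsP la_pos true (nth 0%N la K).-1 (linw 0 m) uI KI Ila.
have V23 : [forall i, (p.1 i < p.1 (ordS i))%N ==> ~~ p.2 i] &&
     [forall i, (p.1 (ordS i) < p.1 i)%N ==> p.2 i] =
     ~~ p.2 ord_max && chain K (linw 0 m).
  have -> : chain K (linw 0 m) = chain (C 0) (linw 0 m) by rewrite color0.
  rewrite chain_lin; apply/andP/andP => [[/forallP h1 /forallP h2]|[h1 /allP h2]].
    split; last by apply/allP => i _; rewrite /C -vtxS; apply/andP.
    apply: (implyP (h1 ord_max)); rewrite -vtx_max vtxS vtx_wrap c0.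
    by have := cm; rewrite -vtx_max -val_eqE /= => h; rewrite ltn_neqAle h -ltnS ltn_ord.
  have H i : ((p.1 i < p.1 (ordS i))%N ==> ~~ p.2 i) && ((p.1 (ordS i) < p.1 i)%N ==> p.2 i).
    have [im|] := ltnP i m.
      have := h2 i; rewrite mem_iota /C /D -vtxS vtx_ord => -> //.
    move=> mi; have -> : i = ord_max by apply: val_inj; apply/eqP; rewrite /= eqn_leq mi -ltnS ltn_ord.
    rewrite h1 implybT /= -{1}vtx_max vtxS vtx_wrap c0 /=.
    by rewrite ltnNge -ltnS ltn_ord.
  by split; apply/forallP => i; case/andP: (H i).
apply/idP/idP.
  rewrite /valid_data => /and4P[/forallP v1 v2 v3 /forallP v4].
  have := V23; rewrite v2 v3 => /esym/andP[-> ch] /=; apply/acc; split=> //.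
    move=> j; have [jK|Kj] := ltnP j K.+1.
      have := v1 (Ordinal jK); rewrite card_fiber_lin /= => /eqP e.
      rewrite mem_iota /= add0n; case: (eqVneq j K) e => [->|jK'] e; first by rewrite -e.
      have -> : (j < K)%N by rewrite ltn_neqAle jK'.
      by rewrite -e.
    rewrite mem_iota /= add0n gtn_eqF // ltnNge ltnW //=.
    apply/count_memPn/negP; rewrite /colors /linw -map_comp => /mapP[i _ /= e].
    by have := ltn_ord (p.1 (vtx i)); rewrite -e ltnNge Kj.
  move=> j jK; have jK' : (j < K.+1)%N.
    by move: jK; rewrite inE mem_iota /= add0n; case/orP => [/eqP ->|/ltnW].
  have := v4 (Ordinal jK'); rewrite card_roots_lin /= => /eqP ->.
  by case: ifP.
case/andP => dm /acc[ch cn ro].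
have := V23; rewrite dm ch /= => /andP[v2 v3].
rewrite /valid_data v2 v3 /=; apply/andP; split; apply/forallP => j.
  rewrite card_fiber_lin cn mem_iota /= add0n; have := ltn_ord j; rewrite ltnS leq_eqVlt.
  rewrite eq_sym; case: (eqVneq (val j) K) => [->|jK] /=; first by rewrite add1n prednK.
  by move=> ->.
rewrite card_roots_lin ro; first by case: ifP.
by rewrite inE mem_iota /= add0n -leq_eqVlt -ltnS.
Qed.

End OneDatum.
End Linearise.

Lemma nth_take_nseq (T : eqType) (x0 b : T) r s i :
  count_mem b s = r -> take r s = nseq r b -> (i < size s)%N ->
  (nth x0 s i == b) = (i < r)%N.
Proof.
move=> cs ts si; have [ir|ri] := ltnP i r.
  by rewrite -(nth_take x0 ir) ts nth_nseq ir eqxx.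
apply/negP => /eqP e.
have : b \in drop r s by rewrite -e -(subnKC ri) -nth_drop mem_nth // size_drop ltn_sub2r // (leq_ltn_trans ri).
rewrite -has_pred1 has_count.
have : (count_mem b (take r s) + count_mem b (drop r s))%N = r by rewrite -count_cat cat_take_drop.
by rewrite ts count_nseq /= eqxx mul1n; lia.
Qed.

(** * Marking the start of the top arc *)

Section Marked.
Variables (m K : nat) (la : seq nat).
Hypotheses (sla : sumn la = m.+1) (la_pos : 0%N \notin la) (laK : size la = K.+1) (K0 : (0 < K)%N).
Implicit Type p : {ffun 'I_m.+1 -> 'I_K.+1} * {ffun 'I_m.+1 -> bool}.

Let r := (nth 0%N la K).-1.

Lemma laK_gt0 : (0 < nth 0%N la K)%N.
Proof. by rewrite lt0n; apply: contraNneq la_pos => <-; rewrite mem_nth // laK. Qed.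

Lemma accepts_top w i : accepts la K true r (iota 0 K) w -> (i < size w)%N ->
  (nth 0%N (colors w) i == K) = (i < r)%N.
Proof.
move=> ac iw.
have KI : K \notin iota 0 K by rewrite mem_iota add0n ltnn andbF.
have Ila : {in iota 0 K, forall j, (j < size la)%N}.
  by move=> j; rewrite mem_iota laK => /andP[_ jK]; apply: leqW.
have [_ cn _] := (acceptsP la_pos true r w (iota_uniq 0 K) KI Ila).1 ac.
have := cn K; rewrite eqxx => cK.
by apply: nth_take_nseq; rewrite ?size_map // (accepts_head ac).
Qed.

Lemma top_part_small : (r < m)%N.
Proof.
have lK : (K < size la)%N by rewrite laK.
have l0 : (0 < size la)%N by rewrite laK.
have : (0 < nth 0%N la 0)%N by rewrite lt0n; apply: contraNneq la_pos => <-; rewrite mem_nth.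
have := laK_gt0; rewrite /r; move: sla; rewrite sumnE (big_nth 0%N) big_mkord.
rewrite (bigD1 (Ordinal lK)) // (bigD1 (Ordinal l0)) /=; last by rewrite -val_eqE /=; lia.
by move: (\sum_(i < _ | _) _)%N => t; lia.
Qed.

Definition mark p : pred 'I_m.+1 := fun i => (p.1 i == ord_max) && (p.1 (ord_pred i) != ord_max).

Lemma ord_pred0 : ord_pred ord0 = ord_max :> 'I_m.+1.
Proof. by apply: val_inj; rewrite /= modn_small. Qed.

Lemma top_color p i : valid_data la p -> mark p ord0 -> (p.1 i == ord_max) = (i <= r)%N.
Proof.
rewrite /mark ord_pred0 => vp /andP[/eqP c0 cm].
have := vp; rewrite (valid_lin la_pos laK c0 cm) => /andP[_ ac].
have [i0|i0] := posnP i; first by rewrite i0 leq0n (_ : i = ord0) ?c0 ?eqxx //; apply: val_inj.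
have im : (i.-1 < m)%N by have := ltn_ord i; lia.
have := @accepts_top _ i.-1 ac; rewrite /linw size_map size_iota => /(_ im).
rewrite /colors -map_comp (nth_map 0%N) ?size_iota // nth_iota // add1n prednK //= vtx_ord.
by rewrite -val_eqE /= => ->; lia.
Qed.

Lemma mark0_uniq p i : valid_data la p -> mark p ord0 -> mark p i -> i = ord0.
Proof.
move=> vp m0; rewrite {1}/mark !(top_color _ vp m0).
have [i0 _|i0] := posnP i; first exact: val_inj.
by rewrite val_ord_pred //; lia.
Qed.

Lemma mark_rot p i : mark (rot_data p) i = mark p (ordS i).
Proof. by rewrite /mark !ffunE ord_predK ordSK. Qed.

(** A mark exists since colours K and 0 both occur: without one, every vertex before a vertex of
    colour K would have colour K. For uniqueness a mark is rotated to 0, where the automaton shows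
    that colour K fills an initial stretch. *)
Lemma card_mark p : valid_data la p -> #|mark p| = 1%N.
Proof.
move=> vp; apply/eqP.
have [i mi] : exists i, mark p i.
  have vK := vp; have := and4P vK => -[/forallP v1 _ _ _].
  have fib (j : 'I_K.+1) : exists x, p.1 x = j.
    have : (0 < #|[set x | p.1 x == j]|)%N.
      by rewrite (eqP (v1 j)) lt0n; apply: contraNneq la_pos => <-; rewrite mem_nth // laK.
    by case/card_gt0P => x; rewrite inE => /eqP; exists x.
  have [x xK] := fib ord_max; have [y y0] := fib ord0.
  apply/existsP; apply: contraT; rewrite negb_exists => /forallP nm.
  have [k ky] := ord_pred_reach x y.
  have : p.1 y = ord_max.
    rewrite -ky; elim: k {ky} => //= k IH.
    by have := nm (iter k (@ord_pred _) x); rewrite /mark IH eqxx negbK => /eqP.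
  by rewrite y0 => /(congr1 val) /= K00; have := K0; rewrite -K00.
have [k ki] := ordS_reach ord0 i.
have rotk q : (forall j, mark (iter k (@rot_data _ _) q) j = mark q (iter k (@ordS _) j)) /\
   valid_data la (iter k (@rot_data _ _) q) = valid_data la q.
  elim: k {ki} => //= k [IH1 IH2]; split=> [j|]; last by rewrite valid_rot.
  by rewrite mark_rot IH1 -iterSr.
have [mk vk] := rotk p.
rewrite (eq_card1 (x := i)) // => j; apply/idP/eqP => [mj|-> //].
have ex : exists j', iter k (@ordS _) j' = j.
  by elim: k {ki mk vk rotk} => [|k [j' <-]]; [exists j | exists (ord_pred j'); rewrite iterSr ord_predK].
have [j' ej] := ex; rewrite -ki -ej; congr iter.
by apply: (@mark0_uniq (iter k (@rot_data _ _) p)); rewrite ?vk ?mk ?ki ?ej.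
Qed.

(** Colour of vertex 0 and direction of the closing edge are forced by the cut; letter j of the word
    gives the colour of vertex j + 1 and the direction at j. *)
Definition data_of (w : m.-tuple ('I_K.+1 * bool)) :
    {ffun 'I_m.+1 -> 'I_K.+1} * {ffun 'I_m.+1 -> bool} :=
  ([ffun i => if unlift ord0 i is Some j then (tnth w j).1 else ord_max],
   [ffun i => if unlift ord_max i is Some j then (tnth w j).2 else false]).

Definition data_word p : m.-tuple ('I_K.+1 * bool) :=
  [tuple (p.1 (lift ord0 i), p.2 (lift ord_max i)) | i < m].

Lemma data_ofK : cancel data_of data_word.
Proof.
move=> w; apply: eq_from_tnth => i; rewrite tnth_mktuple !ffunE !liftK.
by case: (tnth w i).
Qed.

Lemma data_wordK p : p.1 ord0 = ord_max -> ~~ p.2 ord_max -> data_of (data_word p) = p.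
Proof.
case: p => c d /= c0 dm; congr (_, _); apply/ffunP => i; rewrite ffunE.
  by case: unliftP => [j ->|->]; rewrite ?tnth_mktuple.
by case: unliftP => [j ->|->]; rewrite ?tnth_mktuple // (negPf dm).
Qed.

Lemma linw_data_word p : linw p 0 m = natw (data_word p).
Proof.
rewrite /linw /natw /= -map_comp -(addn0 1%N) iotaDl -map_comp -val_enum_ord -map_comp.
apply: eq_map => i /=; congr (nat_of_ord (p.1 _), p.2 _).
  by apply: val_inj; exact: (vtx_small (ltn_ord i)).
by apply: val_inj; apply: etrans (vtx_small (ltnW (ltn_ord i))) _; exact/esym/lift_max.
Qed.

Lemma weight_data_of w : (\sum_i (data_of w).2 i = \sum_(x <- w) x.2)%N.
Proof.
rewrite big_ord_recr /= ffunE unlift_none addn0 big_tuple.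
apply: eq_bigr => i _; rewrite ffunE.
have -> : widen_ord (leqnSn m) i = lift ord_max i by apply: val_inj; exact/esym/lift_max.
by rewrite liftK.
Qed.

Lemma valid_data_of w :
  valid_data la (data_of w) && mark (data_of w) ord0 = accepts la K true r (iota 0 K) (natw w).
Proof.
have c0 : (data_of w).1 ord0 = ord_max by rewrite ffunE unlift_none.
have dm : ~~ (data_of w).2 ord_max by rewrite ffunE unlift_none.
have lw : linw (data_of w) 0 m = natw w by rewrite linw_data_word data_ofK.
rewrite /mark ord_pred0 c0 eqxx /=; have [cm|cm] := boolP ((data_of w).1 ord_max == ord_max).
  (* The top colour fills only the first r letters of an accepted word, and r < m because other
     parts exist; so the last vertex has another colour. *)
  rewrite andbF; apply/esym/negP => ac.
  have m0 := leq_ltn_trans (leq0n _) top_part_small.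
  have := @accepts_top _ m.-1 ac; rewrite size_map size_tuple prednK // leqnn => /(_ isT).
  rewrite -lw /colors /linw -map_comp (nth_map 0%N) ?size_iota ?prednK // nth_iota ?prednK //.
  by rewrite add1n prednK //= vtx_max (eqP cm) eqxx => /esym; rewrite leqNgt top_part_small.
by rewrite andbT (valid_lin la_pos laK c0 cm) dm lw.
Qed.

Lemma sum_valid :
  \sum_(p : {ffun 'I_m.+1 -> 'I_K.+1} * {ffun 'I_m.+1 -> bool} | valid_data la p)
     'X^(\sum_i p.2 i)%N = m.+1%:R * 'X * eulerian K * \prod_(l <- la) qint l :> {poly rat}.
Proof.
rewrite (@sum_marked m _ (valid_data la) mark (@rot_data _ _)); last first.
- exact: card_mark.
- exact: mark_rot.
- by move=> p; rewrite weight_rot.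
- exact: valid_rot.
- exact: rot_data_inj.
rewrite -!mulrA; congr (_ * _).
transitivity (wsum la K.+1 K true r (iota 0 K) m).
  rewrite (reindex_onto data_of data_word) /=; last first.
    move=> p /andP[vp mp]; apply: data_wordK; first by case/andP: mp => /eqP.
    have := mp; rewrite /mark ord_pred0 => /andP[/eqP c0 cm].
    by have := vp; rewrite (valid_lin la_pos laK c0 cm) => /andP[].
  rewrite /wsum big_mkcond; apply: eq_bigr => w _.
  by rewrite data_ofK eqxx andbT valid_data_of weight_data_of.
have laE (R : Type) (idx : R) (op : Monoid.com_law idx) (F : nat -> R) :
    \big[op/idx]_(l <- la) F l = op (F (nth 0%N la K)) (\big[op/idx]_(j <- iota 0 K) F (nth 0%N la j)).
  rewrite (big_nth 0%N) laK big_nat_recr //= Monoid.mulmC.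
  by rewrite /index_iota subn0.
rewrite wsumE ?iota_ltn_sorted //; last 2 first.
- by move=> j; rewrite mem_iota => /andP[_ /ltnW].
- apply: succn_inj; rewrite -sla sumnE laE -addSn prednK //; exact: laK_gt0.
rewrite prednK ?laK_gt0 // laE size_iota.
have -> : count (ltn^~ K) (iota 0 K) = K.
  rewrite -[RHS](size_iota 0); apply/eqP; rewrite -all_count; apply/allP => j.
  by rewrite mem_iota.
(* The walk starts at the largest colour with all K others smaller. Its first change of colour is a
   descent, which produces the factor t in front of A_K. *)
case: K K0 => // k _; rewrite eul_from_top -eulerianE.
by rewrite /=; ring.
Qed.

End Marked.

Theorem theorem6 (n : nat) (hn : (2 <= n)%N) :
  (forall la : seq nat, is_partn n la -> (2 <= size la)%N ->
     \sum_(s in Nset (@cycle_digraph n) la) 'X^(inv_digraph (@cycle_digraph n) s)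
     = n%:R * 'X * eulerian (size la).-1 * \prod_(l <- la) qint l :> {poly rat})
  /\ \sum_(s in Nset (@cycle_digraph n) [:: n]) 'X^(inv_digraph (@cycle_digraph n) s)
     = n%:R * 'X * qint n.-1 :> {poly rat}
  /\ (forall c : seq nat -> {poly rat},
        omega (chromatic (@cycle_digraph n)) = psum_expansion n c
        <-> c [:: n] = n%:R * 'X * qint n.-1
            /\ (forall la : seq nat, is_partn n la -> la <> [:: n] ->
                  c la = n%:R * 'X * eulerian (size la).-1
                         * \prod_(l <- la) qint l)).
Proof.
split=> [la /and3P[_ la_pos /eqP sla] la2|].
  case: n hn sla => // m hn sla.
  have laK : size la = (size la).-1.+1 by rewrite prednK // ltnW.
  have K0 : (0 < (size la).-1)%N by rewrite -ltnS -laK.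
  by rewrite (sum_Nset hn sla la_pos laK) (sum_valid sla la_pos laK K0).
split; last by move=> c; apply: omega_chromatic_cycle; apply: ltnW.
case: n hn => // m hn; have m0 : (0 < m)%N by [].
rewrite (@sum_Nset _ 0 [:: m.+1]) ?sum_valid_one_block //= ?addn0 //.
Qed.
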